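(* Let $\mathbf{k}$ be a field, let $n\ge 1$ be an integer, and let $G$ be a finite group acting on a finite bounded graded poset $P$ of rank $n+1$ by order preserving bijections. Then for every positive integer $t$, $$\beta\big((P^-\ast T_{t,n})_{-}\big)\ \cong_G\ \sum_{S\in \mathrm{Stab}([n-1])}\beta_P([n]\smallsetminus S)\,t^{|S|}(1+t)^{n-2|S|}\ +\ \sum_{S\in \mathrm{Stab}([n-2])}\beta_P([n-1]\smallsetminus S)\,t^{|S|+1}(1+t)^{n-1-2|S|}$$ and $$\beta\big(\bar P\ast T_{t,n-1}\big)\ \cong_G\ \sum_{S\in \mathrm{Stab}([2,n-2])}\beta_P([n-1]\smallsetminus S)\,t^{|S|+1}(1+t)^{n-2-2|S|}\ +\ \sum_{S\in \mathrm{Stab}([2,n-1])}\beta_P([n]\smallsetminus S)\,t^{|S|}(1+t)^{n-1-2|S|}.$$ Moreover, if $P$ is Cohen--Macaulay over $\mathbf{k}$, then the left-hand sides of these two formulas may be replaced by the $G$-representations $\widetilde H_{n-1}((P^-\ast T_{t,n})_{-};\mathbf{k})$ and $\widetilde H_{n-1}(\bar P\ast T_{t,n-1};\mathbf{k})$, respectively, and all representations which appear in these formulas are non-virtual.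
   Context: Notation: $[m]=\{1,\dots,m\}$ (empty if $m\le 0$); $[a,b]=\{a,a+1,\dots,b\}$ (empty if $a>b$). For $\Theta\subseteq\mathbb{Z}$, $\mathrm{Stab}(\Theta)$ is the set of all subsets of $\Theta$ which do not contain two consecutive integers (so $\mathrm{Stab}(\varnothing)=\{\varnothing\}$). Convention for the degenerate case $n=1$: the first sum on the right-hand side of the second formula is read as $0$. All posets are finite. A poset is graded if all its maximal chains have the same length, and bounded if it has a minimum $\hat 0$ and a maximum $\hat 1$. The rank function of a graded poset takes the value $0$ on all minimal elements. For a graded bounded poset $P$ of rank $n+1$ with rank function $\rho$ and $S\subseteq[n]$, put $P_S=\{x\in P:\rho(x)\in S\}\cup\{\hat 0,\hat 1\}$. If $G$ acts on $P$ by order preserving bijections, $\alpha_P(S)$ is the permutation representation of $G$ over $\mathbf{k}$ on the set of maximal chains of $P_S$, and $\beta_P(S)=\sum_{T\subseteq S}(-1)^{|S\smallsetminus T|}\alpha_P(T)$, a virtual $G$-representation. Virtual $G$-representations are elements of the Grothendieck group of finite-dimensional $G$-representations over $\mathbf{k}$, $\cong_G$ (isomorphism of $G$-representations) is equality there, integer coefficients denote multiplicities, and a virtual representation is non-virtual if it is the class of an actual representation. $P^-$, $P_-$ and $\bar P$ are obtained from $P$ by removing the maximum, the minimum, or both, respectively (the notation $X_-$ is also used for any poset $X$ with a minimum element). For a graded $G$-poset $X$ of the form $X=\bar Q$, where $Q$ is a bounded graded $G$-poset of rank $n+1$ (that is, $Q$ is $X$ with a new minimum and a new maximum element added, both fixed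 by $G$), we write $\beta(X):=\beta_Q([n])$. $T_{t,n}$ is the poset whose Hasse diagram is a complete $t$-ary tree of height $n$ rooted at the minimum element (every element of rank less than $n$ is covered by exactly $t$ elements, and every non-minimum element covers exactly one element). For graded posets $P,Q$ with rank functions $\rho_P,\rho_Q$, the Rees product is $P\ast Q=\{(p,q)\in P\times Q:\rho_P(p)\ge\rho_Q(q)\}$, with $(p_1,q_1)\preceq(p_2,q_2)$ iff $p_1\preceq p_2$, $q_1\preceq q_2$ and $\rho_P(p_2)-\rho_P(p_1)\ge\rho_Q(q_2)-\rho_Q(q_1)$. If $G$ acts on $P$, it acts on $P\ast Q$ by $g\cdot(p,q)=(g\cdot p,q)$. Note that in $\bar P$, regarded as a graded poset on its own, the atoms of $P$ have rank $0$. Homology of a poset means simplicial homology of its order complex. A bounded graded poset is Cohen--Macaulay over $\mathbf{k}$ if for all $x<y$ in it the reduced homology over $\mathbf{k}$ of the order complex of the open interval $(x,y)$ vanishes in all degrees below the dimension of that complex. *)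

(* Defs.v *)
From HB Require Import structures.
From mathcomp Require Import all_boot all_order all_fingroup all_algebra.
From mathcomp Require Import ring_quotient mxrepresentation.
From mathcomp Require Import finmap freeg boolp zify.

Set Implicit Arguments.
Unset Strict Implicit.
Unset Printing Implicit Defensive.

Import Order.TTheory GRing.Theory.

Local Open Scope ring_scope.

Section Grothendieck.
Variables (k : fieldType) (G : finGroupType).

Definition rep := {d : nat & mx_representation k [set: G] d}.

HB.instance Definition _ := gen_eqMixin rep.
HB.instance Definition _ := gen_choiceMixin rep.

Definition Rep d (V : mx_representation k [set: G] d) : rep := existT _ d V.

(* As everywhere in mxrepresentation, representations act on row vectors:    *)
(* f and g are the matrices of v |-> v *m f and v |-> v *m g in              *)
(* 0 -> U -> V -> W -> 0.                                                    *)
Definition short_exact (U V W : rep) : Prop :=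
  exists (f : 'M[k]_(tag U, tag V)) (g : 'M[k]_(tag V, tag W)),
    [/\ forall x : G, tagged U x *m f = f *m tagged V x,
        forall x : G, tagged V x *m g = g *m tagged W x,
        row_free f, row_full g & (f == kermx g)%MS].

Inductive K0_relation : {freeg rep / int} -> Prop :=
| K0_relation_exact U V W of short_exact U V W :
    K0_relation (<< V >> - << U >> - << W >>)
| K0_relation0 : K0_relation 0
| K0_relationB x y of K0_relation x & K0_relation y : K0_relation (x - y).

Definition K0_null : {pred {freeg rep / int}} := fun x => `[< K0_relation x >].

Lemma K0_null_zmod_closed : zmod_closed K0_null.
Proof.
split=> [|x y /asboolP Kx /asboolP Ky]; apply/asboolP.
  exact: K0_relation0.
exact: K0_relationB.
Qed.

HB.instance Definition _ :=
  GRing.isZmodClosed.Build {freeg rep / int} K0_null K0_null_zmod_closed.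

Definition K0 : zmodType := Quotient.quot (K0_null : zmodClosed _).

Definition K0_class d (V : mx_representation k [set: G] d) : K0 :=
  \pi_(Quotient.quot (K0_null : zmodClosed _))%qT << Rep V >>.

Definition nonvirtual (x : K0) : Prop :=
  exists d (V : mx_representation k [set: G] d), x = K0_class V.

End Grothendieck.

Section PermRepr.
Variables (k : fieldType) (G : finGroupType) (T : finType).
Variable to : {action G &-> T}.

Definition perm_repr_mx (g : G) : 'M[k]_#|T| :=
  \matrix_(i, j) (to (enum_val i) g == enum_val j)%:R.

Lemma perm_repr_mxE g (M : 'M[k]_#|T|) i j :
  (perm_repr_mx g *m M) i j = M (enum_rank (to (enum_val i) g)) j.
Proof.
rewrite mxE (bigD1 (enum_rank (to (enum_val i) g))) //= mxE enum_rankK eqxx.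
rewrite mul1r big1 ?addr0 // => l; rewrite mxE.
by move=> neq_l; rewrite (_ : _ == _ = false) ?mul0r //; apply: contra_neqF neq_l
  => /eqP->; rewrite enum_valK.
Qed.

Lemma perm_repr_mx_repr : mx_repr [set: G] perm_repr_mx.
Proof.
split=> [|g h _ _]; apply/matrixP=> i j.
  by rewrite !mxE act1 (inj_eq enum_val_inj).
by rewrite perm_repr_mxE !mxE enum_rankK actM.
Qed.

Definition perm_repr := MxRepresentation perm_repr_mx_repr.

End PermRepr.

Section SubAction.
Variables (G : finGroupType) (T : finType) (to : {action G &-> T}).
Variables (p : pred T) (to_p : forall g x, p x -> p (to x g)).

Definition sub_act (x : {x | p x}) (g : G) : {x | p x} :=
  exist _ (to (val x) g) (to_p g (valP x)).

Lemma sub_act_is_action : is_action [set: G] sub_act.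
Proof.
split=> [g x y /(congr1 val)/= /act_inj/val_inj //|x g h _ _].
by apply: val_inj; rewrite /= actM.
Qed.

Definition sub_action : {action G &-> {x | p x}} := Action sub_act_is_action.

End SubAction.

Section Poset.
Variables (d : Order.disp_t) (X : finPOrderType d).
Implicit Types (C D : {set X}) (x y : X).

Definition chain C := [forall x in C, forall y in C, (x >=< y)%O].

(* The largest length of a chain with maximum x; when all maximal chains     *)
(* have the same length this is the rank function.                           *)
Definition rank x : nat :=
  \max_(C : {set X} | chain C && [forall y in C, (y < x)%O]) #|C|.

Definition max_chains (A : {set X}) : {set {set X}} :=
  [set C | maxset [pred D | chain D && (D \subset A)] C].

Definition graded (r : nat) : Prop :=
  forall C, C \in max_chains [set: X] -> #|C| = r.+1.

Definition is_min x := [forall y, (x <= y)%O].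
Definition is_max x := [forall y, (y <= x)%O].

Section Homology.
Variable k : fieldType.

(* Simplices of the order complex are oriented by the order of X.  The j-th  *)
(* vertex x of a chain C is the one with j elements of C below it.  All      *)
(* subsets of X serve as indices; chain_mx selects the chains with m         *)
(* elements, i.e. the simplices of dimension m - 1 (the empty one if m = 0). *)
Definition boundary_coef (C D : {set X}) : k :=
  \sum_(x in C | D == C :\ x) (-1) ^+ #|[set y in C | (y < x)%O]|.

Definition boundary_mx : 'M[k]_#|{set X}| :=
  \matrix_(i, j) boundary_coef (enum_val i) (enum_val j).

Definition is_simplex (m : nat) (C : {set X}) := chain C && (#|C| == m).

Definition chain_mx (m : nat) : 'M[k]_#|{set X}| :=
  diag_mx (\row_i (is_simplex m (enum_val i))%:R).

(* Row spaces of (m-1)-dimensional reduced cycles and boundaries.            *)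
Definition cycles (m : nat) : 'M[k]_#|{set X}| :=
  (chain_mx m :&: kermx boundary_mx)%MS.
Definition boundaries (m : nat) : 'M[k]_#|{set X}| :=
  chain_mx m.+1 *m boundary_mx.

(* Vanishing of the reduced homology in all degrees m - 1 below the          *)
(* dimension (largest number of elements of a chain, minus 1).               *)
Definition homology_only_on_top : Prop :=
  forall m, (m < \max_(C : {set X} | chain C) #|C|)%N ->
    (cycles m <= boundaries m)%MS.

End Homology.
End Poset.

Section Subposet.
Variables (d : Order.disp_t) (X : finPOrderType d) (p : pred X).

Definition subposet := {x : X | p x}.

HB.instance Definition _ := SubFinite.on subposet.
HB.instance Definition _ :=
  [SubChoice_isSubPOrder of subposet by <: with d].

End Subposet.

Definition open_interval d (X : finPOrderType d) (x y : X) :=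
  subposet (fun z : X => x < z < y)%O.

Definition cohen_macaulay (k : fieldType) d (X : finPOrderType d) : Prop :=
  forall x y : X, (x < y)%O -> homology_only_on_top (open_interval x y) k.

Definition remove_min d (X : finPOrderType d) :=
  subposet (fun x : X => ~~ is_min x).
Definition remove_max d (X : finPOrderType d) :=
  subposet (fun x : X => ~~ is_max x).
Definition remove_both d (X : finPOrderType d) :=
  subposet (fun x : X => ~~ is_min x && ~~ is_max x).

Variant adjoined (T : Type) := Bot | In of T | Top.
Arguments Bot {T}.
Arguments Top {T}.

Section Adjoined.
Variables (d : Order.disp_t) (X : finPOrderType d).

Definition adjoined_code (u : adjoined X) : option (option X) :=
  match u with Bot => None | Top => Some None | In x => Some (Some x) end.
Definition adjoined_decode (v : option (option X)) : adjoined X :=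
  match v with None => Bot | Some None => Top | Some (Some x) => In x end.
Lemma adjoined_codeK : cancel adjoined_code adjoined_decode.
Proof. by case. Qed.

HB.instance Definition _ := Finite.copy (adjoined X) (can_type adjoined_codeK).

Definition adjoined_le (u v : adjoined X) : bool :=
  match u, v with
  | Bot, _ | _, Top => true
  | In x, In y => (x <= y)%O
  | _, _ => false
  end.

Lemma adjoined_le_refl : reflexive adjoined_le.
Proof. by case=> //= x; exact: lexx. Qed.
Lemma adjoined_le_anti : antisymmetric adjoined_le.
Proof. by case=> [|x|] [|y|] //= /le_anti->. Qed.
Lemma adjoined_le_trans : transitive adjoined_le.
Proof. by case=> [|y|] [|x|] [|z|] //=; exact: le_trans. Qed.

HB.instance Definition _ := Order.Le_isPOrder.Build d (adjoined X)
  adjoined_le_refl adjoined_le_anti adjoined_le_trans.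

Lemma adjoined_le0x u : (Bot <= u :> adjoined X)%O. Proof. by case: u. Qed.
Lemma adjoined_lex1 u : (u <= Top :> adjoined X)%O. Proof. by case: u. Qed.

HB.instance Definition _ := Order.hasBottom.Build d (adjoined X) adjoined_le0x.
HB.instance Definition _ := Order.hasTop.Build d (adjoined X) adjoined_lex1.

End Adjoined.

Section Rees.
Variables (d1 d2 : Order.disp_t) (X : finPOrderType d1) (Y : finPOrderType d2).

Definition rees := {u : X * Y | (rank u.2 <= rank u.1)%N}.

HB.instance Definition _ := SubFinite.on rees.

(* The last condition is rank q2 - rank q1 <= rank p2 - rank p1, without     *)
(* truncated subtractions.                                                   *)
Definition rees_le (u v : rees) : bool :=
  let: (p1, q1) := val u in let: (p2, q2) := val v in
  [&& (p1 <= p2)%O, (q1 <= q2)%O & (rank q2 + rank p1 <= rank p2 + rank q1)%N].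

Lemma rees_le_refl : reflexive rees_le.
Proof. by case=> [[p q] /= ?]; rewrite /rees_le /= !lexx addnC leqnn. Qed.
Lemma rees_le_anti : antisymmetric rees_le.
Proof.
move=> [[p1 q1] i1] [[p2 q2] i2]; rewrite /rees_le /=.
case/andP=> /and3P[p12 q12 _] /and3P[p21 q21 _]; apply: val_inj => /=.
by congr pair; apply: le_anti; apply/andP.
Qed.
Lemma rees_le_trans : transitive rees_le.
Proof.
move=> [[p2 q2] i2] [[p1 q1] i1] [[p3 q3] i3]; rewrite /rees_le /=.
case/and3P=> p12 q12 r12 /and3P[p23 q23 r23].
rewrite (le_trans p12 p23) (le_trans q12 q23) /=.
lia.
Qed.

HB.instance Definition _ := Order.Le_isPOrder.Build d1 rees
  rees_le_refl rees_le_anti rees_le_trans.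

End Rees.

(* Nodes are the words of length at most n over a t-letter alphabet; the     *)
(* children of a node are obtained by appending a letter.                    *)
Section Tree.
Variables t n : nat.

Definition tree := n.-bseq 'I_t.

HB.instance Definition _ := SubFinite.on tree.

Definition tree_le (u v : tree) : bool := prefix u v.

Lemma tree_le_refl : reflexive tree_le.
Proof. by move=> u; exact: prefix_refl. Qed.
Lemma tree_le_anti : antisymmetric tree_le.
Proof.
move=> u v /andP[/prefixP[s1 e1] /prefixP[s2 e2]]; apply: val_inj => /=.
have := congr1 size e2; rewrite [in RHS]e1 !size_cat -addnA -[LHS]addn0.
by move/addnI/esym/eqP; rewrite addn_eq0 => /andP[/nilP s10 _]; rewrite e1 s10 cats0.
Qed.
Lemma tree_le_trans : transitive tree_le.
Proof. by move=> v u w; exact: prefix_trans. Qed.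

HB.instance Definition _ :=
  Order.Le_isPOrder.Build (Order.Disp tt tt) tree
    tree_le_refl tree_le_anti tree_le_trans.

End Tree.

(* Actions are right actions, in agreement with representations on row       *)
(* vectors; a left action of G is a right action through g |-> g^-1.         *)
Record poset_action (G : finGroupType) d (X : finPOrderType d) := PosetAction {
  pact :> {action G &-> X};
  pact_homo : forall g, {homo pact^~ g : x y / (x <= y)%O}
}.

Section PosetActionTheory.
Variables (G : finGroupType) (d : Order.disp_t) (X : finPOrderType d).
Variable to : poset_action G X.
Implicit Types (x y : X) (g : G) (C D : {set X}).

Lemma pact_mono g : {mono to^~ g : x y / (x <= y)%O}.
Proof.
move=> x y; apply/idP/idP => [|/(pact_homo to g)//].
by move/(pact_homo to g^-1); rewrite !actK.
Qed.

Lemma pact_lt g : {mono to^~ g : x y / (x < y)%O}.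
Proof. by move=> x y; rewrite !lt_neqAle pact_mono (inj_eq (act_inj to g)). Qed.

Lemma mem_pact g C x : (to x g \in (to^*)%act C g) = (x \in C).
Proof. exact: (mem_imset C x (act_inj to g)). Qed.

Lemma pact_chain g C : chain ((to^*)%act C g) = chain C.
Proof.
apply/'forall_implyP/'forall_implyP => cC x Cx; apply/'forall_implyP => y Cy.
  have := cC (to x g); rewrite mem_pact => /(_ Cx)/'forall_implyP/(_ (to y g)).
  by rewrite mem_pact => /(_ Cy); rewrite /Order.comparable !pact_mono.
case/imsetP: Cx Cy => {}x Cx -> /imsetP[{}y Cy ->].
have /'forall_implyP/(_ y Cy) := cC x Cx.
by rewrite /Order.comparable !pact_mono.
Qed.

Lemma pact_card g C : #|(to^*)%act C g| = #|C|.
Proof. exact: card_setact. Qed.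

Lemma pact_rank g x : rank (to x g) = rank x.
Proof.
rewrite /rank (reindex_inj (act_inj (to^*)%act g)) /=.
apply: eq_big => [C|C _]; last exact: pact_card.
rewrite pact_chain; congr (_ && _); apply/'forall_implyP/'forall_implyP.
  by move=> C_lt y Cy; have := C_lt (to y g); rewrite mem_pact pact_lt; apply.
by move=> C_lt _ /imsetP[y Cy ->]; rewrite pact_lt; exact: C_lt.
Qed.

Lemma pact_is_min g x : is_min (to x g) = is_min x.
Proof.
apply/forallP/forallP => le_x y; last by rewrite -(pact_mono g^-1) actK.
by rewrite -(pact_mono g).
Qed.

Lemma pact_is_max g x : is_max (to x g) = is_max x.
Proof.
apply/forallP/forallP => le_x y; last by rewrite -(pact_mono g^-1) actK.
by rewrite -(pact_mono g).
Qed.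

Lemma pact_max_chains (A : {set X}) g C :
    (forall h x, x \in A -> to x h \in A) ->
  C \in max_chains A -> (to^*)%act C g \in max_chains A.
Proof.
move=> toA; have sub_act h D : D \subset A -> (to^*)%act D h \subset A.
  by move=> sDA; apply/subsetP=> _ /imsetP[x Dx ->]; exact/toA/(subsetP sDA).
rewrite !inE => /maxsetP[/andP[cC sCA] maxC]; apply/maxsetP; split=> [|D].
  by rewrite /= pact_chain cC sub_act.
case/andP=> cD sDA sCD; rewrite -[D](actKV (to^*)%act g); congr ((to^*)%act _ g).
apply: maxC; first by rewrite /= pact_chain cD sub_act.
by rewrite -[C](actK (to^*)%act g); exact: imsetS.
Qed.

Section Sub.
Variables (p : pred X) (to_p : forall g x, p x -> p (to x g)).

Lemma sub_pact_homo g :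
  {homo (sub_action to_p : {action G &-> subposet p})^~ g : x y / (x <= y)%O}.
Proof. by move=> x y; exact: (pact_homo to g). Qed.

Definition sub_pact : poset_action G (subposet p) := PosetAction sub_pact_homo.

End Sub.

Lemma remove_min_stable g x : ~~ is_min x -> ~~ is_min (to x g).
Proof. by rewrite pact_is_min. Qed.
Lemma remove_max_stable g x : ~~ is_max x -> ~~ is_max (to x g).
Proof. by rewrite pact_is_max. Qed.
Lemma remove_both_stable g x :
  ~~ is_min x && ~~ is_max x -> ~~ is_min (to x g) && ~~ is_max (to x g).
Proof. by rewrite pact_is_min pact_is_max. Qed.

Definition act_remove_min : poset_action G (remove_min X) :=
  sub_pact remove_min_stable.
Definition act_remove_max : poset_action G (remove_max X) :=
  sub_pact remove_max_stable.
Definition act_remove_both : poset_action G (remove_both X) :=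
  sub_pact remove_both_stable.

Definition adjoined_act (u : adjoined X) (g : G) : adjoined X :=
  match u with Bot => Bot | Top => Top | In x => In (to x g) end.

Lemma adjoined_is_action : is_action [set: G] adjoined_act.
Proof.
split=> [g [|x|] [|y|] //= [/act_inj->] //|[|x|] g h _ _ //=].
by rewrite actM.
Qed.

Definition adjoined_action : {action G &-> adjoined X} :=
  Action adjoined_is_action.

Lemma adjoined_act_homo g : {homo adjoined_action^~ g : u v / (u <= v)%O}.
Proof. by case=> [|x|] [|y|] //; exact: (pact_homo to g). Qed.

Definition act_adjoined : poset_action G (adjoined X) :=
  PosetAction adjoined_act_homo.

Section Rees.
Variables (e : Order.disp_t) (Y : finPOrderType e).

Lemma rees_act_subproof g (u : rees X Y) :
  (rank (val u).2 <= rank (to (val u).1 g))%N.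
Proof. by rewrite pact_rank (valP u). Qed.

Definition rees_act (u : rees X Y) (g : G) : rees X Y :=
  exist (fun w : X * Y => rank w.2 <= rank w.1)%N
    (to (val u).1 g, (val u).2) (rees_act_subproof g u).

Lemma rees_is_action : is_action [set: G] rees_act.
Proof.
split=> [g [[x1 y1] i1] [[x2 y2] i2] /(congr1 val)[/act_inj/= ex ey]|].
  by apply: val_inj; rewrite /= ex ey.
by move=> u g h _ _; apply: val_inj; rewrite /= actM.
Qed.

Definition rees_action : {action G &-> rees X Y} := Action rees_is_action.

Lemma rees_act_homo g : {homo rees_action^~ g : u v / (u <= v)%O}.
Proof.
move=> [[x1 y1] i1] [[x2 y2] i2]; rewrite /Order.le /= /rees_le /=.
by rewrite !pact_rank pact_mono.
Qed.

Definition act_rees : poset_action G (rees X Y) := PosetAction rees_act_homo.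

End Rees.

Section HomologyRepr.
Variable k : fieldType.

Definition chain_repr := perm_repr k (to^*)%act.

Lemma chain_repr_mulmxE g (M : 'M[k]_#|{set X}|) i j :
  (chain_repr g *m M) i j = M (enum_rank ((to^*)%act (enum_val i) g)) j.
Proof. exact: perm_repr_mxE. Qed.

Lemma mulmx_chain_reprE g (M : 'M[k]_#|{set X}|) i j :
  (M *m chain_repr g) i j = M i (enum_rank ((to^*)%act (enum_val j) g^-1%g)).
Proof.
rewrite mxE (bigD1 (enum_rank ((to^*)%act (enum_val j) g^-1%g))) //=.
rewrite mxE enum_rankK actKV eqxx mulr1 big1 ?addr0 // => l neq_l.
rewrite mxE (_ : _ == _ = false) ?mulr0 //; apply: contra_neqF neq_l => /eqP<-.
by rewrite actK enum_valK.
Qed.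

Lemma boundary_coef_act g C D :
  boundary_coef k ((to^*)%act C g) ((to^*)%act D g) = boundary_coef k C D.
Proof.
rewrite /boundary_coef (reindex_inj (act_inj to g)).
have actD1 x : (to^*)%act C g :\ to x g = (to^*)%act (C :\ x) g.
  apply/setP=> y; rewrite -[y](actKV to g) mem_pact !inE mem_pact.
  by rewrite (inj_eq (act_inj to g)).
apply: eq_big => [x|x _].
  rewrite actD1 (inj_eq (act_inj (to^*)%act g)); congr (_ && _).
  exact: mem_pact.
congr (_ ^+ _); rewrite -[RHS](pact_card g); apply: eq_card => y.
by rewrite -[y](actKV to g) mem_pact !inE mem_pact pact_lt.
Qed.

Lemma boundary_mx_comm g :
  boundary_mx X k *m chain_repr g = chain_repr g *m boundary_mx X k.
Proof.
apply/matrixP=> i j; rewrite chain_repr_mulmxE mulmx_chain_reprE !mxE.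
by rewrite !enum_rankK -[in RHS](actKV (to^*)%act g (enum_val j)) boundary_coef_act.
Qed.

Lemma chain_mx_comm m g :
  chain_mx X k m *m chain_repr g = chain_repr g *m chain_mx X k m.
Proof.
apply/matrixP=> i j; rewrite chain_repr_mulmxE mulmx_chain_reprE !mxE.
rewrite enum_rankK /is_simplex pact_chain pact_card.
congr (_ *+ nat_of_bool _); rewrite -(inj_eq enum_val_inj) -[in RHS](inj_eq enum_val_inj).
by rewrite !enum_rankK; apply/eqP/eqP => [->|<-]; rewrite ?actKV ?actK.
Qed.

Lemma cycles_module m : mxmodule chain_repr (cycles X k m).
Proof.
apply: capmx_module; apply/mxmoduleP => g _.
  by rewrite chain_mx_comm submxMl.
by apply/sub_kermxP; rewrite -mulmxA -boundary_mx_comm mulmxA mulmx_ker mul0mx.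
Qed.

Lemma boundaries_module m : mxmodule chain_repr (boundaries X k m).
Proof.
apply/mxmoduleP => g _; rewrite /boundaries -mulmxA boundary_mx_comm mulmxA.
by rewrite chain_mx_comm -mulmxA submxMl.
Qed.

(* The reduced homology in degree m - 1, i.e. cycles modulo boundaries.      *)
Definition homology_repr (m : nat) :=
  section_repr (boundaries_module m) (cycles_module m).

Definition homology (m : nat) : K0 k G := K0_class (homology_repr m).

End HomologyRepr.
End PosetActionTheory.

Section AlphaBeta.
Variables (k : fieldType) (G : finGroupType).
Variables (d : Order.disp_t) (Q : finTBPOrderType d) (to : poset_action G Q).

Definition rank_selected (S : {fset nat}) : {set Q} :=
  [set x | [|| rank x \in S, x == \bot%O | x == \top%O]].

Lemma pact_bot g : to \bot%O g = \bot%O.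
Proof. by apply/eqP; rewrite -lex0 -(pact_mono to g^-1) actK le0x. Qed.

Lemma pact_top g : to \top%O g = \top%O.
Proof. by apply/eqP; rewrite -le1x -(pact_mono to g^-1) actK lex1. Qed.

Lemma pact_rank_selected S g x :
  x \in rank_selected S -> to x g \in rank_selected S.
Proof.
rewrite !inE pact_rank => /or3P[->//|/eqP->|/eqP->].
  by rewrite pact_bot eqxx orbT.
by rewrite pact_top eqxx !orbT.
Qed.

Lemma pact_selected_chains S g C :
  C \in max_chains (rank_selected S) ->
  (to^*)%act C g \in max_chains (rank_selected S).
Proof. by apply: pact_max_chains => h x; exact: pact_rank_selected. Qed.

Definition alpha (S : {fset nat}) : K0 k G :=
  K0_class (perm_repr k (sub_action (@pact_selected_chains S))).

Definition beta (S : {fset nat}) : K0 k G :=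
  \sum_(T <- fpowerset S) alpha T *~ (-1) ^+ #|` (S `\` T)%fset|.

End AlphaBeta.

Definition int_range (a b : nat) : {fset nat} := [fset i in iota a (b.+1 - a)]%fset.

Definition Stab (Theta : {fset nat}) : {fset {fset nat}} :=
  [fset S in fpowerset Theta | [forall i : S, (val i).+1 \notin S]]%fset.

(* beta(X) for X without added extrema; the rank of \top in the poset with   *)
(* extrema added is n + 1.                                                   *)
Definition beta_proper (k : fieldType) (G : finGroupType) d
    (X : finPOrderType d) (to : poset_action G X) : K0 k G :=
  beta k (act_adjoined to) (int_range 1 (rank (\top%O : adjoined X)).-1).

(* Main.v *)
Require Import Defs.
From mathcomp Require Import all_boot all_order all_fingroup all_algebra.
From mathcomp Require Import ring_quotient mxrepresentation.
From mathcomp Require Import finmap boolp zify.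

(** Write Z(T, A) for the space of combinations of chains of a bounded poset
    with rank set T that are killed by forgetting any rank in A. Assume that
    forgetting i always maps Z(T + i, A) onto Z(T, A). Then the sequences
    0 -> Z(T, A + i) -> Z(T, A) -> Z(T - i, A) -> 0 are exact, and inclusion-
    exclusion gives beta(T) = [Z(T, T)]. For the full rank set, Z(T, T) is the
    top reduced homology.

    A Cohen-Macaulay poset has this lifting property: by induction over
    intervals one splits chains at a rank in T but not in A, and if there is
    none one uses the vanishing of homology below the top degree.

    A chain of the Rees product with the tree is a chain of P with rank set T
    together with a word over t letters and a symbol for staying, in a normal
    form: a letter is followed by a stay (a descent) only at ranks in T. Hence
    alpha(T) gets multiplied by the number of words with descents in T, and by
    Moebius inversion the multiplicity of beta_P([n] - S) is the number of
    words having descents at all elements of S. This is zero unless S is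
    stable, and otherwise t^|S| (1 + t)^m, where m is the number of free
    positions. Replacing a word by its signed sum over exchanges of letter and
    stay at the descents gives a basis adapted to all the forgetful maps, which
    transfers the lifting property from P to the Rees product. *)

Set Implicit Arguments.
Unset Strict Implicit.
Unset Printing Implicit Defensive.

Import Order.TTheory GRing.Theory.

Local Open Scope ring_scope.

(** * Classes of submodules *)

(** The two formulas for [beta] need no lifting: they follow from the count of words and Moebius
    inversion for every graded poset. Lifting enters when [P] is Cohen-Macaulay, where it turns
    [beta] into an actual module and, for the Rees products, into top homology. The obstacle there
    is that the normal form of a chain depends on its rank set: once a rank is forgotten, a descent
    at that rank is no longer allowed and another word takes over. The forgetful maps therefore do
    not respect the splitting of chains by words. They are only triangular: the new word has smaller
    weight, the weight being the sum of the depths of the nodes visited. Hence the induction on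
    weight that transfers lifting. Since the characteristic of [k] may divide the order of [G],
    submodules need not split off. Identities of classes come from short exact sequences, and the
    modules Z(T, A) are kept as row spaces inside the permutation module on all subsets of the
    poset, where exactness is an identity of row spaces. *)

Section GrothendieckGroup.
Variables (k : fieldType) (G : finGroupType).
Local Notation repr := (mx_representation k [set: G]).

Lemma K0_class_exact d1 d2 d3 (U : repr d1) (V : repr d2) (W : repr d3) :
  short_exact (Rep U) (Rep V) (Rep W) ->
  K0_class V = K0_class U + K0_class W.
Proof.
move=> ex; rewrite /K0_class -!pi_addr; apply/eqP.
rewrite -Quotient.idealrBE opprD addrA; apply/asboolP.
exact: K0_relation_exact.
Qed.

Definition submodule_class N (rG : repr N) (U : 'M_N) (modU : mxmodule rG U) :=
  K0_class (submod_repr modU).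

(** The map lives on the ambient spaces and is described through row spaces only. Written in the
    bases of [U], [K] and [V] that [submod_repr] uses, it gives the short exact sequence. *)
Lemma submodule_class_exact N N' (rG : repr N) (rG' : repr N') f
    (U K : 'M_N) (V : 'M_N') (modU : mxmodule rG U) (modK : mxmodule rG K)
    (modV : mxmodule rG' V) :
    (forall x, rG x *m f = f *m rG' x) ->
    (K :=: U :&: kermx f)%MS -> (V :=: U *m f)%MS ->
  submodule_class modU = submodule_class modK + submodule_class modV.
Proof.
move=> fG defK defV; apply: K0_class_exact.
have sKU : (K <= U)%MS by rewrite defK capmxSl.
have valKU m (A : 'M_(m, \rank K)) : (val_submod A <= U)%MS.
  exact: submx_trans (val_submodP _) sKU.
have valfV m (A : 'M_(m, \rank U)) : (val_submod A *m f <= V)%MS.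
  by rewrite defV submxMr ?val_submodP.
have inG x : x \in [set: G] by rewrite inE.
pose i := in_submod U (val_submod (1%:M : 'M_(\rank K))).
pose g := in_submod V (val_submod (1%:M : 'M_(\rank U)) *m f).
have row_free_i : row_free i.
  by rewrite /row_free mxrank_in_submod // val_submod1.
have gE m (A : 'M_(m, \rank U)) : A *m g = in_submod V (val_submod A *m f).
  by rewrite /g in_submodE mulmxA [in RHS]in_submodE [val_submod A]val_submodE !mulmxA.
have row_full_g : row_full g.
  rewrite /row_full mxrank_in_submod //.
  by rewrite (eqmxMr _ (val_submod1 U)) defV.
exists i, g; split=> //= [x|x|].
- rewrite -in_submodJ //.
  rewrite -(mul1mx (submod_mx modK x)) /i in_submodE mulmxA.
  by rewrite -val_submodE val_submodJ // -in_submodE.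
- rewrite -in_submodJ // gE -(mul1mx (submod_mx modU x)) val_submodJ //.
  by rewrite -!mulmxA fG.
apply/rV_eqP => v.
have -> : (v <= i)%MS = (val_submod v <= K)%MS.
  rewrite -val_submodS in_submodK ?valKU //.
  by rewrite val_submod1.
have -> : (v <= kermx g)%MS = (val_submod v *m f == 0).
  rewrite (sameP sub_kermxP eqP) gE.
  by rewrite -val_submod_eq0 in_submodK.
by rewrite defK sub_capmx val_submodP (sameP sub_kermxP eqP).
Qed.

(** For U = 0 the zero map makes 0 -> U -> U -> U -> 0 exact, so [U] = [U] + [U]. *)
Lemma submodule_class0 N (rG : repr N) (U : 'M_N) (modU : mxmodule rG U) :
  U = 0 -> submodule_class modU = 0.
Proof.
move=> U0; apply: (@addrI _ (submodule_class modU)).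
have fG x : rG x *m 0 = 0 *m rG x :> 'M_N by rewrite mulmx0 mul0mx.
rewrite addr0 -(submodule_class_exact modU modU modU fG) ?mulmx0 ?U0 //.
by apply/eqmxP; rewrite sub0mx capmxSl.
Qed.

Lemma submodule_class_iso N N' (rG : repr N) (rG' : repr N') f
    (U : 'M_N) (V : 'M_N') (modU : mxmodule rG U) (modV : mxmodule rG' V) :
    (forall x, rG x *m f = f *m rG' x) ->
    (U :&: kermx f = 0)%MS -> (V :=: U *m f)%MS ->
  submodule_class modU = submodule_class modV.
Proof.
move=> fG Uf0 defV.
rewrite (submodule_class_exact modU (mxmodule0 rG N) modV fG) ?Uf0 //.
by rewrite submodule_class0 ?add0r.
Qed.

Lemma submodule_class_eqmx N (rG : repr N) (U V : 'M_N)
    (modU : mxmodule rG U) (modV : mxmodule rG V) :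
  (U :=: V)%MS -> submodule_class modU = submodule_class modV.
Proof.
move=> UV; apply: (submodule_class_iso (f := 1%:M)) => [x||].
- by rewrite mulmx1 mul1mx.
- have -> : kermx (1%:M : 'M[k]_N) = 0 by apply/eqP; rewrite kermx_eq0 row_free_unit unitmx1.
  by rewrite capmx0.
- by rewrite mulmx1; exact: eqmx_sym.
Qed.

(** [K0] is defined by exact sequences alone, so isomorphic representations are identified through 0
    -> 0 -> U -> V -> 0. *)
Lemma K0_class_rsim d1 d2 (U : repr d1) (V : repr d2) :
  mx_rsim U V -> K0_class U = K0_class V.
Proof.
case=> B d12 freeB homB.
have cZ : submodule_class (mxmodule0 U d1) = 0 by exact: submodule_class0.
rewrite -[RHS]add0r -cZ; apply: K0_class_exact.
exists 0, B; split=> //= [x|x|||].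
- by rewrite mulmx0 mul0mx.
- by rewrite homB ?inE.
- by rewrite /row_free !mxrank0.
- by rewrite /row_full (eqP freeB); apply/eqP.
by rewrite (eqP (_ : kermx B == 0)) ?kermx_eq0 // !sub0mx.
Qed.

Lemma K0_class_submodule d (U : repr d) (modU : mxmodule U 1%:M) :
  K0_class U = submodule_class modU.
Proof. by symmetry; apply/K0_class_rsim/rsim_submod1. Qed.

Lemma nonvirtual_submodule_class N (rG : repr N) (U : 'M_N)
    (modU : mxmodule rG U) :
  nonvirtual (submodule_class modU).
Proof. by exists (\rank U), (submod_repr modU). Qed.

End GrothendieckGroup.

(** * Permutation modules and ranks *)

Section IndexedVectors.
Variable k : fieldType.

Definition entry (S : finType) (u : 'rV[k]_#|S|) (s : S) : k := u 0 (enum_rank s).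
Definition vec (S : finType) (F : S -> k) : 'rV[k]_#|S| := \row_i F (enum_val i).

Definition kernel_mx (S S' : finType) (c : S -> S' -> k) : 'M[k]_(#|S|, #|S'|) :=
  \matrix_(i, j) c (enum_val i) (enum_val j).

Definition push_mx (S S' : finType) (h : S -> S') :=
  kernel_mx (fun s s' => (h s == s')%:R).

(** A projection whose row space consists of the vectors supported on [p]. *)
Definition supp_mx (S : finType) (p : pred S) : 'M[k]_#|S| :=
  diag_mx (\row_i (p (enum_val i))%:R).

Variables S S' : finType.
Implicit Types (u v : 'rV[k]_#|S|) (p q : pred S).

Lemma vecE F s : entry (@vec S F) s = F s.
Proof. by rewrite /entry mxE enum_rankK. Qed.

Lemma entry_inj u v : entry u =1 entry v -> u = v.
Proof.
by move=> uv; apply/rowP=> i; rewrite -[i]enum_valK; exact: uv.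
Qed.

Lemma entry0 s : entry (0 : 'rV_#|S|) s = 0. Proof. exact: mxE. Qed.
Lemma entryD u v s : entry (u + v) s = entry u s + entry v s.
Proof. exact: mxE. Qed.
Lemma entryB u v s : entry (u - v) s = entry u s - entry v s.
Proof. by rewrite /entry !mxE. Qed.
Lemma entryZ a u s : entry (a *: u) s = a * entry u s.
Proof. by rewrite /entry !mxE. Qed.
Lemma entry_sum I (r : seq I) (P : pred I) (F : I -> 'rV_#|S|) s :
  entry (\sum_(i <- r | P i) F i) s = \sum_(i <- r | P i) entry (F i) s.
Proof. exact: summxE. Qed.

Lemma entry_kernel u (c : S -> S' -> k) s' :
  entry (u *m kernel_mx c) s' = \sum_s entry u s * c s s'.
Proof.
rewrite /entry mxE (reindex _ (onW_bij _ (@enum_rank_bij S))) /=.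
by apply: eq_bigr => s _; rewrite mxE !enum_rankK.
Qed.

Lemma entry_push u (h : S -> S') s' :
  entry (u *m push_mx h) s' = \sum_(s | h s == s') entry u s.
Proof.
rewrite entry_kernel [RHS]big_mkcond; apply: eq_bigr => s _.
by case: eqP; rewrite ?mulr1 ?mulr0.
Qed.

Lemma entry_push_inj u (h : S -> S') s : injective h ->
  entry (u *m push_mx h) (h s) = entry u s.
Proof.
move=> inj_h; rewrite entry_push (big_pred1 s) // => s'.
by rewrite /= (inj_eq inj_h).
Qed.

Lemma entry_push_notin u (h : S -> S') s' : (forall s, h s != s') ->
  entry (u *m push_mx h) s' = 0.
Proof.
move=> h_s'; rewrite entry_push big_pred0 // => s; exact/negbTE.
Qed.

Lemma entry_supp u p s : entry (u *m supp_mx p) s = (p s)%:R * entry u s.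
Proof.
by rewrite /entry /supp_mx mul_mx_diag !mxE enum_rankK mulrC.
Qed.

Lemma sub_supp_mxP u p :
  reflect (forall s, entry u s != 0 -> p s) (u <= supp_mx p)%MS.
Proof.
apply: (iffP submxP) => [[v ->] s|u_p].
  by rewrite entry_supp; case: (p s) => //; rewrite mul0r eqxx.
exists u; apply: entry_inj => s; rewrite entry_supp.
have [->|/u_p->] := eqVneq (entry u s) 0; first by rewrite mulr0.
by rewrite mul1r.
Qed.

Lemma supp_mxS p q : subpred p q -> (supp_mx p <= supp_mx q)%MS.
Proof.
move=> sub_pq; apply/rV_subP=> u /sub_supp_mxP u_p.
by apply/sub_supp_mxP => s /u_p/sub_pq.
Qed.

Lemma supp_mxT p : (forall s, p s) -> supp_mx p = 1%:M.
Proof.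
move=> pT; apply/matrixP=> i j; rewrite !mxE pT.
by case: eqP.
Qed.

End IndexedVectors.

Section RemovalMatrices.
Variables (k : fieldType) (X : finType).
Implicit Types (z : X) (C D : {set X}).

(** Common form of the simplicial boundary, where [a] is a sign, and of the maps forgetting a rank,
    where [a] selects the elements of that rank. *)
Definition removal_mx (a : X -> {set X} -> k) :=
  kernel_mx (fun C D => \sum_(z in C | D == C :\ z) a z C).

Lemma entry_removal u (a : X -> {set X} -> k) D :
  entry (u *m removal_mx a) D = \sum_(z | z \notin D) a z (z |: D) * entry u (z |: D).
Proof.
rewrite entry_kernel.
under eq_bigr do rewrite mulr_sumr.
rewrite (exchange_big_dep predT) //= [RHS]big_mkcond; apply: eq_bigr => z _.
case: ifPn => [Dz|/negPn Dz].
  rewrite (big_pred1 (z |: D)) => [|C /=]; first exact: mulrC.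
  apply/andP/eqP => [[Cz /eqP->]|->]; first by rewrite setD1K.
  by rewrite setU11 setU1K.
by rewrite big_pred0 // => C; apply: contraTF Dz => /andP[_ /eqP->]; rewrite setD11.
Qed.

End RemovalMatrices.

Section PermutationModules.
Variables (k : fieldType) (G : finGroupType) (S : finType).
Variable to : {action G &-> S}.

Lemma perm_repr_push g : perm_repr k to g = push_mx k (to^~ g).
Proof. by apply/matrixP=> i j; rewrite !mxE. Qed.

Lemma entry_perm_repr (u : 'rV[k]_#|S|) g s :
  entry (u *m perm_repr k to g) s = entry u (to s g^-1%g).
Proof.
rewrite perm_repr_push -{1}[s](actKV to g) entry_push_inj //.
exact: act_inj.
Qed.

Lemma perm_supp_mx_comm (p : pred S) g : (forall s, p (to s g) = p s) ->
  perm_repr k to g *m supp_mx k p = supp_mx k p *m perm_repr k to g.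
Proof.
move=> pG; apply/row_matrixP => i; rewrite !rowE !mulmxA.
apply: entry_inj => s.
rewrite entry_supp !entry_perm_repr entry_supp.
by rewrite -[s in p s](actKV to g) pG.
Qed.

Lemma supp_mx_module (p : pred S) : (forall g s, p (to s g) = p s) ->
  mxmodule (perm_repr k to) (supp_mx k p).
Proof.
by move=> pG; apply/mxmoduleP => g _; rewrite -perm_supp_mx_comm ?submxMl.
Qed.

End PermutationModules.

Section PermutationModuleMaps.
Variables (k : fieldType) (G : finGroupType) (S S' : finType).
Variables (to : {action G &-> S}) (to' : {action G &-> S'}).

Lemma kernel_mx_comm (c : S -> S' -> k) g :
    (forall s s', c (to s g) (to' s' g) = c s s') ->
  perm_repr k to g *m kernel_mx c = kernel_mx c *m perm_repr k to' g.
Proof.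
move=> cG; apply/row_matrixP => i; rewrite !rowE !mulmxA.
apply: entry_inj => s'.
rewrite entry_kernel entry_perm_repr entry_kernel.
rewrite (reindex_inj (act_inj to g)); apply: eq_bigr => s _.
by rewrite entry_perm_repr actK -[s' in LHS](actKV to' g) cG.
Qed.

Lemma push_mx_comm (h : S -> S') g : (forall s, h (to s g) = to' (h s) g) ->
  perm_repr k to g *m push_mx k h = push_mx k h *m perm_repr k to' g.
Proof.
move=> hG; apply: kernel_mx_comm => s s'.
by rewrite hG (inj_eq (act_inj to' g)).
Qed.

End PermutationModuleMaps.

Lemma boundary_removal (k : fieldType) d (X : finPOrderType d) :
  boundary_mx X k =
  removal_mx (fun z (C : {set X}) => (-1) ^+ #|[set y in C | (y < z)%O]| : k).
Proof. by []. Qed.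

(** * Rank functions of finite posets *)

Section RankLemmas.
Variables (d : Order.disp_t) (X : finPOrderType d).
Implicit Types (x y z : X) (C D : {set X}).

Lemma chainP C : reflect {in C &, forall x y, (x >=< y)%O} (chain C).
Proof.
apply: (iffP 'forall_implyP) => [cC x y Cx Cy|cC x Cx].
  by have /'forall_implyP/(_ y Cy) := cC x Cx.
by apply/'forall_implyP => y Cy; exact: cC.
Qed.

Lemma chainS C D : C \subset D -> chain D -> chain C.
Proof.
by move=> /subsetP sCD /chainP cD; apply/chainP => x y /sCD ? /sCD ?; exact: cD.
Qed.

Lemma chainU1 z C : chain C -> (forall x, x \in C -> (z >=< x)%O) ->
  chain (z |: C).
Proof.
move=> /chainP cC zC; apply/chainP => x y; rewrite !inE.
case/predU1P=> [->|Cx] /predU1P[->|Cy].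
- exact: comparablexx.
- exact: zC.
- by rewrite comparable_sym; exact: zC.
exact: cC.
Qed.

Lemma chain1 z : chain [set z].
Proof. by apply/chainP => x y /set1P-> /set1P->; exact: comparablexx. Qed.

Lemma leq_rank x C : chain C -> (forall y, y \in C -> (y < x)%O) ->
  (#|C| <= rank x)%N.
Proof.
move=> cC C_lt; apply: (bigop.bigmax_sup C) => //.
by rewrite cC; apply/'forall_implyP.
Qed.

Lemma rank_chain x : exists C, [/\ chain C, forall y, y \in C -> (y < x)%O & #|C| = rank x].
Proof.
pose P (C : {set X}) := chain C && [forall y in C, (y < x)%O].
have P0 : P set0.
  by apply/andP; split; [apply/chainP => ? ?; rewrite inE|apply/'forall_implyP=> ?; rewrite inE].
rewrite /rank -/P (bigop.bigmax_eq_arg set0) //.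
case: arg_maxnP => // C /andP[cC /'forall_implyP C_lt] _.
by exists C.
Qed.

Lemma rank_lt x y : (x < y)%O -> (rank x < rank y)%N.
Proof.
move=> lt_xy; have [C [cC C_lt <-]] := rank_chain x.
have xC : x \notin C by apply/negP => /C_lt; rewrite ltxx.
rewrite -add1n -[1%N]/(true : nat) -xC -cardsU1; apply: leq_rank.
  by apply: chainU1 => // z /C_lt/ltW; rewrite comparable_sym; exact: le_comparable.
by move=> z /setU1P[->//|/C_lt/lt_trans]; exact.
Qed.

Lemma rank_le x y : (x <= y)%O -> (rank x <= rank y)%N.
Proof. by rewrite le_eqVlt => /predU1P[->|/rank_lt/ltnW]. Qed.

Lemma comparable_rank_lt x y :
  (x >=< y)%O -> (rank x < rank y)%N -> (x < y)%O.
Proof.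
by case: (comparableP x y) => // [/rank_lt ? _ ?|-> _]; lia.
Qed.

Lemma comparable_rank_eq x y : (x >=< y)%O -> rank x = rank y -> x = y.
Proof. by case: (comparableP x y) => // /rank_lt ? _ ?; lia. Qed.

(** The element of largest rank in a longest chain below [x] lies above the rest of that chain, so
    its rank is at least one less than that of [x]. *)
Lemma rank_pred x : (0 < rank x)%N -> exists2 y, (y < x)%O & rank y = (rank x).-1.
Proof.
have [C [cC C_lt Cx]] := rank_chain x; rewrite -Cx => /card_gt0P[y0 Cy0].
case: (arg_maxnP (fun z => rank z) Cy0) => y Cy max_y.
have {}Cy : y \in C by [].
have {}max_y z : z \in C -> (rank z <= rank y)%N by exact: max_y.
exists y; first exact: C_lt.
have ltCy : forall z, z \in C :\ y -> (z < y)%O.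
  move=> z /setD1P[zy Cz]; have cyz := chainP _ cC _ _ Cy Cz.
  apply: comparable_rank_lt; first by rewrite comparable_sym.
  rewrite ltn_neqAle max_y // andbT; apply: contra_neq zy => eq_r.
  exact/esym/comparable_rank_eq.
have := leq_rank (chainS (subsetDl _ _) cC) ltCy.
have := cardsD1 y C; rewrite Cy; have := rank_lt (C_lt _ Cy); lia.
Qed.

(** Stepping down for one of the functions while the other strictly decreases gives both
    inequalities. This computes the ranks of trees, subposets and Rees products without exhibiting
    longest chains. *)
Lemma rank_unique (r : X -> nat) :
    (forall x y, (x < y)%O -> (r x < r y)%N) ->
    (forall x, (0 < r x)%N -> exists2 y, (y < x)%O & r y = (r x).-1) ->
  forall x, rank x = r x.
Proof.
move=> r_lt r_pred x; have [m] := ubnP (rank x + r x).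
elim: m x => // m IHm x lt_m.
have [r0|r_gt0] := posnP (r x).
  case: (posnP (rank x)) => [->//|/rank_pred[y /r_lt]]; lia.
have [y lt_yx ry] := r_pred x r_gt0.
have := rank_lt lt_yx; rewrite IHm; last by have := rank_lt lt_yx; lia.
have [->|/rank_pred[z lt_zx rz]] := posnP (rank x); first lia.
have := r_lt _ _ lt_zx; rewrite -IHm; last by have := r_lt _ _ lt_zx; lia.
lia.
Qed.

End RankLemmas.

(** The form in which gradedness is used: it can be checked on a Rees product by choosing one
    intermediate pair. *)
Definition ranked n d (Q : finTBPOrderType d) : Prop :=
  rank (\top%O : Q) = n.+1 /\
  forall (x y : Q) i, (x < y)%O -> (rank x < i < rank y)%N ->
    exists2 z, (x < z < y)%O & rank z = i.

Section GradedRanked.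
Variables (n : nat) (d : Order.disp_t) (Q : finTBPOrderType d).

Lemma chain_extension (C : {set Q}) : chain C ->
  exists2 D, D \in max_chains [set: Q] & C \subset D.
Proof.
move=> cC.
have [|D maxD sCD] := @maxset_exists _ [pred D | chain D && (D \subset [set: Q])] C.
  by rewrite /= cC subsetT.
by exists D => //; rewrite inE.
Qed.

(** In a maximal chain the elements below [c] number exactly [rank c], since replacing them by a
    longest chain below [c] cannot give more than n + 2 elements. A maximal chain through x < y thus
    meets every rank between theirs. *)
Lemma graded_ranked : graded Q n.+1 -> ranked n Q.
Proof.
move=> gQ.
have card_chain (C : {set Q}) : chain C -> (#|C| <= n.+2)%N.
  by move=> cC; have [D /gQ<- /subset_leq_card] := chain_extension cC.
have max_rank (C : {set Q}) c : C \in max_chains [set: Q] -> c \in C ->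
    #|[set z in C | (z < c)%O]| = rank c.
  move=> maxC Cc; have cardC := gQ _ maxC.
  have {maxC} cC : chain C by move: maxC; rewrite inE => /maxsetp/andP[].
  have sC1 : chain [set z in C | (z < c)%O].
    by apply: chainS cC; apply/subsetP=> z /setIdP[].
  apply/eqP; rewrite eqn_leq leq_rank //=; last by move=> y /setIdP[].
  have [D [cD D_lt <-]] := rank_chain c.
  pose E := [set z in C | (c <= z)%O].
  have cE : chain E by apply: chainS cC; apply/subsetP=> z /setIdP[].
  have cDE : chain (D :|: E).
    apply/chainP => u v; rewrite !inE.
    case/orP=> [Du|/andP[Cu cu]] /orP[Dv|/andP[Cv cv]].
    - exact: (chainP _ cD).
    - by apply/le_comparable/ltW/(lt_le_trans (D_lt _ Du)).
    - by rewrite comparable_sym; apply/le_comparable/ltW/(lt_le_trans (D_lt _ Dv)).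
    exact: (chainP _ cC).
  have := card_chain _ cDE; rewrite cardsU (_ : D :&: E = set0); last first.
    apply/setP=> z; rewrite !inE; apply/negP => /andP[/D_lt lt_zc /andP[_ le_cz]].
    by have := lt_le_trans lt_zc le_cz; rewrite ltxx.
  rewrite cards0 subn0 -cardC -(cardsID [set z | (z < c)%O] C).
  rewrite (_ : C :&: _ = [set z in C | (z < c)%O]); last first.
    by apply/setP=> z; rewrite !inE.
  rewrite (_ : C :\: _ = E) ?leq_add2r //.
  apply/setP=> z; rewrite !inE andbC; case: (boolP (z \in C)) => //= Cz.
  by have := chainP _ cC _ _ Cc Cz; case: (comparableP c z).
have max_bounds (C : {set Q}) : C \in max_chains [set: Q] -> \top%O \in C.
  rewrite inE => /maxsetP[/andP[/= cC _] /(_ (\top%O |: C))]; rewrite subsetU1 /=.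
  move=> <- //; first exact: setU11.
  rewrite subsetT andbT; apply: chainU1 => // x _; rewrite comparable_sym.
  exact/le_comparable/lex1.
have rkT : rank (\top%O : Q) = n.+1.
  have [C maxC _] := chain_extension (chain1 (\top%O : Q)).
  have CT := max_bounds _ maxC.
  rewrite -(max_rank _ _ maxC CT); have := gQ _ maxC.
  rewrite (cardsD1 \top%O) CT => -[<-]; apply: eq_card => z.
  by rewrite !inE lt_neqAle lex1 andbT andbC.
split=> // x y i lt_xy /andP[lt_xi lt_iy].
have cxy : chain [set x; y].
  apply: chainU1; first exact: chain1.
  by move=> z /set1P->; exact/le_comparable/ltW.
have [C maxC /subsetP sC] := chain_extension cxy.
have Cx : x \in C by apply: sC; rewrite !inE eqxx.
have Cy : y \in C by apply: sC; rewrite !inE eqxx orbT.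
have cC : chain C by move: (maxC); rewrite inE => /maxsetp/andP[].
have cardC := gQ _ maxC.
have lt_rank (z : Q) : (rank z < n.+2)%N by rewrite ltnS -rkT rank_le ?lex1.
pose r (z : Q) : 'I_n.+2 := Ordinal (lt_rank z).
have inj_r : {in C &, injective r}.
  by move=> u v Cu Cv /(congr1 val)/=; apply: comparable_rank_eq; exact: (chainP _ cC).
have imC : r @: C = [set: 'I_n.+2].
  by apply/eqP; rewrite eqEcard subsetT card_in_imset // cardC cardsT card_ord leqnn.
have lt_in : (i < n.+2)%N by exact: ltn_trans lt_iy (lt_rank y).
have : Ordinal lt_in \in r @: C by rewrite imC inE.
case/imsetP=> z Cz /(congr1 val)/= ri; exists z => //; rewrite {i lt_in}ri in lt_xi lt_iy.
by rewrite !comparable_rank_lt //; exact: (chainP _ cC).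
Qed.

End GradedRanked.

Section SelectedChains.
Variables (k : fieldType) (n : nat) (d : Order.disp_t) (Q : finTBPOrderType d).
Hypothesis rankedQ : ranked n Q.
Implicit Types (x y z : Q) (C D : {set Q}) (T A : {set 'I_n.+2}) (i j l : 'I_n.+2).

Definition rk z : 'I_n.+2 := inord (rank z).

Lemma rkE z : rk z = rank z :> nat.
Proof. by rewrite inordK // ltnS -rankedQ.1 rank_le ?lex1. Qed.

Lemma rk_eq x y : (rk x == rk y) = (rank x == rank y).
Proof. by rewrite -val_eqE /= !rkE. Qed.

Lemma chain_rk_inj C : chain C -> {in C &, injective rk}.
Proof.
move=> /chainP cC x y Cx Cy /eqP; rewrite rk_eq => /eqP.
by apply: comparable_rank_eq; exact: cC.
Qed.

Lemma chain_card_rk C : chain C -> #|rk @: C| = #|C|.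
Proof. by move/chain_rk_inj/card_in_imset. Qed.

Lemma rk_lt x y : (x < y)%O -> (rk x < rk y)%N.
Proof. by rewrite !rkE; exact: rank_lt. Qed.

Lemma chain_rk_lt C x y : chain C -> x \in C -> y \in C ->
  (x < y)%O = (rk x < rk y)%N.
Proof.
move=> cC Cx Cy; apply/idP/idP => [/rk_lt //|]; rewrite !rkE.
by apply: comparable_rank_lt; exact: (chainP _ cC).
Qed.

Lemma rk_setU1_notin z D : z \notin D -> chain (z |: D) -> rk z \notin rk @: D.
Proof.
move=> Dz cD; apply: contra Dz => /imsetP[x Dx rkzx].
by rewrite (chain_rk_inj cD _ _ rkzx) ?setU11 // setU1r.
Qed.

Definition typed_chain x y T C :=
  [&& chain C, C \subset [set z | (x < z < y)%O] & rk @: C == T].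

Lemma typed_chainU1 x y T z D : z \notin D -> typed_chain x y T (z |: D) ->
  typed_chain x y (T :\ rk z) D /\ rk z \in T.
Proof.
move=> Dz /and3P[cD sD /eqP<-]; split; last by rewrite imset_f ?setU11.
rewrite /typed_chain (chainS _ cD) ?subsetU1 //= (subset_trans _ sD) ?subsetU1 //=.
by rewrite imsetU1 setU1K ?rk_setU1_notin.
Qed.

(** Unsigned, so that these maps commute with each other; the signed versions that add up to the
    boundary come later. Chains without rank [l] are sent to 0. *)
Definition forget_mx l := removal_mx (fun (z : Q) _ => (rk z == l)%:R : k).

Lemma entry_forget u l D :
  entry (u *m forget_mx l) D = \sum_(z | (z \notin D) && (rk z == l)) entry u (z |: D).
Proof.
rewrite entry_removal big_mkcondr; apply: eq_bigr => z _.
by case: eqP; rewrite ?mul1r ?mul0r.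
Qed.

Lemma entry_forget_neq0 u l D : entry (u *m forget_mx l) D != 0 ->
  exists z, [/\ z \notin D, rk z = l & entry u (z |: D) != 0].
Proof.
rewrite entry_forget => neq0.
have [z /andP[Dz /eqP rz] uz] :
  exists2 z, (z \notin D) && (rk z == l) & entry u (z |: D) != 0; last by exists z.
apply/exists_inP; apply: contraNT neq0; rewrite negb_exists_in => /'forall_implyP h.
by apply/eqP; rewrite big1 // => z /h/negPn/eqP.
Qed.

Lemma forget_mxC i j : forget_mx i *m forget_mx j = forget_mx j *m forget_mx i.
Proof.
have [->//|neq_ij] := eqVneq i j.
apply/row_matrixP => r; rewrite !rowE !mulmxA; apply: entry_inj => D.
rewrite !entry_forget; under eq_bigr do rewrite entry_forget.
under [RHS]eq_bigr do rewrite entry_forget.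
rewrite (exchange_big_dep (fun z => (z \notin D) && (rk z == i))) /=; last first.
  by move=> z z' _; rewrite !inE negb_or -andbA => /and3P[_ -> ->].
apply: eq_bigr => z /andP[Dz /eqP rz]; apply: eq_big => [z'|z' _].
  rewrite !inE !negb_or Dz rz eqxx !andbT.
  rewrite [z == z']eq_sym.
  by case: (eqVneq z' z); rewrite ?andbF ?andbT.
by rewrite !setUA (setUC [set z]).
Qed.

(* The space Z(T, A) above, for the open interval from x to y.                 *)
Definition cycle_mx x y T A :=
  (supp_mx k (typed_chain x y T) :&: \bigcap_(l in A) kermx (forget_mx l))%MS.

Lemma cycle_mxP (u : 'rV_#|{set Q}|) x y T A :
  reflect ((forall C, entry u C != 0 -> typed_chain x y T C) /\
           (forall l, l \in A -> u *m forget_mx l = 0))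
    (u <= cycle_mx x y T A)%MS.
Proof.
rewrite sub_capmx; apply: (iffP andP) => -[uT uA]; split.
- exact/sub_supp_mxP.
- by move=> l Al; apply/sub_kermxP; move/sub_bigcapmxP: uA; exact.
- exact/sub_supp_mxP.
by apply/sub_bigcapmxP => l Al; apply/sub_kermxP/uA.
Qed.

(* Requiring this for all T, A and i amounts to the distributivity of the      *)
(* lattice generated by the kernels of the maps forgetting one rank.           *)
Definition lifting x y := forall T A i, A \subset T -> i \notin T ->
  (rk x < i < rk y)%N ->
  (cycle_mx x y T A <= cycle_mx x y (i |: T) A *m forget_mx i)%MS.

Lemma cycle_mx_forget x y T A i : i \in T -> i \notin A ->
  (cycle_mx x y T A *m forget_mx i <= cycle_mx x y (T :\ i) A)%MS.
Proof.
move=> Ti Ai; apply/rV_subP=> v /submxP[w ->]; rewrite mulmxA.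
have /cycle_mxP[] := submxMl w (cycle_mx x y T A).
move: (w *m _) => u uT uA.
apply/cycle_mxP; split=> [C|l /uA uA0].
  by case/entry_forget_neq0=> z [Cz <- /uT/(typed_chainU1 Cz)[]].
by rewrite -mulmxA forget_mxC mulmxA uA0 mul0mx.
Qed.

End SelectedChains.

(** * Rank selection and the classes beta *)

Section PushSupport.
Variables (k : fieldType) (S S' : finType) (p : pred S) (q : pred S') (h : S -> S').
Hypotheses (inj_h : {in p &, injective h}) (ph : forall s, p s -> q (h s)).
Hypothesis hp : forall s', q s' -> exists2 s, p s & h s = s'.

Lemma entry_push_in (u : 'rV[k]_#|S|) s : (u <= supp_mx k p)%MS -> p s ->
  entry (u *m push_mx k h) (h s) = entry u s.
Proof.
move=> /sub_supp_mxP up ps; rewrite entry_push (bigD1 s) //= big1 ?addr0 // => s'.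
case/andP=> /eqP hs' neq; apply/eqP; apply: contraNT neq => /up ps'.
by apply/eqP/inj_h.
Qed.

Lemma push_supp_ker : (supp_mx k p :&: kermx (push_mx k h))%MS = 0.
Proof.
apply/eqP/rowV0P => u; rewrite sub_capmx => /andP[up /sub_kermxP uh].
apply: entry_inj => s; rewrite entry0; have [ps|] := boolP (p s).
  by rewrite -entry_push_in // uh entry0.
by apply: contraNeq; move/sub_supp_mxP: up; exact.
Qed.

Lemma push_supp : (supp_mx k q :=: supp_mx k p *m push_mx k h)%MS.
Proof.
apply/eqmxP/rV_eqP => u; apply/idP/idP => [/sub_supp_mxP uq|].
  pose v := vec (fun s => if p s then entry u (h s) else 0).
  have vp : (v <= supp_mx k p)%MS.
    by apply/sub_supp_mxP => s; rewrite vecE; case: ifP => //; rewrite eqxx.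
  suff -> : u = v *m push_mx k h by exact: submxMr.
  apply: entry_inj => s'; have [/hp[s ps <-]|Nq] := boolP (q s').
    by rewrite entry_push_in // vecE ps.
  have [->|/uq] := eqVneq (entry u s') 0; last by rewrite (negbTE Nq).
  rewrite entry_push big1 // => s /eqP hs; rewrite vecE; case: ifP => // /ph.
  by rewrite hs (negbTE Nq).
case/submxP=> w ->; rewrite mulmxA; apply/sub_supp_mxP => s'.
rewrite entry_push => neq0.
have [s /eqP <-] : exists2 s, h s == s' & p s.
  apply/exists_inP; apply: contraNT neq0 => /exists_inPn hN.
  by apply/eqP; rewrite big1 // => s /hN /negbTE; rewrite entry_supp => ->; rewrite mul0r.
exact: ph.
Qed.

Lemma push_submodule_class (G : finGroupType)
    (to : {action G &-> S}) (to' : {action G &-> S'})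
    (modp : mxmodule (perm_repr k to) (supp_mx k p))
    (modq : mxmodule (perm_repr k to') (supp_mx k q)) :
  (forall s g, h (to s g) = to' (h s) g) ->
  submodule_class modp = submodule_class modq.
Proof.
move=> hG; apply: (submodule_class_iso (f := push_mx k h)).
- by move=> g; apply: push_mx_comm => s.
- exact: push_supp_ker.
exact: push_supp.
Qed.

End PushSupport.

Section SelectedMaxChains.
Variables (n : nat) (d : Order.disp_t) (Q : finTBPOrderType d).
Hypothesis rankedQ : ranked n Q.
Implicit Types (x y z : Q) (C D : {set Q}) (T A : {set 'I_n.+2}) (i j l : 'I_n.+2).

(** Rank sets are finite sets of ordinals here, but finite sets of naturals in the definition of
    [beta]. *)
Definition fset_of m (T : {set 'I_m}) : {fset nat} := [fset nat_of_ord i | i in T]%fset.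

Lemma in_fset_of m (T : {set 'I_m}) (i : 'I_m) : ((i : nat) \in fset_of T) = (i \in T).
Proof.
apply/imfsetP/idP => [[j Tj /val_inj->]//|Ti]; by exists i.
Qed.

Definition proper_ranks : {set 'I_n.+2} := [set i : 'I_n.+2 | (0 < i < n.+1)%N].

Lemma rank_bot : rank (\bot%O : Q) = 0%N.
Proof.
have [C [_ C_lt <-]] := rank_chain (\bot%O : Q).
by apply/eqP; rewrite cards_eq0; apply/set0Pn => -[z /C_lt]; rewrite ltx0.
Qed.

Lemma rank_proper z : (0 < rank z < n.+1)%N = (\bot < z < \top)%O.
Proof.
rewrite -[LHS]/((0 < rank z) && (rank z < n.+1))%N -rankedQ.1 -rank_bot.
rewrite -[RHS]/((\bot < z) && (z < \top))%O lt0x ltx1; congr andb.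
  by apply/idP/idP=> [|?]; [apply: contraTneq => ->; rewrite ltnn|rewrite rank_lt // lt0x].
by apply/idP/idP=> [|?]; [apply: contraTneq => ->; rewrite ltnn|rewrite rank_lt // ltx1].
Qed.

(** The elements of the chain next below and next above rank [i] have an element of rank [i] between
    them, which is then comparable to the whole chain. *)
Lemma chain_insert C i : chain C -> \bot%O \in C -> \top%O \in C ->
  exists2 z, rank z = i & chain (z |: C).
Proof.
move=> cC Cb Ct.
have [/exists_inP[z Cz /eqP rz]|/exists_inPn Ni] :=
  boolP [exists z in C, rank z == i].
  by exists z => //; rewrite (setUidPr _) // sub1set.
have i_bnd : (0 < i < n.+1)%N.
  have := Ni _ Cb; have := Ni _ Ct; rewrite rank_bot rankedQ.1.
  by have := ltn_ord i; lia.
pose lo (z : Q) := (z \in C) && (rank z < i)%N.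
pose hi (z : Q) := (z \in C) && (i < rank z)%N.
have Pb : lo \bot%O by rewrite /lo Cb rank_bot; lia.
have Pt : hi \top%O by rewrite /hi Ct rankedQ.1; lia.
case: (arg_maxnP (fun z => rank z) Pb) => x /andP[Cx lt_xi] max_x.
case: (arg_minnP (fun z => rank z) Pt) => y /andP[Cy lt_iy] min_y.
have lt_xy : (x < y)%O.
  by apply: comparable_rank_lt (ltn_trans lt_xi lt_iy); exact: (chainP _ cC).
have [|z /andP[lt_xz lt_zy] rz] := rankedQ.2 x y i lt_xy; first by rewrite lt_xi.
exists z => //; apply: chainU1 => // w Cw.
have := Ni _ Cw; rewrite neq_ltn => /orP[lt_wi|lt_iw].
  have le_wx : (rank w <= rank x)%N by apply: max_x; rewrite /lo Cw.
  rewrite comparable_sym; apply/le_comparable/ltW/(le_lt_trans _ lt_xz).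
  have := chainP _ cC _ _ Cw Cx; case: (comparableP w x) => // /rank_lt; lia.
have le_yw : (rank y <= rank w)%N by apply: min_y; rewrite /hi Cw.
apply/le_comparable/ltW/(lt_le_trans lt_zy).
have := chainP _ cC _ _ Cy Cw; case: (comparableP y w) => // /rank_lt; lia.
Qed.

Local Notation bounds := [set \bot%O; \top%O : Q].

(** A missing rank of [T] can always be filled, so maximality amounts to having all ranks of [T].
    The extrema, which lie in every such chain, are stripped off. *)
Lemma max_chains_selected T C : T \subset proper_ranks ->
  (C \in max_chains (rank_selected Q (fset_of T))) =
  (bounds \subset C) && typed_chain \bot%O \top%O T (C :\: bounds).
Proof.
move=> /subsetP Tpr; have rkQ := rkE rankedQ.
have selE z : (z \in rank_selected Q (fset_of T)) = (rk n z \in T) || (z \in bounds).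
  by rewrite !inE -rkQ in_fset_of.
rewrite inE; apply/maxsetP/andP => [[/andP[/= cC sC] maxC]|[sbC /and3P[cC sC /eqP rkC]]].
  have add z : z \in rank_selected Q (fset_of T) -> (forall x, x \in C -> (z >=< x)%O) -> z \in C.
    move=> selz cz; rewrite -(maxC (z |: C)) ?setU11 ?subsetU1 //=.
    by rewrite chainU1 // subUset sub1set selz.
  have Cb : \bot%O \in C.
    by apply: add => [|z _]; [rewrite selE !inE eqxx orbT|exact/le_comparable/le0x].
  have Ct : \top%O \in C.
    apply: add => [|z _]; first by rewrite selE !inE eqxx !orbT.
    by rewrite comparable_sym; exact/le_comparable/lex1.
  split; first by rewrite subUset !sub1set Cb.
  apply/and3P; split; first exact: chainS (subsetDl _ _) cC.
    by apply/subsetP=> z; rewrite !inE lt0x ltx1 negb_or => /andP[].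
  rewrite eqEsubset; apply/andP; split; apply/subsetP => i.
    case/imsetP=> z /setDP[/(subsetP sC)]; rewrite selE => /orP[Tz _ ->//|->//].
  move=> Ti; have [z rz cz] := chain_insert i cC Cb Ct.
  have rkz : rk n z = i by apply: val_inj; rewrite /= rkQ.
  apply/imsetP; exists z => //; rewrite inE; apply/andP; split; last first.
    apply: add => [|x Cx]; first by rewrite selE rkz Ti.
    by apply: (chainP _ cz); rewrite ?setU11 ?setU1r.
  rewrite !inE negb_or -lt0x -ltx1 -rank_proper rz.
  by move/Tpr: Ti; rewrite inE.
have cCC : chain C.
  rewrite -(setID C bounds) (setIidPr sbC) -setUA.
  apply: chainU1 => [|z _]; last exact/le_comparable/le0x.
  apply: chainU1 => // z _; rewrite comparable_sym; exact/le_comparable/lex1.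
split=> [|D /andP[/= cD sD] sCD].
  rewrite /= cCC; apply/subsetP=> z Cz; rewrite selE; apply/orP.
  have [zb|Nz] := boolP (z \in bounds); [by right|left].
  by rewrite -rkC imset_f // inE Nz.
apply/eqP; rewrite eqEsubset sCD andbT; apply/subsetP=> z Dz.
move: (subsetP sD _ Dz); rewrite selE => /orP[|/(subsetP sbC)//].
rewrite -rkC => /imsetP[w /setDP[Cw _] rkzw].
by rewrite (chain_rk_inj rankedQ cD Dz _ rkzw) // (subsetP sCD).
Qed.

End SelectedMaxChains.

Section BetaHomology.
Variables (k : fieldType) (G : finGroupType).
Variables (n : nat) (d : Order.disp_t) (Q : finTBPOrderType d) (to : poset_action G Q).
Hypothesis rankedQ : ranked n Q.
Implicit Types (x y z : Q) (C D : {set Q}) (T A : {set 'I_n.+2}) (i j l : 'I_n.+2).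
Local Notation M := (chain_repr to k).

Lemma pact_rk g z : rk n (to z g) = rk n z.
Proof. by rewrite /rk pact_rank. Qed.

Lemma setactD1 g z C : (to^*)%act (C :\ z) g = (to^*)%act C g :\ to z g.
Proof.
apply/setP=> y; rewrite -[y](actKV to g) mem_pact !inE mem_pact.
by rewrite (inj_eq (act_inj to g)).
Qed.

Lemma forget_mx_comm l g :
  M g *m forget_mx k Q l = forget_mx k Q l *m M g.
Proof.
apply: kernel_mx_comm => C D; rewrite (reindex_inj (act_inj to g)).
apply: eq_big => [z|z _]; last by rewrite pact_rk.
by rewrite -setactD1 (inj_eq (act_inj (to^*)%act g)); congr (_ && _); exact: mem_pact.
Qed.

Lemma pact_typed_chain g T C :
  typed_chain \bot%O \top%O T ((to^*)%act C g) = typed_chain \bot%O \top%O T C.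
Proof.
rewrite /typed_chain pact_chain; congr [&& _, _ & _].
  apply/subsetP/subsetP => sC z.
    move=> Cz; have := sC (to z g); rewrite mem_pact Cz => /(_ isT).
    by rewrite !inE -{1}(pact_bot to g) -{1}(pact_top to g) !pact_lt.
  case/imsetP=> {}z /sC Cz ->; move: Cz.
  by rewrite !inE -{2}(pact_bot to g) -{2}(pact_top to g) !pact_lt.
rewrite /= /setact -imset_comp; congr (_ == _); by apply: eq_imset => z /=; rewrite pact_rk.
Qed.

Lemma cycle_mx_module T A : mxmodule M (cycle_mx k \bot%O \top%O T A : 'M_#|{set Q}|).
Proof.
apply: capmx_module; first by apply: supp_mx_module => g C; exact: pact_typed_chain.
apply/mxmoduleP => g _; apply/sub_bigcapmxP => l Al.
apply/sub_kermxP; rewrite -mulmxA forget_mx_comm mulmxA.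
have /sub_bigcapmxP/(_ l Al) := submx_refl (\bigcap_(l in A) kermx (forget_mx k Q l))%MS.
by move=> /sub_kermxP->; rewrite mul0mx.
Qed.

Definition cycle_class T A : K0 k G := submodule_class (cycle_mx_module T A).

Hypothesis liftQ : lifting k n (\bot%O : Q) \top%O.

Lemma cycle_class_setU1 T A i : T \subset proper_ranks n -> A \subset T ->
    i \in T -> i \notin A ->
  cycle_class T A = cycle_class T (i |: A) + cycle_class (T :\ i) A.
Proof.
move=> Tpr sAT Ti Ai; apply: (submodule_class_exact (f := forget_mx k Q i)).
- by move=> g; exact: forget_mx_comm.
- apply/eqmxP/rV_eqP => u; rewrite sub_capmx; apply/cycle_mxP/andP => [[uT uA]|].
    split; last by apply/sub_kermxP/uA/setU11.
    by apply/cycle_mxP; split=> // l Al; apply/uA/setU1r.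
  case=> /cycle_mxP[uT uA] /sub_kermxP ui; split=> // l /setU1P[->//|]; exact: uA.
(* The image is all of Z(T - i, A) by lifting along [i]. *)
apply/eqmxP; rewrite (cycle_mx_forget k rankedQ) // andbT.
rewrite -{2}(setD1K Ti); apply: liftQ; rewrite ?setD11 //.
  apply/subsetP=> l Al; rewrite !inE (subsetP sAT) // andbT.
  by apply: contraNneq Ai => <-.
rewrite !(rkE rankedQ) rank_bot rankedQ.1.
by move/subsetP/(_ _ Ti): Tpr; rewrite inE.
Qed.

(** No map has to kill a vector of Z(T, set0), which is therefore the permutation module on typed
    chains. Stripping the extrema is an equivariant bijection from the maximal chains onto these. *)
Lemma cycle_class0 T : T \subset proper_ranks n ->
  cycle_class T set0 = alpha k to (fset_of T).
Proof.
move=> Tpr; rewrite /alpha (K0_class_submodule (mxmodule1 _)).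
have modT := supp_mx_module k (fun g C => pact_typed_chain g T C).
have mod1 := supp_mx_module k (to := sub_action (@pact_selected_chains G d Q to (fset_of T)))
   (p := predT) (fun g s => erefl).
transitivity (submodule_class modT).
  apply: submodule_class_eqmx; apply/eqmxP/rV_eqP=> u.
  apply/cycle_mxP/sub_supp_mxP => [[]//|uT]; split=> // l; by rewrite inE.
have -> : submodule_class (mxmodule1 (perm_repr k (sub_action (@pact_selected_chains G d Q to (fset_of T)))))
   = submodule_class mod1.
  by apply: submodule_class_eqmx; rewrite supp_mxT.
pose h (C : {C | C \in max_chains (rank_selected Q (fset_of T))}) : {set Q} :=
  val C :\: [set \bot%O; \top%O].
symmetry; apply: (push_submodule_class (h := h)).
- move=> [C maxC] [D maxD] _ _ ; rewrite /h /= => CD.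
  apply: val_inj => /=; move: (maxC) (maxD).
  rewrite !(max_chains_selected rankedQ) // => /andP[sC _] /andP[sD _].
  by rewrite -(setID C [set \bot%O; \top%O]) -(setID D [set \bot%O; \top%O]) CD (setIidPr sC) (setIidPr sD).
- by move=> [C maxC] _ /=; rewrite /h /=; move: (maxC); rewrite (max_chains_selected rankedQ) // => /andP[].
- move=> c Tc; pose C := [set \bot%O; \top%O] :|: c.
  have cD : C :\: [set \bot%O; \top%O] = c.
    apply/setP=> z; rewrite in_setD [z \in C]in_setU; case/and3P: Tc => _ /subsetP sc _.
    apply/andP/idP => [[/negPf Nz /orP[]//]|zc]; first by rewrite Nz.
    by split; [have := sc z zc; rewrite !inE negb_or lt0x ltx1|rewrite zc orbT].
  have maxC : C \in max_chains (rank_selected Q (fset_of T)).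
    by rewrite (max_chains_selected rankedQ) // subsetUl cD.
  by exists (exist _ C maxC).
move=> C g; rewrite /h /=; apply/setP=> z; rewrite -[z](actKV to g) mem_pact.
rewrite !in_setD mem_pact; congr (~~ _ && _).
rewrite !inE -{1}(pact_bot to g) -{1}(pact_top to g).
by rewrite !(inj_eq (act_inj to g)).
Qed.

End BetaHomology.

(** * Moebius inversion over subsets *)

Section Mobius.
Variables (I : finType) (V : zmodType).
Implicit Types (A B E R S T U : {set I}).

(** Toggling a fixed element of R outside E pairs the terms with opposite signs. *)
Lemma sum_sign_interval E R : E \subset R ->
  \sum_(T : {set I} | (E \subset T) && (T \subset R)) (-1) ^+ #|R :\: T| =
  (E == R)%:R :> int.
Proof.
move=> sER; have [<-{R sER}|neqER] := eqVneq E R.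
  rewrite (big_pred1 E) => [|T]; first by rewrite setDv cards0 expr0.
  by rewrite /= eqEsubset andbC.
have /properP[_ [i Ri Ei]] : E \proper R by rewrite properEneq neqER.
rewrite (bigID (fun T : {set I} => i \in T)) /=.
rewrite (reindex_onto (fun T => i |: T) (fun T => T :\ i)) /=; last first.
  by move=> T /andP[_ Ti]; rewrite setD1K.
rewrite -[X in _ + X]opprK -sumrN; apply/eqP; rewrite subr_eq0; apply/eqP.
apply: eq_big => [T|T].
  rewrite setU11 andbT subUset sub1set Ri /=.
  have [Ti|Ti] := boolP (i \in T).
    rewrite andbF; apply/negbTE; rewrite negb_and; apply/orP; right.
    by apply: contraTneq Ti => <-; rewrite setD11.
  rewrite setU1K // eqxx !andbT; congr (_ && _).
  apply/subsetP/subsetP => sE j Ej; last by rewrite inE sE ?orbT.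
  by case/setU1P: (sE j Ej) => // ji; rewrite ji (negbTE Ei) in Ej.
case/andP=> _ /eqP Ti.
have {}Ti : i \notin T by rewrite -Ti setD11.
have -> : R :\: T = i |: (R :\: (i |: T)).
  apply/setP=> j; rewrite !inE negb_or; case: eqP => [->|//]; by rewrite Ti Ri.
by rewrite cardsU1 !inE eqxx /= exprS mulN1r opprK.
Qed.

Lemma sum_sign_interval_low E R : E \subset R ->
  \sum_(T : {set I} | (E \subset T) && (T \subset R)) (-1) ^+ #|T :\: E| =
  (E == R)%:R :> int.
Proof.
move=> sER; transitivity ((-1) ^+ #|R :\: E| * (E == R)%:R : int); last first.
  by case: eqP => [->|]; rewrite ?setDv ?cards0 ?expr0 ?mul1r ?mulr0.
rewrite -sum_sign_interval // mulr_sumr; apply: eq_bigr => T /andP[sET sTR].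
rewrite -exprD -signr_odd -[RHS]signr_odd; congr ((-1) ^+ nat_of_bool _).
have := cardsD R E; have := cardsD T E; have := cardsD R T.
rewrite (setIidPr sER) (setIidPr sET) (setIidPr sTR).
have := subset_leq_card sET; have := subset_leq_card sTR; lia.
Qed.

Definition mobius (f : {set I} -> V) S : V :=
  \sum_(B : {set I} | B \subset S) f B *~ (-1) ^+ #|S :\: B|.

Lemma sum_mobius f T : f T = \sum_(U : {set I} | U \subset T) mobius f U.
Proof.
rewrite /mobius (exchange_big_dep (fun B : {set I} => B \subset T)) /=; last first.
  by move=> U B sUT sBU; exact: subset_trans sUT.
under eq_bigr => B sBT.
  rewrite -mulrz_sumr.
  under eq_bigl do rewrite andbC.
  rewrite sum_sign_interval_low //.
  over.
rewrite (bigD1 T) //= eqxx [X in _ + X]big1 ?addr0 // => B /andP[_ /negbTE->].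
by rewrite mulr0z.
Qed.

(** Solving the recursion for the larger second argument and iterating gives [y T A] as an
    alternating sum of [y (T :\: B) set0] over the subsets B of A; then A = T. *)
Lemma mobius_recursion (y : {set I} -> {set I} -> V) R :
    (forall T A i, T \subset R -> A \subset T -> i \in T -> i \notin A ->
       y T A = y T (i |: A) + y (T :\ i) A) ->
  forall T, T \subset R -> y T T = mobius (y^~ set0) T.
Proof.
move=> yE.
suff y_sum A T : T \subset R -> A \subset T ->
    y T A = \sum_(B : {set I} | B \subset A) y (T :\: B) set0 *~ (-1) ^+ #|B|.
  move=> T sTR; rewrite y_sum // /mobius.
  rewrite (reindex_onto (fun B => T :\: B) (fun B => T :\: B)) /=; last first.
    by move=> B sBT; rewrite setDDr setDv set0U (setIidPr sBT).
  apply: eq_big => [B|B]; last by case/andP=> _ /eqP->.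
  rewrite subsetDl /= setDDr setDv set0U.
  by apply/eqP/idP=> [<-|/setIidPr//]; rewrite subsetIl.
have [m] := ubnP #|A|; elim: m A T => // m IHm A T lt_m sTR sAT.
have [->|/set0Pn[i Ai]] := eqVneq A set0.
  rewrite (big_pred1 set0) => [|B]; last exact: subset0.
  by rewrite setD0 cards0 mulr1z.
have lt_A' : (#|A :\ i| < m)%N by have := cardsD1 i A; rewrite Ai; lia.
have Ti := subsetP sAT _ Ai.
have sA'T : A :\ i \subset T by exact: subset_trans (subsetDl _ _) sAT.
have := yE T (A :\ i) i sTR sA'T Ti (negbT (setD11 _ _)).
rewrite setD1K // => /esym/(canRL (addrK _))->.
rewrite !IHm //; [|exact: subset_trans (subsetDl _ _) sTR|exact: setSD].
rewrite [RHS](bigID (fun B : {set I} => i \in B)) /= [RHS]addrC; congr (_ + _).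
  apply: eq_bigl => B; rewrite subsetD1 //.
rewrite [RHS](reindex_onto (fun B => i |: B) (fun B => B :\ i)) /=; last first.
  by move=> B /andP[_ Bi]; rewrite setD1K.
rewrite -sumrN; apply: eq_big => [B|B].
  rewrite setU11 andbT subUset sub1set Ai subsetD1 /=; congr (_ && _).
  by apply/idP/eqP => [/setU1K//|<-]; rewrite setD11.
by rewrite subsetD1 => /andP[_ Bi]; rewrite cardsU1 Bi exprS mulN1r mulrNz setDDl.
Qed.

(** Expanding [f T] by its Moebius inverse turns the product into a sum over pairs (U, w) with U and
    [D w] inside T. Inversion at R leaves the pairs with U :|: D w = R, that is, those where [D w]
    contains the complement S of U. *)
Lemma mobius_mulrn_card (W : finType) (D : W -> {set I}) (f : {set I} -> V) R :
    (forall w, D w \subset R) ->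
  mobius (fun T => f T *+ #|[set w | D w \subset T]|) R =
  \sum_(S : {set I} | S \subset R) mobius f (R :\: S) *+ #|[set w | S \subset D w]|.
Proof.
move=> sDR.
have sum_card (p : pred W) (x : V) : x *+ #|[set w | p w]| = \sum_w x *~ (p w)%:R.
  rewrite -sum1_card -sumrMnr big_mkcond /=; apply: eq_bigr => w _; rewrite inE.
  by case: (p w).
pose g := mobius f.
transitivity (\sum_(U : {set I} | U \subset R) g U *+ #|[set w | U :|: D w == R]|); last first.
  rewrite (reindex_onto (fun S => R :\: S) (fun S => R :\: S)) /=; last first.
    by move=> B sBT; rewrite setDDr setDv set0U (setIidPr sBT).
  have DDE S : (R :\: S \subset R) && (R :\: (R :\: S) == S) = (S \subset R).
    rewrite subsetDl /= setDDr setDv set0U.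
    by apply/eqP/idP=> [<-|/setIidPr//]; rewrite subsetIl.
  apply: eq_big => [S|S]; rewrite DDE // => sSR.
  rewrite /g; congr (_ *+ _); apply: eq_card => w; rewrite !inE.
  rewrite eqEsubset subUset subsetDl sDR /=.
  apply/subsetP/subsetP => [sR i Si|sS i Ri].
    by have := sR i (subsetP sSR i Si); rewrite !inE Si.
  by rewrite !inE Ri andbT; case: (boolP (i \in S)) => //= /sS.
rewrite /mobius.
transitivity (\sum_(T : {set I} | T \subset R) \sum_(U : {set I} | U \subset T)
    g U *~ (\sum_w (D w \subset T)%:R * (-1) ^+ #|R :\: T|)).
  apply: eq_bigr => T _; rewrite (sum_mobius f T) -/g sum_card -mulrz_sumr -mulrzA.
  by rewrite -mulrz_suml mulr_suml.
rewrite (exchange_big_dep (fun U : {set I} => U \subset R)) /=; last first.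
  by move=> T U sTR sUT; exact: subset_trans sTR.
apply: eq_bigr => U sUR; rewrite sum_card -mulrz_sumr -mulrz_sumr exchange_big /=.
congr (_ *~ _); apply: eq_bigr => w _.
rewrite -sum_sign_interval ?subUset ?sUR ?sDR // big_mkcond [RHS]big_mkcond.
apply: eq_bigr => T _; rewrite subUset.
by case: (U \subset T); case: (T \subset R); case: (D w \subset T); rewrite ?mul1r ?mul0r.
Qed.

End Mobius.

Section FsetSums.
Variables (m : nat) (V : zmodType).

Lemma fset_of_inj : injective (@fset_of m).
Proof.
move=> A B AB; apply/setP=> i; by rewrite -!in_fset_of AB.
Qed.

Lemma fset_ofP (S : {fset nat}) : (forall i, i \in S -> (i < m)%N) ->
  fset_of [set i : 'I_m | (i : nat) \in S] = S.
Proof.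
move=> S_lt; apply/fsetP=> i; apply/imfsetP/idP => [[j]|Si].
  by rewrite inE => Sj ->.
by exists (Ordinal (S_lt i Si)); rewrite ?inE.
Qed.

Lemma sum_fset_of (X : {fset {fset nat}}) (F : {fset nat} -> V) :
    (forall S i, S \in X -> i \in S -> (i < m)%N) ->
  \sum_(S <- X) F S = \sum_(T : {set 'I_m} | fset_of T \in X) F (fset_of T).
Proof.
move=> X_lt; rewrite -(big_map (@fset_of m) (fun S => S \in X) F).
rewrite -big_filter; apply: perm_big; apply: uniq_perm => //.
  by rewrite filter_uniq // map_inj_uniq ?index_enum_uniq //; exact: fset_of_inj.
move=> S; rewrite mem_filter; case: (boolP (S \in X)) => //= SX; symmetry.
apply/mapP; exists [set i : 'I_m | (i : nat) \in S]; first exact: mem_index_enum.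
by rewrite fset_ofP // => i; exact: X_lt.
Qed.

Lemma fset_ofS (A B : {set 'I_m}) : (fset_of A `<=` fset_of B)%fset = (A \subset B).
Proof.
apply/fsubsetP/subsetP => AB i.
  by rewrite -!in_fset_of; exact: AB.
by case/imfsetP=> j /= /AB Bj ->; rewrite in_fset_of.
Qed.

Lemma fset_ofD (A B : {set 'I_m}) :
  fset_of (A :\: B) = (fset_of A `\` fset_of B)%fset.
Proof.
apply/fsetP=> i; rewrite in_fsetD; apply/imfsetP/andP => [[j /=]|[Bi]].
  by rewrite inE => /andP[Bj Aj] ->; rewrite !in_fset_of.
case/imfsetP=> j /= Aj ij; exists j => //=.
by rewrite ij in_fset_of in Bi; rewrite inE Bi.
Qed.

Lemma card_fset_of (A : {set 'I_m}) : #|` fset_of A| = #|A|.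
Proof.
by rewrite card_imfset /= ?cardE //; exact: val_inj.
Qed.

Lemma in_fset_of_lt (A : {set 'I_m}) i : i \in fset_of A -> (i < m)%N.
Proof. by case/imfsetP=> j _ ->. Qed.

End FsetSums.

Lemma beta_mobius (k : fieldType) (G : finGroupType) d (Q : finTBPOrderType d)
    (to : poset_action G Q) m (T : {set 'I_m}) :
  beta k to (fset_of T) = mobius (fun B => alpha k to (fset_of B)) T.
Proof.
rewrite /beta (@sum_fset_of m).
  by apply: eq_big => B; rewrite fpowersetE fset_ofS // -fset_ofD card_fset_of.
by move=> S i; rewrite fpowersetE => /fsubsetP sST /sST/in_fset_of_lt.
Qed.

Lemma beta_cycle_class (k : fieldType) (G : finGroupType) n d (Q : finTBPOrderType d)
    (to : poset_action G Q) (T : {set 'I_n.+2}) :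
    ranked n Q -> lifting k n (\bot%O : Q) \top%O -> T \subset proper_ranks n ->
  beta k to (fset_of T) = cycle_class k to T T.
Proof.
move=> rkQ liftQ sT; rewrite beta_mobius.
rewrite (@mobius_recursion _ _ _ (proper_ranks n)) //; last first.
  by move=> T' A i ? ? ? ?; exact: cycle_class_setU1.
apply: eq_bigr => B sB; rewrite cycle_class0 //; exact: subset_trans sT.
Qed.

(** * Cohen-Macaulay posets have the lifting property *)

(** The terms for (i, j) and (j, i) cancel. The diagonal is a separate hypothesis because
    [F i i = - F i i] does not give 0 in characteristic 2. *)
Lemma sum_antisymmetric (I : finType) (V : zmodType) (P : pred I) (F : I -> I -> V) :
    (forall i, F i i = 0) -> (forall i j, F i j = - F j i) ->
  \sum_(i | P i) \sum_(j | P j) F i j = 0.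
Proof.
move=> F0 FN; pose r (i : I) := enum_rank i : nat.
have -> : \sum_(i | P i) \sum_(j | P j) F i j =
    \sum_(i | P i) \sum_(j | P j && (r j < r i)%N) F i j +
    \sum_(i | P i) \sum_(j | P j && (r i < r j)%N) F i j.
  rewrite -big_split /=; apply: eq_bigr => i Pi.
  rewrite (bigID (fun j => (r j < r i)%N)) /=; congr (_ + _).
  rewrite (bigD1 i) ?ltnn ?Pi //= F0 add0r; apply: eq_bigl => j.
  rewrite -leqNgt -andbA; congr (_ && _); rewrite ltn_neqAle andbC; congr (_ && _).
  by rewrite eq_sym -[i == j](inj_eq enum_rank_inj).
rewrite [X in _ + X](exchange_big_dep P) /=; last by move=> i j _ /andP[].
rewrite -big_split big1 //= => i Pi.
apply/eqP; rewrite addr_eq0 -sumrN; apply/eqP.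
under [RHS]eq_bigl => j do rewrite Pi /=.
by apply: eq_bigr => j _; rewrite FN.
Qed.

Section SignedForget.
Variables (k : fieldType) (n : nat) (d : Order.disp_t) (Q : finTBPOrderType d).
Hypothesis rankedQ : ranked n Q.
Implicit Types (x y z : Q) (C D : {set Q}) (T A U : {set 'I_n.+2}) (i j l : 'I_n.+2).
Implicit Types (u v : 'rV[k]_#|{set Q}|).
Local Notation rk := (@rk n d Q).
Local Notation forget l := (forget_mx k Q l).

Lemma forget_supp (p : pred {set 'I_n.+2}) u l :
  u *m supp_mx k (fun C => p (rk @: C)) *m forget l =
  u *m forget l *m supp_mx k (fun D => p (l |: rk @: D)).
Proof.
apply: entry_inj => D; rewrite entry_supp !entry_forget mulr_sumr.
apply: eq_bigr => z /andP[_ /eqP rz].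
by rewrite entry_supp imsetU1 rz.
Qed.

(* With these signs the forgetful maps anticommute and add up to the           *)
(* simplicial boundary on chains.                                              *)
Definition rank_sign l C : k := (-1) ^+ #|[set y in C | (rk y < l)%N]|.

Definition sign_mx l : 'M[k]_#|{set Q}| := diag_mx (\row_r rank_sign l (enum_val r)).

Lemma entry_sign u l C : entry (u *m sign_mx l) C = rank_sign l C * entry u C.
Proof.
by rewrite /entry /sign_mx mul_mx_diag !mxE enum_rankK mulrC.
Qed.

Lemma sign_mxK l u : u *m sign_mx l *m sign_mx l = u.
Proof.
apply: entry_inj => C; rewrite !entry_sign mulrA /rank_sign -expr2 sqrr_sign.
by rewrite mul1r.
Qed.

Lemma rank_signU1 i z D : z \notin D ->
  rank_sign i (z |: D) = (-1) ^+ (rk z < i)%N * rank_sign i D.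
Proof.
move=> Dz; rewrite /rank_sign -exprD; congr (_ ^+ _).
have [lt_zi|le_iz] := ltnP (rk z) i.
  rewrite (_ : [set y in z |: D | _] = z |: [set y in D | (rk y < i)%N]).
    by rewrite cardsU1 !inE (negbTE Dz).
  by apply/setP=> y; rewrite !inE; case: eqP => [->|//]; rewrite lt_zi.
rewrite add0n; apply: eq_card => y; rewrite !inE.
by case: eqP => [->|//]; rewrite ltnNge le_iz /= andbF.
Qed.

(** Removing the element of rank [j] changes the number of elements of rank below [i] exactly when j
    < i. *)
Lemma sign_forget u i j :
  u *m sign_mx i *m forget j = (-1) ^+ (j < i)%N *: (u *m forget j *m sign_mx i).
Proof.
apply: entry_inj => D; rewrite entryZ entry_sign !entry_forget !mulr_sumr.
apply: eq_bigr => z /andP[Dz /eqP rz].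
by rewrite entry_sign rank_signU1 // rz mulrA.
Qed.

Definition signed_forget l := forget l *m sign_mx l.

Lemma signed_forget_eq0 u l : (u *m signed_forget l == 0) = (u *m forget l == 0).
Proof.
rewrite mulmxA; apply/eqP/eqP => [|->]; last by rewrite mul0mx.
by move/(congr1 (mulmx^~ (sign_mx l))); rewrite sign_mxK mul0mx.
Qed.

Lemma entry_signed_neq0 u l D : entry (u *m signed_forget l) D != 0 ->
  exists z, [/\ z \notin D, rk z = l & entry u (z |: D) != 0].
Proof.
rewrite mulmxA entry_sign mulf_eq0 negb_or => /andP[_]; exact: entry_forget_neq0.
Qed.

(** The two orders pick up the signs for j < i and for i < j, exactly one of which is -1. *)
Lemma signed_forgetC u i j : i != j ->
  u *m signed_forget i *m signed_forget j = - (u *m signed_forget j *m signed_forget i).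
Proof.
move=> neq_ij; rewrite /signed_forget !mulmxA !sign_forget -!scalemxAl.
rewrite -(mulmxA u (forget j)) (forget_mxC k Q j i) mulmxA.
have -> : forall w : 'rV[k]_#|{set Q}|, w *m sign_mx i *m sign_mx j = w *m sign_mx j *m sign_mx i.
  by move=> w; apply: entry_inj => C; rewrite !entry_sign mulrCA.
rewrite -scaleNr; congr (_ *: _).
by move: neq_ij; rewrite -val_eqE /= neq_ltn => /orP[] lt_; rewrite lt_ ltnNge (ltnW lt_) /= ?opprK.
Qed.

Definition chainly u := forall C, entry u C != 0 -> chain C.

(** A chain has at most one element of each rank. *)
Lemma signed_forget_sq u l : chainly u -> u *m signed_forget l *m signed_forget l = 0.
Proof.
move=> uc; apply: entry_inj => D; rewrite entry0; apply/eqP/negPn/negP.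
case/entry_signed_neq0=> z [Dz rz] /entry_signed_neq0[z' [Dz' rz'] /uc cC].
have := rk_setU1_notin rankedQ Dz' cC.
by rewrite rz' -rz imset_f // setU11.
Qed.

Lemma sum_signed_sq u (P : pred 'I_n.+2) : chainly u ->
  \sum_(l | P l) (\sum_(l' | P l') u *m signed_forget l') *m signed_forget l = 0.
Proof.
move=> uc; under eq_bigr do rewrite mulmx_suml.
apply: sum_antisymmetric => [i|i j]; first exact: signed_forget_sq.
have [->|neq_ij] := eqVneq i j; last by apply: signed_forgetC; rewrite eq_sym.
by rewrite signed_forget_sq // oppr0.
Qed.

Lemma boundary_signed u : chainly u ->
  u *m boundary_mx Q k = \sum_l u *m signed_forget l.
Proof.
move=> uc; apply: entry_inj => D.
rewrite boundary_removal entry_removal entry_sum (partition_big rk predT) //=.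
apply: eq_bigr => l _; rewrite mulmxA entry_sign entry_forget mulr_sumr.
apply: eq_bigr => z /andP[Dz /eqP rz].
have [->|/uc cD] := eqVneq (entry u (z |: D)) 0; first by rewrite !mulr0.
congr (_ * _); rewrite /rank_sign; congr (_ ^+ _); apply: eq_card => y.
rewrite !inE; case: (eqVneq y z) => [->|neq_yz] /=.
  by rewrite ltxx (negbTE Dz).
case: (boolP (y \in D)) => //= Dy.
by rewrite (chain_rk_lt rankedQ cD) ?setU11 ?setU1r // rz.
Qed.

End SignedForget.

Section OrderEmbedding.
Variables (k : fieldType) (dY dQ : Order.disp_t).
Variables (Y : finPOrderType dY) (Q : finPOrderType dQ) (e : Y -> Q).
Variable p : pred Q.
Hypothesis e_mono : {mono e : x y / (x <= y)%O}.
Hypothesis e_image : forall z, p z <-> exists y, e y = z.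
Implicit Types (C D : {set Y}) (E : {set Q}).

Let h C : {set Q} := e @: C.

Lemma embedding_inj : injective e.
Proof. by move=> x y exy; apply: le_anti; rewrite -!e_mono exy lexx. Qed.

Lemma embedding_lt : {mono e : x y / (x < y)%O}.
Proof. by move=> x y; rewrite !lt_neqAle e_mono (inj_eq embedding_inj). Qed.

Lemma embedding_set_inj : injective h.
Proof. exact/imset_inj/embedding_inj. Qed.

Lemma embedding_chain C : chain (e @: C) = chain C.
Proof.
apply/chainP/chainP => cC.
  move=> x y Cx Cy; have := cC _ _ (imset_f e Cx) (imset_f e Cy).
  by rewrite /Order.comparable !e_mono.
move=> _ _ /imsetP[x Cx ->] /imsetP[y Cy ->].
by rewrite /Order.comparable !e_mono; exact: cC.
Qed.

Lemma embedding_preim E : E \subset [set z | p z] -> exists C, e @: C = E.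
Proof.
move=> /subsetP pE; exists (e @^-1: E); apply/setP=> z.
apply/imsetP/idP => [[y]|Ez]; first by rewrite inE => ? ->.
have /e_image[y eyz] : p z by have := pE z Ez; rewrite inE.
by exists y; rewrite // inE eyz.
Qed.

Lemma embedding_p y : p (e y). Proof. by apply/e_image; exists y. Qed.

(** The embedding identifies the chains of [Y] with the chains of [Q] inside [p]. A set that
    contains an element outside [p] is not an image, so only elements of [Y] contribute to the
    boundary of an image. *)
Lemma embedding_boundary :
  boundary_mx Y k *m push_mx k h = push_mx k h *m boundary_mx Q k.
Proof.
apply/row_matrixP => r; rewrite !rowE !mulmxA; move: 'e_r => u.
apply: entry_inj => E; rewrite !boundary_removal [RHS]entry_removal.
have [pE|NpE] := boolP (E \subset [set z | p z]).
  have [D eD] := embedding_preim pE; rewrite -eD.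
  rewrite -/(h D) entry_push_inj; last exact: embedding_set_inj.
  rewrite [LHS]entry_removal.
  rewrite [RHS](bigID p) /= [X in _ = _ + X]big1 ?addr0; last first.
    move=> z /andP[_ Npz]; rewrite entry_push_notin ?mulr0 // => C.
    apply: contraNneq Npz => hC.
    have : z \in h C by rewrite hC setU11.
    by case/imsetP=> y _ ->; exact: embedding_p.
  rewrite [RHS](eq_bigl (fun z => z \in e @: ~: D)); last first.
    move=> z; apply/andP/imsetP => [[Dz /e_image[y eyz]]|[y Dy ->]].
      by exists y => //; rewrite inE; apply: contra Dz => Dy; rewrite -eyz imset_f.
    split; last exact: embedding_p.
    by apply/imsetP=> -[y' Dy' /embedding_inj yy']; rewrite inE yy' Dy' in Dy.
  rewrite big_imset /=; last by move=> y y' _ _; exact: embedding_inj.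
  apply: eq_big => [y|y _]; first by rewrite inE.
  rewrite -imsetU1 -/(h _) entry_push_inj; last exact: embedding_set_inj.
  congr (_ ^+ _ * _); rewrite -(card_imset _ embedding_inj); apply: eq_card => z.
  apply/imsetP/idP => [[y']|].
    case=> /setIdP[Cy' lt_y'] ->; apply/setIdP; rewrite embedding_lt; split=> //.
    exact: imset_f.
  case/setIdP=> /imsetP[y' Cy' ->]; rewrite embedding_lt => lt_y'.
  by exists y' => //; apply/setIdP.
rewrite entry_push_notin; last first.
  move=> C; apply: contraNneq NpE => <-; apply/subsetP=> z /imsetP[y _ ->].
  by rewrite inE embedding_p.
rewrite big1 // => z _; rewrite entry_push_notin ?mulr0 // => C.
apply: contraNneq NpE => hC; apply/subsetP=> z' Ez'.
have : z' \in h C by rewrite hC setU1r.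
by case/imsetP=> y _ ->; rewrite inE embedding_p.
Qed.

Lemma push_embedding_inj (u : 'rV_#|{set Y}|) : u *m push_mx k h = 0 -> u = 0.
Proof.
move=> uh0; apply: entry_inj => C; rewrite entry0.
by rewrite -(entry_push_inj _ _ embedding_set_inj) uh0 entry0.
Qed.

(** The vanishing of homology of [Y], rewritten for chains of [Q], so that all open intervals are
    treated within one vector space. The chain [c] shows that m lies in the range where homology
    vanishes. *)
Lemma homology_top_lift m (v : 'rV[k]_#|{set Q}|) (c : {set Q}) :
    homology_only_on_top Y k ->
    chain c -> c \subset [set z | p z] -> (m < #|c|)%N ->
    (forall E, entry v E != 0 -> [&& chain E, E \subset [set z | p z] & #|E| == m]) ->
    v *m boundary_mx Q k = 0 ->
  exists2 u, u *m boundary_mx Q k = v &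
    forall E, entry u E != 0 -> [&& chain E, E \subset [set z | p z] & #|E| == m.+1].
Proof.
move=> topY cc sc lt_mc vP v0.
have /topY cyc_bd : (m < \max_(C : {set Y} | chain C) #|C|)%N.
  have [C eC] := embedding_preim sc.
  apply: (bigop.bigmax_sup C); first by rewrite -embedding_chain eC.
  by rewrite -(card_imset _ embedding_inj) eC.
pose v' := vec (fun C => entry v (h C)).
have v'h : v' *m push_mx k h = v.
  apply: entry_inj => E; have [pE|NpE] := boolP (E \subset [set z | p z]).
    have [D <-] := embedding_preim pE.
    by rewrite -/(h D) entry_push_inj ?vecE //; exact: embedding_set_inj.
  rewrite entry_push_notin.
    by apply/esym/eqP; apply: contraNT NpE => /vP/and3P[].
  move=> C; apply: contraNneq NpE => <-; apply/subsetP=> z /imsetP[y _ ->].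
  by rewrite inE embedding_p.
have v'_cycle : (v' <= cycles Y k m)%MS.
  rewrite sub_capmx; apply/andP; split.
    apply/sub_supp_mxP => C; rewrite vecE => /vP/and3P[chC _ cardC].
    by rewrite /is_simplex -embedding_chain chC -(card_imset _ embedding_inj).
  apply/sub_kermxP/push_embedding_inj.
  by rewrite -mulmxA embedding_boundary mulmxA v'h.
have /submxP[w] := submx_trans v'_cycle cyc_bd.
rewrite /boundaries mulmxA => v'w.
exists (w *m chain_mx Y k m.+1 *m push_mx k h).
  by rewrite -[_ *m boundary_mx Q k]mulmxA -embedding_boundary mulmxA -v'w.
move=> E; have [pE|NpE] := boolP (E \subset [set z | p z]); last first.
  rewrite entry_push_notin ?eqxx // => C.
  apply: contraNneq NpE => <-; apply/subsetP=> z /imsetP[y _ ->].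
  by rewrite inE embedding_p.
have [D <-] := embedding_preim pE.
rewrite -/(h D) entry_push_inj; last exact: embedding_set_inj.
have /sub_supp_mxP wP := submxMl w (chain_mx Y k m.+1).
move/wP => /andP[cD /eqP cardD].
by rewrite embedding_chain cD /= card_imset ?cardD //; exact: embedding_inj.
Qed.

End OrderEmbedding.

Section IntervalLifting.
Variables (k : fieldType) (n : nat) (d : Order.disp_t) (Q : finTBPOrderType d).
Hypothesis rankedQ : ranked n Q.
Implicit Types (C D : {set Q}) (T A U : {set 'I_n.+2}) (i j l : 'I_n.+2).
Implicit Types (u v w g : 'rV[k]_#|{set Q}|).
Local Notation rk := (@rk n d Q).
Local Notation forget l := (forget_mx k Q l).
Local Notation dl l := (signed_forget k Q l).
Variables x y : Q.

Definition interval_chain C := chain C && (C \subset [set z | (x < z < y)%O]).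

Definition typed_supp (p : pred {set 'I_n.+2}) u :=
  forall C, entry u C != 0 -> interval_chain C && p (rk @: C).

Lemma typed_supp_chainly p u : typed_supp p u -> chainly u.
Proof. by move=> up C /up/andP[/andP[]]. Qed.

Lemma interval_chainU1 z D : interval_chain (z |: D) -> interval_chain D.
Proof.
case/andP=> cD sD; rewrite /interval_chain (chainS _ cD) ?subsetU1 //=.
exact: subset_trans (subsetU1 _ _) sD.
Qed.

Definition liftable T A i :=
  (cycle_mx k x y T A <= cycle_mx k x y (i |: T) A *m forget i)%MS.

(** [liftable] speaks of one rank set at a time; a vector with mixed rank sets is lifted component
    by component. *)
Lemma lift_types (p q : pred {set 'I_n.+2}) A i u :
    (forall T, p T -> [/\ liftable T A i & q (i |: T)]) ->
    typed_supp p u -> (forall l, l \in A -> u *m forget l = 0) ->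
  exists h, [/\ typed_supp q h, forall l, l \in A -> h *m forget l = 0 &
    h *m dl i = u].
Proof.
move=> plift up uA.
pose W := (supp_mx k (fun C => interval_chain C && q (rk @: C)) :&:
           \bigcap_(l in A) kermx (forget l))%MS.
(* Twisting by the sign of [i], which is its own inverse, turns a lift through [forget i] into one
   through the signed map. *)
pose v := u *m sign_mx k Q i.
have vp : typed_supp p v.
  by move=> C; rewrite entry_sign mulf_eq0 negb_or => /andP[_ /up].
have vA l : l \in A -> v *m forget l = 0.
  by move=> Al; rewrite sign_forget uA // mul0mx scaler0.
have v_sum : v = \sum_(T | p T) v *m supp_mx k (fun C => rk @: C == T).
  apply: entry_inj => C; rewrite entry_sum.
  under eq_bigr do rewrite entry_supp.
  have [->|/vp/andP[_ pC]] := eqVneq (entry v C) 0.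
    by rewrite big1 // => T _; rewrite mulr0.
  rewrite (bigD1 (rk @: C)) //= eqxx mul1r big1 ?addr0 // => T /andP[_].
  by rewrite eq_sym => /negbTE->; rewrite mul0r.
have : (v <= W *m forget i)%MS.
  rewrite v_sum; apply: summx_sub => T pT.
  have [liftT qT] := plift T pT.
  apply: (submx_trans (B := cycle_mx k x y T A)); last first.
    apply: submx_trans liftT _; apply: submxMr; apply: capmxS => //.
    by apply: supp_mxS => C /and3P[cC sC /eqP->]; rewrite /interval_chain cC sC.
  apply/cycle_mxP; split=> [C|l Al].
    rewrite entry_supp mulf_eq0 negb_or => /andP[eqT /vp/andP[/andP[cC sC] _]].
    rewrite /typed_chain cC sC /=; apply: contraNT eqT => /negbTE->; exact: eqxx.
  by rewrite (forget_supp (fun U => U == T)) vA // mul0mx.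
case/submxP=> B vB; have := submxMl B W; set h := B *m W in vB *.
rewrite sub_capmx => /andP[/sub_supp_mxP hq /sub_bigcapmxP hA]; exists h; split=> //.
  by move=> l Al; apply/sub_kermxP/hA.
by rewrite mulmxA -(mulmxA B) -vB sign_mxK.
Qed.

Lemma forget_not_in p u l D : typed_supp p u -> entry (u *m dl l) D != 0 ->
  exists z, [/\ z \notin D, rk z = l, l \notin rk @: D,
    p (l |: rk @: D) & interval_chain (z |: D)].
Proof.
move=> up /entry_signed_neq0[z [Dz rz uz]]; exists z.
have /andP[iz] := up _ uz; rewrite imsetU1 rz => pz.
have /andP[cz _] := iz.
by split=> //; rewrite -rz; exact: rk_setU1_notin.
Qed.

(* Exactness below the top of the complex of chains with ranks in U that       *)
(* contain rank j. Induction on U minus A: choose i outside A, remove the      *)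
(* part without rank i by the boundary of a lift of it; what remains is also   *)
(* killed by forgetting i.                                                     *)
Lemma cube_exact j U :
    (forall T A i, A \subset T -> i \notin T -> j \in T -> j \notin A ->
       i \in U -> liftable T A i) ->
  forall A m u, A \subset U -> j \notin A -> j \in U ->
    typed_supp (fun T => [&& j \in T, A \subset T, T \subset U & #|T| == m]) u ->
    (m < #|U|)%N -> (forall l, l \in A -> u *m forget l = 0) ->
    \sum_(l | l != j) u *m dl l = 0 ->
  exists2 g, typed_supp (fun T => [&& j \in T, T \subset U & #|T| == m.+1]) g &
    u = \sum_(l | l != j) g *m dl l.
Proof.
move=> liftj A; have [r] := ubnP #|U :\: A|; elim: r A => // r IHr A ltr m u.
move=> sAU Aj Uj uP lt_mU uA ud.
have [/existsP[i /and3P[Ui Ai ij]]|/existsPn Ni] :=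
    boolP [exists i, [&& i \in U, i \notin A & i != j]]; last first.
  (* Here U lies in j + A, so every chain in the support of [u] would have all ranks of U, which are
     too many: u = 0. *)
  exists 0 => [C|]; first by rewrite entry0 eqxx.
  rewrite big1 => [|l _]; last by rewrite mul0mx.
  apply: entry_inj => C; rewrite entry0; apply/eqP/negPn/negP.
  case/uP/andP=> _ /and4P[jC sAC _ /eqP cardC].
  have /subset_leq_card : U \subset rk @: C.
    apply/subsetP=> l Ul; have := Ni l; rewrite Ul /= negb_and !negbK.
    by case/orP=> [/(subsetP sAC)//|/eqP->].
  by rewrite cardC leqNgt lt_mU.
pose p T := [&& j \in T, A \subset T, T \subset U & #|T| == m] && (i \notin T).
pose q T := [exists T' : {set 'I_n.+2}, p T' && (T == i |: T')].
pose u' := u *m supp_mx k (fun C => i \notin rk @: C).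
have u'p : typed_supp p u'.
  move=> C; rewrite entry_supp /p; case: (i \notin _); last by rewrite mul0r eqxx.
  by rewrite mul1r andbT => /uP.
have u'A l : l \in A -> u' *m forget l = 0.
  by move=> Al; rewrite (forget_supp (fun T => i \notin T)) uA // mul0mx.
have [T|h [hq hA hi]] := @lift_types p q A i u' _ u'p u'A.
  case/andP=> /and4P[jT sAT sTU cT] iT; split; first exact: liftj.
  by apply/existsP; exists T; rewrite /p jT sAT sTU cT iT eqxx.
have hc := typed_supp_chainly hq.
have hAd l : l \in A -> h *m dl l = 0 by move=> Al; apply/eqP; rewrite signed_forget_eq0 hA.
(* All chains of [h] contain rank [i], so only its image under [dl i], which is [u'], lacks that
   rank. Hence all chains of [u1] contain it. *)
pose u1 := u - \sum_(l | l != j) h *m dl l.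
have u1E : u1 = u - u' - \sum_(l | (l != j) && (l != i)) h *m dl l.
  by rewrite /u1 (bigD1 i) //= hi opprD addrA.
have u1p : typed_supp (fun T => [&& j \in T, i |: A \subset T, T \subset U & #|T| == m]) u1.
  move=> C; have [iC uC|iC uC] := boolP ((i \in rk @: C) && (entry u C != 0)).
    case/andP: iC => iC /uP/andP[-> /and4P[jC sAC sCU cC]].
    by rewrite jC sCU cC subUset sub1set iC sAC.
  have uu'0 : entry (u - u') C = 0.
    rewrite entryB entry_supp; move: iC; rewrite negb_and negbK.
    case: (i \in rk @: C) => /= [/eqP->|_]; first by rewrite mul0r subrr.
    by rewrite mul1r subrr.
  move: uC; rewrite u1E entryB uu'0 sub0r oppr_eq0 entry_sum => sum_neq0.
  have [l /andP[lj li] hl] : exists2 l, (l != j) && (l != i) & entry (h *m dl l) C != 0.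
    apply/exists_inP; apply: contraNT sum_neq0 => /exists_inPn hN.
    by rewrite big1 // => l /hN/negPn/eqP.
  have Al : l \notin A by apply: contraNN hl => /hAd->; rewrite entry0.
  have [z [Cz rz lC /existsP[T /andP[/andP[/and4P[jT sAT sTU /eqP cT] iT]]]]] :=
    forget_not_in hq hl.
  move/eqP=> eT iz; rewrite (interval_chainU1 iz) /=.
  have inT l' : l' != l -> (l' \in rk @: C) = (l' \in i |: T).
    by move=> ll'; rewrite -eT in_setU1 (negbTE ll').
  apply/and4P; split.
  - by rewrite inT 1?eq_sym // inE jT orbT.
  - rewrite subUset sub1set inT 1?eq_sym // setU11; apply/subsetP => l' Al'.
    rewrite inT; first by rewrite inE (subsetP sAT) ?orbT.
    by apply: contraNneq Al => <-.
  - apply/subsetP => l' Cl'; have : l' \in i |: T by rewrite -eT inE Cl' orbT.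
    by case/setU1P=> [->//|/(subsetP sTU)].
  by have := congr1 (fun X : {set 'I_n.+2} => #|X|) eT; rewrite !cardsU1 lC iT cT => /eqP; rewrite eqn_add2l.
have u1A l : l \in i |: A -> u1 *m forget l = 0.
  move=> il; apply/eqP; rewrite -signed_forget_eq0.
  have ud1 : \sum_(l | l != j) u1 *m dl l = 0.
    rewrite /u1; under eq_bigr do rewrite mulmxBl.
    by rewrite sumrB ud sum_signed_sq // subr0.
  case/setU1P: il => [->|Al]; last first.
    rewrite /u1 mulmxBl mulmx_suml big1 => [|l' _].
      by rewrite subr0 signed_forget_eq0 uA.
    have [->|neq] := eqVneq l' l; first by rewrite hAd // mul0mx.
    by rewrite signed_forgetC // hAd // mul0mx oppr0.
  (* A chain without rank [i] arises from [u1] only by forgetting [i], so the vanishing of the whole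
     sum forces that of this single term. *)
  apply/eqP/entry_inj => D; rewrite entry0; apply/eqP/negPn/negP => u1i.
  have [z [_ _ iD _ _]] := forget_not_in u1p u1i.
  move/(congr1 (fun w => entry w D)): ud1; rewrite entry_sum entry0 (bigD1 i) //=.
  rewrite big1 ?addr0 => [/eqP|l' /andP[_ li]]; first by rewrite (negbTE u1i).
  apply/eqP/negPn/negP => /(forget_not_in u1p)[z' [_ _ _]].
  case/and4P=> _ /subsetP/(_ _ (setU11 _ _)).
  by rewrite in_setU1 (negbTE iD) orbF eq_sym (negbTE li).
have [||||g gp gE] := IHr (i |: A) _ m u1 _ _ Uj u1p lt_mU u1A.
- rewrite setUC -setDDl; have := cardsD1 i (U :\: A).
  by rewrite [i \in _]inE Ai Ui; move: ltr; lia.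
- by rewrite subUset sub1set Ui.
- by rewrite !inE negb_or eq_sym ij.
- rewrite /u1; under eq_bigr do rewrite mulmxBl.
  by rewrite sumrB ud sum_signed_sq // subr0.
exists (g + h) => [C|].
  rewrite entryD; have [->|/gp//] := eqVneq (entry g C) 0.
  rewrite add0r => /hq/andP[-> /existsP[T /andP[/andP[/and4P[jT _ sTU /eqP cT] iT] /eqP->]]].
  by rewrite inE jT orbT subUset sub1set Ui sTU cardsU1 iT cT /=.
under eq_bigr do rewrite mulmxDl.
by rewrite big_split /= -gE /u1 subrK.
Qed.

End IntervalLifting.

Section TopLifting.
Variables (k : fieldType) (n : nat) (d : Order.disp_t) (Q : finTBPOrderType d).
Hypothesis rankedQ : ranked n Q.
Implicit Types (C D : {set Q}) (T A U : {set 'I_n.+2}) (i j l : 'I_n.+2).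
Implicit Types (u v w g : 'rV[k]_#|{set Q}|).
Local Notation rk := (@rk n d Q).
Local Notation forget l := (forget_mx k Q l).
Local Notation dl l := (signed_forget k Q l).

(** Bounds the dimension of the open interval from below, which shows that the cycles to be filled
    lie below the top degree. *)
Lemma saturated_chain (x y : Q) : (x < y)%O ->
  exists2 C, interval_chain x y C & [set l : 'I_n.+2 | (rk x < l < rk y)%N] \subset rk @: C.
Proof.
have [m] := ubnP (rank y - rank x); elim: m x => // m IHm x lt_m lt_xy.
have [le_yx|lt_xy1] := leqP (rank y) (rank x).+1.
  exists set0.
    by apply/andP; split; [apply/chainP => ? ?; rewrite inE|rewrite sub0set].
  by apply/subsetP=> l; rewrite inE !(rkE rankedQ); lia.
have [|z /andP[lt_xz lt_zy] rz] := rankedQ.2 x y (rank x).+1 lt_xy; first by rewrite ltnSn.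
have [|C /andP[cC sC] fullC] := IHm z _ lt_zy; first lia.
have ltz (w : Q) : w \in C -> (z < w < y)%O by move/(subsetP sC); rewrite inE.
exists (z |: C).
  apply/andP; split.
    by apply: chainU1 => // w /ltz/andP[/ltW/le_comparable].
  apply/subsetP=> w /setU1P[->|/ltz/andP[lt_zw lt_wy]]; rewrite inE ?lt_xz //.
  by rewrite (lt_trans lt_xz).
apply/subsetP=> l; rewrite inE !(rkE rankedQ) => /andP[lt_xl lt_ly].
rewrite imsetU1 in_setU1; have [->|neq] := eqVneq l (rk z); rewrite ?eqxx //=.
apply: (subsetP fullC); rewrite inE !(rkE rankedQ) lt_ly andbT rz.
rewrite ltn_neqAle lt_xl andbT; apply: contraNneq neq => eq_l; apply/eqP/val_inj.
by rewrite /= (rkE rankedQ) rz.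
Qed.

(* A vector v in Z(A, A) is a cycle, hence v bounds some u by the vanishing of *)
(* homology below the top. The ranks other than those of A and i are removed   *)
(* from u one by one: the part of u containing rank j is a relative cycle, so  *)
(* it is a relative boundary by cube_exact, and subtracting the full boundary  *)
(* of the bounding vector removes it.                                          *)
Lemma top_liftable (x y : Q) A i :
    homology_only_on_top (open_interval x y) k -> (x < y)%O ->
    (rk x < i < rk y)%N -> i \notin A ->
    (forall T A i j, A \subset T -> i \notin T -> j \in T -> j \notin A ->
       (rk x < i < rk y)%N -> (rk x < j < rk y)%N -> liftable k x y T A i) ->
  liftable k x y A A i.
Proof.
move=> topxy lt_xy xiy iA lift_lt; pose full := [set l : 'I_n.+2 | (rk x < l < rk y)%N].
apply/rV_subP => v0 /cycle_mxP[v0A v0kill].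
have [->|v0n0] := eqVneq v0 0; first exact: sub0mx.
pose v := v0 *m sign_mx k Q i.
have vA C : entry v C != 0 -> typed_chain x y A C.
  by rewrite entry_sign mulf_eq0 negb_or => /andP[_ /v0A].
have vkill l : l \in A -> v *m dl l = 0.
  move=> Al; apply/eqP; rewrite signed_forget_eq0; apply/eqP.
  by rewrite sign_forget v0kill // mul0mx scaler0.
have sAfull : A \subset full.
  have [C vC] : exists C, entry v0 C != 0.
    apply/existsP; apply: contraNT v0n0 => /existsPn v00.
    by apply/eqP/entry_inj => C; rewrite entry0; apply/eqP/negPn/v00.
  have /and3P[_ /subsetP sC /eqP <-] := v0A _ vC.
  apply/subsetP=> _ /imsetP[z /sC zP ->]; move: zP; rewrite !inE => /andP[xz zy].
  by rewrite !(rk_lt rankedQ).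
have ifull : i \in full by rewrite inE.
have vtyped : typed_supp x y (fun T => T == A) v.
  by move=> C /vA/and3P[cC sC eC]; rewrite /interval_chain cC sC.
have vchainly := typed_supp_chainly vtyped.
(* For [l] outside A there is nothing to forget, as all chains of [v] have rank set A. *)
have vdl l : v *m dl l = 0.
  have [/vkill//|Al] := boolP (l \in A).
  apply: entry_inj => D; rewrite entry0; apply/eqP/negPn/negP.
  case/(forget_not_in rankedQ vtyped)=> z [_ _ _ /eqP eA _].
  by rewrite -eA setU11 in Al.
have [C0 /andP[cC0 sC0] fullC0] := saturated_chain lt_xy.
have [u0 u0v u0P] : exists2 u, u *m boundary_mx Q k = v & forall E, entry u E != 0 ->
    [&& chain E, E \subset [set z | (x < z < y)%O] & #|E| == #|A|.+1].
  apply: (@homology_top_lift k _ _ (open_interval x y) Q val (fun z => x < z < y)%O _ _ #|A| v C0) => //.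
  - by move=> z; split=> [zP|[z' <-]]; [exists (exist _ z zP)|exact: (valP z')].
  - rewrite -(chain_card_rk rankedQ cC0); apply: leq_trans (subset_leq_card fullC0).
    by rewrite -/full (cardsD1 i full) ifull ltnS subset_leq_card // subsetD1 sAfull.
  - move=> E /vA/and3P[cE sE /eqP rE]; rewrite cE sE /=.
    by rewrite -(chain_card_rk rankedQ cE) rE.
  by rewrite (boundary_signed rankedQ) // big1.
have main r U : #|full :\: U| = r -> i |: A \subset U -> U \subset full ->
    exists2 u, typed_supp x y (fun T => (T \subset U) && (#|T| == #|A|.+1)) u &
      \sum_(l : 'I_n.+2) u *m dl l = v.
  elim: r U => [|r IHr] U.
    move/eqP; rewrite cards_eq0 setD_eq0 => sfU sAU sUf.
    have u0t : typed_supp x y (fun T => (T \subset U) && (#|T| == #|A|.+1)) u0.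
      move=> E /u0P/and3P[cE sE card_E]; rewrite /interval_chain cE sE /=.
      rewrite (chain_card_rk rankedQ cE) card_E andbT; apply: subset_trans sfU.
      apply/subsetP=> _ /imsetP[z /(subsetP sE) zP ->]; move: zP; rewrite !inE.
      by case/andP=> xz zy; rewrite !(rk_lt rankedQ).
    exists u0 => //.
    exact: etrans (esym (boundary_signed rankedQ (typed_supp_chainly u0t))) u0v.
  move=> cardU sAU sUf.
  have /set0Pn[j /setDP[jf jU]] : full :\: U != set0 by rewrite -card_gt0 cardU.
  have jnA : j \notin i |: A by apply: contra jU; exact: (subsetP sAU).
  have [|||u ut uv] := IHr (j |: U).
  - rewrite setUC -setDDl; apply/eqP; rewrite -eqSS -cardU.
    by rewrite [X in _ == X](cardsD1 j) [j \in _]inE jU jf.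
  - exact: subset_trans (subsetU1 _ _).
  - by rewrite subUset sub1set jf.
  pose uE := u *m supp_mx k (fun C => j \in rk @: C).
  have uEt : typed_supp x y (fun T => [&& j \in T, set0 \subset T, T \subset j |: U & #|T| == #|A|.+1]) uE.
    move=> C; rewrite entry_supp sub0set; case: (j \in _); last by rewrite mul0r eqxx.
    by rewrite mul1r => /ut.
  (* On chains containing rank [j] the boundary of [u] agrees with the relative boundary of [uE],
     and [v] has no such chains because [j] is not in A. *)
  have uE0 : \sum_(l | l != j) uE *m dl l = 0.
    apply: entry_inj => D; rewrite entry0 entry_sum.
    have [jD|jD] := boolP (j \in rk @: D); last first.
      rewrite big1 // => l lj; apply/eqP/negPn/negP.
      case/(forget_not_in rankedQ uEt)=> z [_ _ _ /andP[jl _] _].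
      by move: jl; rewrite in_setU1 (negbTE jD) orbF eq_sym (negbTE lj).
    transitivity (entry v D); last first.
      apply/eqP/negPn/negP => /vA/and3P[_ _ /eqP eA].
      by rewrite eA in jD; case/negP: jnA; rewrite in_setU1 jD orbT.
    rewrite -uv entry_sum [RHS](bigD1 j) //= [X in X + _](_ : _ = 0) ?add0r.
      apply: eq_bigr => l lj; rewrite /uE /signed_forget mulmxA [in RHS]mulmxA.
      rewrite (forget_supp (fun T => j \in T)) !entry_sign entry_supp.
      by rewrite in_setU1 jD orbT mul1r.
    apply/eqP/negPn/negP=> /(forget_not_in rankedQ ut)[z [_ _ jN _ _]].
    by rewrite jD in jN.
  have [||||||||w wt uEw] := @cube_exact k n d Q rankedQ x y j (j |: U) _ set0 #|A|.+1 uE.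
  - move=> T A' i' sAT iT jT jA iU.
    have inf l : l \in j |: U -> (rk x < l < rk y)%N.
      case/setU1P=> [->|/(subsetP sUf)]; last by rewrite inE.
      by move: jf; rewrite inE.
    by apply: (lift_lt T A' i' j) => //; apply: inf; rewrite ?setU11.
  - exact: sub0set.
  - by rewrite inE.
  - exact: setU11.
  - exact: uEt.
  - rewrite cardsU1 jU add1n ltnS; apply: leq_trans (subset_leq_card sAU).
    by rewrite cardsU1 iA.
  - by move=> l; rewrite inE.
  - exact: uE0.
  exists (u - \sum_(l : 'I_n.+2) w *m dl l); last first.
    under eq_bigr do rewrite mulmxBl.
    rewrite sumrB uv (sum_signed_sq rankedQ) ?subr0 //; exact: (typed_supp_chainly wt).
  have uUt C : j \notin rk @: C -> entry u C != 0 ->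
      interval_chain x y C && ((rk @: C \subset U) && (#|rk @: C| == #|A|.+1)).
    move=> jC /ut/andP[-> /andP[sC ->]]; rewrite andbT; apply/subsetP => l lC.
    by case/setU1P: (subsetP sC l lC) => // lj; rewrite -lj lC in jC.
  move=> C; rewrite (bigD1 j) //= -uEw opprD addrA addrAC entryB => neq0.
  have [jC|jC] := boolP (j \in rk @: C).
    have : entry (w *m dl j) C != 0.
      apply: contraNneq neq0 => wj0.
      by rewrite wj0 subr0 entryB entry_supp jC mul1r subrr.
    by case/(forget_not_in rankedQ wt) => z [_ _]; rewrite jC.
  have [uC|uC] := eqVneq (entry u C) 0; last exact: uUt.
  have : entry (w *m dl j) C != 0.
    by apply: contraNneq neq0 => wj0; rewrite wj0 subr0 entryB entry_supp uC mulr0 subrr.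
  case/(forget_not_in rankedQ wt) => z [_ _ _ /and3P[_ sC cC] iz].
  rewrite (interval_chainU1 iz) /=; move: cC; rewrite cardsU1 jC eqSS => ->.
  rewrite andbT; apply/subsetP => l lC; have := subsetP sC l (setU1r _ lC).
  by case/setU1P=> // lj; rewrite -lj lC in jC.
(* For U = i + A the cardinality forces the rank set i + A. Forgetting a rank of A leaves chains
   with rank [i], which [v] does not have, so the boundary comes from forgetting [i] alone. *)
have [|u ut uv] := main _ (i |: A) erefl (subxx _); first by rewrite subUset sub1set ifull.
have utype C : entry u C != 0 -> typed_chain x y (i |: A) C.
  case/ut/andP=> /andP[cC sC] /andP[sCA cardC].
  by rewrite /typed_chain cC sC eqEcard sCA (eqP cardC) cardsU1 iA add1n leqnn.
have udl l : l != i -> u *m dl l = 0.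
  move=> li; apply: entry_inj => D; rewrite entry0; apply/eqP/negPn/negP => ul.
  have utt : typed_supp x y (fun T => T == i |: A) u.
    by move=> C /utype/and3P[cC sC eC]; rewrite /interval_chain cC sC.
  have [z [_ _ lD /eqP lDA _]] := forget_not_in rankedQ utt ul.
  have : entry v D != 0.
    rewrite -uv entry_sum (bigD1 l) //= big1 ?addr0 // => l' l'l.
    apply/eqP/negPn/negP => /(forget_not_in rankedQ utt)[z' [_ _ l'D /eqP l'DA _]].
    have : l \in l' |: rk @: D by rewrite l'DA -lDA setU11.
    by rewrite in_setU1 (negbTE lD) orbF eq_sym (negbTE l'l).
  case/vA/and3P=> _ _ /eqP eA; have : i \in l |: rk @: D by rewrite lDA setU11.
  by rewrite in_setU1 eq_sym (negbTE li) eA (negbTE iA).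
have -> : v0 = u *m forget i.
  move: uv; rewrite (bigD1 i) //= big1 ?addr0 => [|l li]; last by rewrite udl.
  by rewrite /signed_forget mulmxA => /(congr1 (mulmx^~ (sign_mx k Q i))); rewrite /v !sign_mxK.
apply: submxMr; apply/cycle_mxP; split=> // l Al; apply/eqP.
by rewrite -signed_forget_eq0 udl //; apply: contraNneq iA => <-.
Qed.

End TopLifting.

Lemma linear_section (k : fieldType) N N' (U : 'M[k]_N') (W : 'M_N) (f : 'M_(N, N')) :
  (U <= W *m f)%MS ->
  exists s : 'M_(N', N), forall u : 'rV_N', (u <= U)%MS ->
    (u *m s <= W)%MS /\ u *m s *m f = u.
Proof.
move=> sUWf; exists (pinvmx (W *m f) *m W) => u /submx_trans/(_ sUWf) uWf.
by rewrite mulmxA submxMl -mulmxA mulmxKpV.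
Qed.

(* If some rank j in T is not in A, chains split at their element z of rank j, *)
(* and a linear section of the lifting for the side of z containing i is       *)
(* applied with the other side kept fixed. Linearity is what preserves the     *)
(* conditions for the ranks in A on the other side.                            *)
Section SplitLifting.
Variables (k : fieldType) (n : nat) (d : Order.disp_t) (Q : finTBPOrderType d).
Hypothesis rankedQ : ranked n Q.
Implicit Types (C D E : {set Q}) (T A U : {set 'I_n.+2}) (l : 'I_n.+2) (a z : Q).
Implicit Types (u w g : 'rV[k]_#|{set Q}|).
Local Notation rk := (@rk n d Q).
Local Notation forget l := (forget_mx k Q l).
Variables (x y : Q) (T A : {set 'I_n.+2}) (i j : 'I_n.+2).
Hypotheses (sAT : A \subset T) (iT : i \notin T) (jT : j \in T) (jA : j \notin A).
Hypothesis xiy : (rk x < i < rk y)%N.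
Hypothesis lift_near : forall z, (x < z < y)%O -> rk z = j ->
  lifting k n x z /\ lifting k n z y.

(** The side of rank [j] on which [i] lies; [lo z] and [hi z] bound the corresponding half of the
    interval cut at [z]. *)
Let near l := if (i < j)%N then (l < j)%N else (j < l)%N.
Let lo z := if (i < j)%N then x else z.
Let hi z := if (i < j)%N then z else y.

Let nearI z a : (x < z < y)%O -> rk z = j -> (z >=< a)%O -> (x < a < y)%O ->
  near (rk a) -> (lo z < a < hi z)%O.
Proof.
rewrite /near /lo /hi => /andP[xz zy] rz za /andP[xa ay]; rewrite -rz !(rkE rankedQ).
case: ifP => _ lt_r; rewrite ?xa ?ay ?andbT /=.
  by rewrite comparable_rank_lt // comparable_sym.
exact: comparable_rank_lt.
Qed.

Let nearE z a : rk z = j -> (lo z < a < hi z)%O -> near (rk a).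
Proof.
by rewrite /near /lo /hi => <-; case: ifP => _ /andP[]; [move=> _|move=> + _]; exact: rk_lt.
Qed.

Let nearxy z a : (x < z < y)%O -> (lo z < a < hi z)%O -> (x < a < y)%O.
Proof.
rewrite /lo /hi => /andP[xz zy]; case: ifP => _ /andP[l1 l2].
  by rewrite l1 (lt_trans l2).
by rewrite l2 (lt_trans xz).
Qed.

Let nearj : near j = false. Proof. by rewrite /near !ltnn if_same. Qed.

Let neq_ij : i != j. Proof. by apply: contraNneq iT => ->. Qed.

Let neari : near i.
Proof.
rewrite /near; case: ltnP => // le_ji; rewrite ltn_neqAle le_ji andbT eq_sym; exact: neq_ij.
Qed.

Let T1 := [set l in T | near l].
Let A1 := [set l in A | near l].

(** The conditions on [z] stand after the existential so that a matrix can be chosen for every [z]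
    at once, with 0 as default. *)
Let section_mx z : exists s : 'M[k]_#|{set Q}|, (x < z < y)%O -> rk z = j ->
  forall u, (u <= cycle_mx k (lo z) (hi z) T1 A1)%MS ->
    (u *m s <= cycle_mx k (lo z) (hi z) (i |: T1) A1)%MS /\ u *m s *m forget i = u.
Proof.
have [/andP[zP /eqP rz]|] := boolP ((x < z < y)%O && (rk z == j)); last first.
  by move=> zN; exists 0 => zP rz; rewrite zP rz eqxx in zN.
suff /linear_section[s sP] : (cycle_mx k (lo z) (hi z) T1 A1 <=
    cycle_mx k (lo z) (hi z) (i |: T1) A1 *m forget i)%MS by exists s.
have [lift1 lift2] := lift_near zP rz.
have sA1T1 : A1 \subset T1.
  by apply/subsetP=> l; rewrite !inE => /andP[/(subsetP sAT)-> ->].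
have iT1 : i \notin T1 by rewrite inE (negbTE iT).
case/andP: xiy => xi iy; move: neari; rewrite /near /lo /hi.
by case: ifP => _ nj; [apply: lift1|apply: lift2]; rewrite // rz ?xi ?iy ?nj.
Qed.

Let far C := [set a in C | ~~ near (rk a)].
Let close C := [set a in C | near (rk a)].

Let closefar C : close C :|: far C = C.
Proof. by apply/setP=> a; rewrite !inE -andb_orr orbN andbT. Qed.

Variable v : 'rV[k]_#|{set Q}|.
Hypothesis v_cycle : (v <= cycle_mx k x y T A)%MS.

Let vT C : entry v C != 0 -> typed_chain x y T C.
Proof. by case/cycle_mxP: v_cycle => vT _; exact: vT. Qed.

Let vA l : l \in A -> v *m forget l = 0.
Proof. by case/cycle_mxP: v_cycle => _; exact. Qed.

(** The slice of [v] along a fixed part [E] on the other side of [z]. *)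
Let restrict z E := vec (fun C =>
  if C \subset [set a | (lo z < a < hi z)%O] then entry v (C :|: E) else 0).

(** Forgetting a rank on the near side does not touch [E], so the conditions on [v] at these ranks
    hold slice by slice. *)
Let restrict_cycle z E : (x < z < y)%O -> rk z = j -> z \in E ->
    (forall a, a \in E -> ~~ near (rk a)) ->
  (restrict z E <= cycle_mx k (lo z) (hi z) T1 A1)%MS.
Proof.
move=> zP rz Ez Efar; apply/cycle_mxP; split=> [C|l].
  rewrite vecE; case: ifP => [sC /vT/and3P[cCE sCE /eqP rCE]|]; last by rewrite eqxx.
  rewrite /typed_chain (chainS _ cCE) ?subsetUl // sC /=.
  have Cnear a : a \in C -> near (rk a).
    by move/(subsetP sC); rewrite inE; exact: nearE.
  rewrite eqEsubset; apply/andP; split; apply/subsetP=> l.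
    by case/imsetP=> a Ca ->; rewrite inE Cnear // andbT -rCE imset_f // inE Ca.
  rewrite inE -rCE => /andP[/imsetP[a + ->]]; rewrite inE => /orP[Ca _|Ea].
    exact: imset_f.
  by rewrite (negbTE (Efar a Ea)).
rewrite inE => /andP[Al nl]; apply: entry_inj => D; rewrite entry0 entry_forget.
have [sD|sD] := boolP (D \subset [set a | (lo z < a < hi z)%O]); last first.
  rewrite big1 // => a _; rewrite vecE ifN //; apply: contra sD.
  exact: subset_trans (subsetU1 _ _).
have := congr1 (fun w => entry w (D :|: E)) (vA Al).
rewrite entry0 entry_forget => /(etrans _); apply; apply: eq_big => [a|a /andP[Da /eqP ra]].
  rewrite in_setU negb_or -andbA; congr (_ && _).
  case: eqP => [ra|_]; last by rewrite andbF.
  by rewrite andbT (contraTN (Efar a)) // ra.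
rewrite vecE setUA subUset sub1set sD andbT inE.
case: ifP => // aN; apply/esym/eqP; apply: contraFT aN => /vT/and3P[cC sC _].
apply: (nearI zP rz).
- by apply: (chainP _ cC); rewrite !inE ?Ez ?eqxx ?orbT.
- by have := subsetP sC a; rewrite !inE eqxx; exact.
by rewrite ra.
Qed.

Lemma split_vector : (v <= cycle_mx k x y (i |: T) A *m forget i)%MS.
Proof.
have /fin_all_exists[s sP] := section_mx.
pose term C z := entry (restrict z (far C) *m s z) (close C).
(* A chain has at most one element of rank [j]; summing over [z] avoids choosing it. *)
pose g := vec (fun C => \sum_(z in C | (x < z < y)%O && (rk z == j)) term C z).
have farN C a : a \in far C -> ~~ near (rk a) by rewrite inE => /andP[].
have farz C z : z \in C -> rk z = j -> z \in far C by move=> Cz rz; rewrite inE Cz rz nearj.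
have g_supp C : entry g C != 0 -> typed_chain x y (i |: T) C.
  rewrite vecE => neq0.
  have [z /and3P[Cz zP /eqP rz] tz] :
      exists2 z, [&& z \in C, (x < z < y)%O & rk z == j] & term C z != 0.
    apply/exists_inP; apply: contraNT neq0 => /exists_inPn zN.
    by rewrite big1 // => z /zN/negPn/eqP.
  have rz_cycle := restrict_cycle zP rz (farz C z Cz rz) (@farN C).
  have [/cycle_mxP[/(_ _ tz)/and3P[cc sc /eqP rc] _] _] := sP z zP rz _ rz_cycle.
  have [c rcN0] : exists c, entry (restrict z (far C)) c != 0.
    apply/existsP; apply: contraNT tz => /existsPn r0.
    rewrite /term (_ : restrict z (far C) = 0) ?mul0mx ?entry0 //.
    by apply: entry_inj => c; rewrite entry0; apply/eqP/negPn/r0.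
  move: rcN0; rewrite vecE; case: ifP => [sc'|]; last by rewrite eqxx.
  case/vT/and3P=> cE sE /eqP rE.
  rewrite -(closefar C) /typed_chain; apply/and3P; split.
  - apply/chainP => a b; rewrite !in_setU.
    have cross a' b' : a' \in close C -> b' \in far C -> (a' >=< b')%O.
      move=> /(subsetP sc); rewrite inE => aP bF.
      have zb : (z >=< b')%O by apply: (chainP _ cE); rewrite in_setU ?bF ?farz ?orbT.
      have := farN _ _ bF; move: aP; rewrite /near /lo /hi -rz.
      case: ifP => _ /andP[lt1 lt2]; rewrite -leqNgt => le_rk.
        apply/le_comparable/(le_trans (ltW lt2)).
        move: zb; by case: (comparableP z b') => // /(rk_lt rankedQ); rewrite ltnNge le_rk.
      rewrite comparable_sym; apply/le_comparable/(le_trans _ (ltW lt1)).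
      move: zb; by case: (comparableP z b') => // /(rk_lt rankedQ); rewrite ltnNge le_rk.
    case/orP=> [ac|af] /orP[bc|bf].
    - exact: (chainP _ cc).
    - exact: cross.
    - by rewrite comparable_sym; exact: cross.
    by apply: (chainP _ cE); rewrite in_setU ?af ?bf orbT.
  - rewrite subUset (subset_trans (subsetUr _ _) sE) andbT.
    apply/subsetP=> a /(subsetP sc); rewrite !inE; exact: nearxy.
  rewrite imsetU rc; apply/eqP/setP => l; rewrite in_setU !in_setU1 -orbA; congr (_ || _).
  have -> : (l \in rk @: far C) = (l \in T) && ~~ near l.
    apply/imsetP/andP => [[a af ->]|[]].
      by rewrite (farN _ _ af) -rE imset_f // in_setU af orbT.
    rewrite -rE => /imsetP[a]; rewrite in_setU => /orP[ac ->|af -> _]; last by exists a.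
    by rewrite (nearE rz) //; move/(subsetP sc'): ac; rewrite inE.
  by rewrite !inE -andb_orr orbN andbT.
have forget_g l D : l != j -> entry (g *m forget l) D =
    \sum_(z in D | (x < z < y)%O && (rk z == j)) \sum_(a | (a \notin D) && (rk a == l)) term (a |: D) z.
  move=> lj; rewrite entry_forget; under eq_bigr do rewrite vecE.
  rewrite (exchange_big_dep (fun z => (z \in D) && ((x < z < y)%O && (rk z == j)))) /=.
    apply: eq_bigr => z /and3P[Dz zP rz]; apply: eq_bigl => a.
    by rewrite zP rz setU1r ?andbT.
  move=> a z /andP[Da /eqP ra] /and3P[]; rewrite in_setU1 => /orP[/eqP->|->]; last by move=> -> ->.
  by rewrite ra (negbTE lj).
have term_close l D z a : near l -> a \notin D -> rk a = l ->
    term (a |: D) z = entry (restrict z (far D) *m s z) (a |: close D).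
  move=> nl Da ra; rewrite /term; congr (entry (restrict z _ *m _) _); apply/setP=> b.
    by rewrite !inE; case: eqP => [->|//]; rewrite ra nl (negbTE Da).
  by rewrite !inE; case: eqP => [->|//]; rewrite ra nl.
have sum_close l D z : near l -> \sum_(a | (a \notin D) && (rk a == l)) term (a |: D) z =
    entry (restrict z (far D) *m s z *m forget l) (close D).
  move=> nl; rewrite entry_forget; apply: eq_big => [a|a /andP[Da /eqP ra]].
    rewrite inE; case: (rk a =P l) => [->|]; last by rewrite !andbF.
    by rewrite nl !andbT.
  exact: (term_close l).
have gi : g *m forget i = v.
  apply: entry_inj => D; rewrite forget_g; last exact: neq_ij.
  have summand z : z \in D -> (x < z < y)%O -> rk z = j ->
      \sum_(a | (a \notin D) && (rk a == i)) term (a |: D) z =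
      if close D \subset [set a | (lo z < a < hi z)%O] then entry v D else 0.
    move=> Dz zP rz; rewrite sum_close ?neari //.
    have [_ ->] := sP z zP rz _ (restrict_cycle zP rz (farz D z Dz rz) (@farN D)).
    by rewrite vecE closefar.
  have [vD0|vD] := eqVneq (entry v D) 0.
    by rewrite big1 // => z /and3P[Dz zP /eqP rz]; rewrite summand // vD0 if_same.
  have /and3P[cD sD /eqP rD] := vT vD.
  have /imsetP[z Dz /esym rz] : j \in rk @: D by rewrite rD.
  have inD a : a \in D -> (x < a < y)%O by move/(subsetP sD); rewrite inE.
  rewrite (big_pred1 z) => [|z' /=].
    rewrite summand ?inD // ifT //; apply/subsetP=> a; rewrite !inE => /andP[Da na].
    by apply: nearI; rewrite ?inD //; apply: (chainP _ cD).
  apply/and3P/eqP => [[Dz' _ /eqP rz']|->]; last by rewrite Dz inD ?rz.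
  by apply: (chain_rk_inj rankedQ cD); rewrite ?rz.
rewrite -gi; apply: submxMr; apply/cycle_mxP; split=> // l Al.
have lj : l != j by apply: contraNneq jA => <-.
apply: entry_inj => D; rewrite forget_g // entry0 big1 // => z /and3P[Dz zP /eqP rz].
have [nl|nl] := boolP (near l).
  rewrite sum_close //.
  have [/cycle_mxP[_ kill] _] := sP z zP rz _ (restrict_cycle zP rz (farz D z Dz rz) (@farN D)).
  by rewrite kill ?entry0 // inE Al.
(* For [l] on the far side the same section [s z] applies to all terms, so the sum over [a] moves
   inside it, where it vanishes by the condition on [v] at [l]. *)
transitivity (entry ((\sum_(a | (a \notin D) && (rk a == l)) restrict z (a |: far D)) *m s z) (close D)).
  rewrite mulmx_suml entry_sum; apply: eq_bigr => a /andP[Da /eqP ra].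
  rewrite /term; congr (entry (restrict z _ *m _) _); apply/setP=> b.
    by rewrite !inE; case: eqP => [->|//]; rewrite ra nl.
  by rewrite !inE; case: eqP => [->|//]; rewrite ra (negbTE nl) !andbF.
rewrite [X in X *m _](_ : _ = 0) ?mul0mx ?entry0 //.
apply: entry_inj => c; rewrite entry_sum entry0.
have [sc|sc] := boolP (c \subset [set a | (lo z < a < hi z)%O]); last first.
  by rewrite big1 // => a _; rewrite vecE (negbTE sc).
have := congr1 (fun w => entry w (c :|: far D)) (vA Al).
rewrite entry0 entry_forget => /(etrans _); apply; apply: eq_big => [a|a _]; last first.
  by rewrite vecE sc setUCA.
rewrite in_setU inE negb_or; case: (rk a =P l) => [ra|]; last by rewrite !andbF.
rewrite ra nl !andbT (_ : a \notin c) //.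
by apply: contra nl => /(subsetP sc); rewrite inE -ra; exact: nearE.
Qed.

End SplitLifting.

Section CohenMacaulay.
Variables (k : fieldType) (n : nat) (d : Order.disp_t) (Q : finTBPOrderType d).
Hypothesis rankedQ : ranked n Q.
Hypothesis cmQ : cohen_macaulay k Q.

(** Splitting at a rank in T but not in A leads to shorter intervals. Only the case A = T uses
    homology, and there the split case of the same interval is already available. *)
Lemma cohen_macaulay_lifting (x y : Q) : (x < y)%O -> lifting k n x y.
Proof.
have [m] := ubnP (rank y - rank x); elim: m x y => // m IHm x y lt_m lt_xy.
have split (T A : {set 'I_n.+2}) (i j : 'I_n.+2) :
    A \subset T -> i \notin T -> j \in T -> j \notin A ->
    (rk n x < i < rk n y)%N -> liftable k x y T A i.
  move=> sAT iT jT jA xiy; apply/rV_subP => v vc.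
  apply: (split_vector rankedQ sAT iT jT jA xiy _ vc) => z /andP[xz zy] _.
  have := rank_lt xz; have := rank_lt zy.
  by split; apply: IHm => //; lia.
move=> T A i sAT iT xiy.
have [sTA|/subsetPn[j jT jA]] := boolP (T \subset A); last exact: (split T A i j).
have <- : A = T by apply/eqP; rewrite eqEsubset sAT.
apply: top_liftable => //.
- exact: cmQ.
- by apply: contra iT; exact: (subsetP sAT).
by move=> T' A' i' j ? ? ? ? ? _; exact: (split T' A' i' j).
Qed.

End CohenMacaulay.

(** * Words *)

(* A word records a path in the tree: letter p is None if the path stays at    *)
(* its node when the rank grows from p - 1 to p, and Some a if it moves to the *)
(* child a. Positions 0 and n + 1 are padding; the first e moves are forced to *)
(* be stays.                                                                   *)
Section Words.
Variables (t n e : nat).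
Local Notation wordT := {ffun 'I_n.+2 -> option 'I_t}.
Implicit Types (u w : wordT) (I T : {set 'I_n.+2}) (i : 'I_n.+2) (p : nat).

Definition letter w p : option 'I_t := w (inord p).

Definition word_ok w :=
  [forall i : 'I_n.+2, ((i <= e)%N || (i == n.+1 :> nat)) ==> (w i == None)].

Definition pref w p : seq 'I_t := pmap (letter w) (iota 0 p.+1).

Definition descents w : {set 'I_n.+2} :=
  [set i : 'I_n.+2 | [&& (i < n.+1)%N, letter w i != None & letter w i.+1 == None]].

(* Exchanges the letters at positions i and i + 1 for all descents i in I,     *)
(* dropping letters that would arrive at position n + 1. Only the prefixes     *)
(* ending at positions in I change.                                            *)
Definition swap I w : wordT :=
  [ffun i : 'I_n.+2 => if i \in I then None
   else if (0 < i < n.+1)%N && (inord i.-1 \in I) then letter w i.-1 else letter w i].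

(** Sum of the depths of the nodes at ranks 0 to n; delaying a move lowers it. *)
Definition weight w := (\sum_(p < n.+1) size (pref w p))%N.

Lemma word_okP w :
  reflect [/\ letter w 0 = None, letter w n.+1 = None &
            forall p, (p <= e)%N -> (p <= n.+1)%N -> letter w p = None] (word_ok w).
Proof.
apply: (iffP forallP) => [wok|[_ wn we] i]; last first.
  apply/implyP=> /orP[le_ie|/eqP ein].
    by have := we i le_ie (ltn_ord i); rewrite /letter inord_val => ->.
  have -> : i = inord n.+1 by apply: val_inj; rewrite /= inordK.
  by move: wn; rewrite /letter => ->.
have wp p : (p < n.+2)%N -> ((p <= e)%N || (p == n.+1)) -> letter w p = None.
  by move=> lt_p; have := wok (inord p); rewrite inordK // => /implyP h /h/eqP.
by split=> [||p le_pe le_pn]; apply: wp; rewrite ?leq0n ?eqxx ?orbT ?le_pe.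
Qed.

Lemma prefS w p : pref w p.+1 = pref w p ++ seq_of_opt (letter w p.+1).
Proof.
rewrite /pref -addn1 iotaD pmap_cat add0n /=.
by case: (letter w p.+1).
Qed.

Lemma pref0 w : letter w 0 = None -> pref w 0 = [::].
Proof. by rewrite /pref /= => ->. Qed.

Lemma prefix_pref w p q : (p <= q)%N -> prefix (pref w p) (pref w q).
Proof.
move/subnK<-; elim: (q - p)%N => [|m IHm]; first exact: prefix_refl.
by apply: prefix_trans IHm _; rewrite addSn prefS prefix_prefix.
Qed.

Lemma leq_size_pref w p q : (p <= q)%N -> (size (pref w p) <= size (pref w q))%N.
Proof. by move/(prefix_pref w)/prefixP=> [s ->]; rewrite size_cat leq_addr. Qed.

Lemma size_prefS w p : size (pref w p.+1) = (size (pref w p) + (letter w p.+1 != None))%N.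
Proof. by rewrite prefS size_cat; case: (letter w p.+1). Qed.

Lemma size_pref_le w p q : (p <= q)%N -> (size (pref w q) + p <= q + size (pref w p))%N.
Proof.
move/subnK<-; elim: (q - p)%N => [|m IHm]; first by rewrite addnC.
by rewrite addSn size_prefS; case: (letter _ _); lia.
Qed.

Lemma size_pref w p : word_ok w -> (e <= 1)%N -> (0 < p <= n.+1)%N ->
  (size (pref w p) + e <= p)%N.
Proof.
case/word_okP=> w0 _ we e1 /andP[p0 pn].
have size_e : size (pref w e) = 0%N.
  case: e e1 we => [|[|//]] _ we; first by rewrite pref0.
  by rewrite prefS pref0 // we.
by have := @size_pref_le w e p; rewrite size_e; lia.
Qed.

Lemma descents_proper w : word_ok w -> descents w \subset proper_ranks n.
Proof.
case/word_okP=> w0 _ _; apply/subsetP=> i; rewrite !inE => /and3P[-> wi _].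
rewrite andbT lt0n; apply: contra_neq wi => i0.
by rewrite i0.
Qed.

(** The exchange at a descent delays its move by one rank, so the node at that rank becomes the
    previous one. Two consecutive positions are never both descents, hence the exchanges do not
    interact. *)
Lemma pref_swap I w p : word_ok w -> I \subset descents w -> (p < n.+1)%N ->
  pref (swap I w) p = if inord p \in I then pref w p.-1 else pref w p.
Proof.
move=> wok /subsetP sI; have [w0 wn _] := word_okP _ wok.
have inI q : (q < n.+2)%N -> inord q \in I ->
    [/\ (q < n.+1)%N, letter w q != None & letter w q.+1 = None].
  by move=> lt_q /sI; rewrite inE inordK // => /and3P[-> -> /eqP->].
have zI : inord 0 \notin I by apply/negP => /(inI 0%N isT)[_]; rewrite w0.
elim: p => [|p IHp] lt_p.
  rewrite (negbTE zI) !pref0 //.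
  by rewrite /letter ffunE (negbTE zI) inordK.
rewrite prefS IHp; last exact: ltnW.
have lt_p2 : (p < n.+2)%N by lia.
have lt_p3 : (p.+1 < n.+2)%N by lia.
rewrite [letter (swap I w) _]ffunE inordK // ltn0Sn lt_p [p.+1.-1]/= andTb.
have [pI|pI] := boolP (inord p \in I).
  have [_ wp wp1] := inI p lt_p2 pI.
  have p1I : inord p.+1 \notin I.
    by apply/negP => /(inI p.+1 (ltnW lt_p))[_]; rewrite wp1.
  rewrite (negbTE p1I) [RHS]prefS wp1 cats0.
  case: p pI {IHp lt_p lt_p2 lt_p3 wp wp1 p1I} => [|p] pI; first by rewrite pI in zI.
  by rewrite -prefS.
by case: ifP => p1I; rewrite ?cats0 // -prefS.
Qed.

Lemma letter_prefE u w p : pref u p = pref w p -> pref u p.+1 = pref w p.+1 ->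
  letter u p.+1 = letter w p.+1.
Proof.
move=> eqp; rewrite !prefS eqp => /eqP; rewrite eqseq_cat // eqxx /=.
by case: (letter u _) (letter w _) => [a|] [b|] //= /eqP // [->].
Qed.

Lemma pref_inj u w : word_ok u -> word_ok w ->
  (forall p, (p < n.+1)%N -> pref u p = pref w p) -> u = w.
Proof.
move=> /word_okP[u0 un _] /word_okP[w0 wn _] uw.
apply/ffunP=> i; rewrite -[i]inord_val -/(letter u i) -/(letter w i).
case: i => [[|p] lt_p] /=; first by rewrite u0 w0.
have [lt_pn|le_np] := ltnP p.+1 n.+1; first by apply: letter_prefE; apply: uw; lia.
have -> : p.+1 = n.+1 by lia.
by rewrite un wn.
Qed.

Lemma swap0 w : word_ok w -> swap set0 w = w.
Proof.
move=> _; apply/ffunP=> i; rewrite ffunE !inE andbF /=.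
by rewrite /letter inord_val.
Qed.

Lemma swap_ok I w : word_ok w -> I \subset descents w -> word_ok (swap I w).
Proof.
move=> wok /subsetP sI; have [w0 wn we] := word_okP _ wok.
apply/word_okP; split; rewrite /letter ?ffunE ?inordK //=.
- by case: ifP; rewrite ?w0.
- by case: ifP; rewrite // ltnn /= wn.
move=> p le_pe le_pn; rewrite ffunE inordK //; case: ifP => // _; case: ifP => [/andP[p0 /sI]|_].
  by move=> _; apply: we; lia.
exact: we.
Qed.

Lemma weight_swap I w : word_ok w -> I \subset descents w ->
  (weight (swap I w) <= weight w ?= iff (I == set0))%N.
Proof.
move=> wok sI; split.
  apply: leq_sum => p _; rewrite pref_swap //; case: ifP => // _.
  exact/leq_size_pref/leq_pred.
have [->|/set0Pn[i Ii]] := eqVneq I set0; first by rewrite swap0 ?eqxx.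
apply/negbTE; rewrite neq_ltn; apply/orP; left; rewrite /weight.
have := subsetP sI i Ii; rewrite inE => /and3P[lt_i wi _].
have [w0 _ _] := word_okP _ wok.
rewrite (bigD1 (Ordinal lt_i)) //= [X in (_ < X)%N](bigD1 (Ordinal lt_i)) //= -addSn.
apply: leq_add; last first.
  apply: leq_sum => p _; rewrite pref_swap //; case: ifP => // _.
  exact/leq_size_pref/leq_pred.
rewrite pref_swap // inord_val Ii.
case: (i : nat) wi => [|p wp] /=; first by rewrite w0.
by rewrite size_prefS wp addn1.
Qed.

(** Suppose [u] is deeper than [w] at some rank. Outside T a stay of [u] is preceded by a stay, and
    tracing back shows that [u] moves at the next position whenever it is deeper. It then remains
    deeper up to rank n and moves at position n + 1, which is padding. *)
Lemma size_pref_min T u w p : word_ok u -> word_ok w -> descents u \subset T ->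
    (forall i, i \in T -> pref u i = pref w i) -> (p < n.+1)%N ->
  (size (pref u p) <= size (pref w p))%N.
Proof.
move=> uok wok sT uw lt_p; have [u0 un _] := word_okP _ uok.
have [w0 _ _] := word_okP _ wok.
have eq_in q : (q < n.+1)%N -> inord q \in T -> pref u q = pref w q.
  by move=> lt_q /uw; rewrite inordK //; lia.
have desc q : (q < n.+1)%N -> inord q \notin T -> letter u q.+1 = None -> letter u q = None.
  move=> lt_q qT uq; apply/eqP; apply: contraNT qT => nq; apply: (subsetP sT).
  by rewrite inE inordK ?lt_q ?nq ?uq //; lia.
rewrite leqNgt; apply/negP => lt_wu.
have down q : (q < n.+1)%N -> (size (pref w q) < size (pref u q))%N -> letter u q.+1 != None.
  elim: q {lt_wu lt_p p} => [|q IHq] lt_q; first by rewrite !pref0.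
  have qT : (size (pref w q.+1) < size (pref u q.+1))%N -> inord q.+1 \notin T.
    by move=> lt; apply/negP => /(eq_in _ lt_q) eq; rewrite eq ltnn in lt.
  move=> lt_wu; apply/negP => /eqP /(desc _ lt_q (qT lt_wu)) uq.
  have : letter u q.+1 != None.
    apply: IHq; first lia.
    by move: lt_wu; rewrite !size_prefS uq eqxx addn0; apply: leq_ltn_trans (leq_addr _ _).
  by rewrite uq.
have up m : (p + m < n.+1)%N -> (size (pref w (p + m)) < size (pref u (p + m)))%N.
  elim: m => [|m IHm]; first by rewrite addn0.
  rewrite addnS => lt_pm; have lt_m := IHm (ltnW lt_pm).
  have := down _ (ltnW lt_pm) lt_m; rewrite !size_prefS => ->.
  by case: (letter w _); lia.
have := down n (ltnSn n); rewrite un => /(_ _)/negP; apply=> //.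
by have := up (n - p)%N; rewrite subnKC; [apply|]; lia.
Qed.

(* Among the words with prescribed prefixes at the ranks in T, the one whose   *)
(* descents lie in T is the unique one of minimal weight: it moves as late as  *)
(* possible.                                                                   *)
Lemma weight_min T u w : word_ok u -> word_ok w -> descents u \subset T ->
    (forall i, i \in T -> pref u i = pref w i) ->
  (weight u <= weight w)%N /\ ((weight w <= weight u)%N -> u = w).
Proof.
move=> uok wok sT uw.
have min p := @size_pref_min T u w p uok wok sT uw.
have [u0 un _] := word_okP _ uok; have [w0 wn _] := word_okP _ wok.
split=> [|le_wu]; first by apply: leq_sum => p _; exact: min.
have eq_size p : (p < n.+1)%N -> size (pref u p) = size (pref w p).
  move=> lt_p; apply/eqP; rewrite eqn_leq min //= leqNgt; apply/negP => lt_uw.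
  move: le_wu; rewrite /weight leqNgt => /negP; apply.
  rewrite (bigD1 (Ordinal lt_p)) //= [X in (_ < X)%N](bigD1 (Ordinal lt_p)) //= -addSn.
  by apply: leq_add => //; apply: leq_sum => q _; exact: min.
have eq_letter p : (p < n.+1)%N -> (letter u p != None) = (letter w p != None).
  case: p => [|p] lt_p; first by rewrite u0 w0.
  have := eq_size _ lt_p; rewrite !size_prefS eq_size; last lia.
  by move/addnI; case: (_ != _) (_ != _) => [] [].
(* Past the last rank of T the word [u] has no descents, and it ends with the stay at n + 1, so it
   never moves. *)
have none_end : forall m p, (p + m = n)%N ->
    (forall q, (p <= q < n.+1)%N -> inord q \notin T) -> letter u p = None.
  elim=> [|m IHm] p.
    rewrite addn0 => -> /(_ n); rewrite leqnn ltnSn => /(_ isT) nT.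
    apply/eqP; apply: contraNT nT => un'; apply: (subsetP sT).
    by rewrite inE inordK ?ltnSn ?un' ?un.
  move=> pm pT; have up1 : letter u p.+1 = None.
    by apply: IHm => [|q /andP[lt_pq lt_q]]; [lia|apply: pT; lia].
  apply/eqP; have : inord p \notin T by apply: pT; lia.
  apply: contraNT => up'; apply: (subsetP sT).
  rewrite inE inordK; last lia.
  by rewrite up' up1 eqxx !andbT; lia.
apply: pref_inj => //; elim=> [|p IHp] lt_p; first by rewrite !pref0.
have [/existsP[q /and3P[qT le_pq lt_q]]|/existsPn noq] :=
  boolP [exists q : 'I_n.+2, [&& q \in T, (p.+1 <= q)%N & (q < n.+1)%N]].
  (* At a later rank of T the two nodes agree; cutting them to the same depth gives the nodes at p +
     1. *)
  have take_pref v : take (size (pref v p.+1)) (pref v q) = pref v p.+1.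
    by have /prefixP[s ->] := prefix_pref v le_pq; rewrite take_size_cat.
  by rewrite -(take_pref u) -(take_pref w) eq_size // uw.
have up : letter u p.+1 = None.
  apply: (none_end (n - p.+1)%N) => [|q /andP[le_pq lt_q]]; first lia.
  by have := noq (inord q); rewrite inordK ?le_pq ?lt_q ?andbT //; lia.
have := eq_letter _ lt_p; rewrite up /= => /esym/negbFE/eqP wp.
by rewrite !prefS up wp !cats0 IHp // ltnW.
Qed.

(** A word of least weight with the given prefixes works: the exchange at a descent outside T would
    keep the prefixes and lower the weight. *)
Lemma normal_form T w : word_ok w -> T \subset proper_ranks n ->
  exists u, [/\ word_ok u, descents u \subset T & forall i, i \in T -> pref u i = pref w i].
Proof.
move=> wok sTp; pose P u := word_ok u && [forall i in T, pref u i == pref w i].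
have Pw : P w by rewrite /P wok; apply/'forall_implyP.
case: (arg_minnP weight Pw) => u /andP[uok /'forall_implyP uw] min_u.
have {}uw i : i \in T -> pref u i = pref w i by move/uw/eqP.
exists u; split=> //; apply/subsetP=> i; apply: contraTT => iT; apply/negP => ui.
have sI : [set i] \subset descents u by rewrite sub1set.
have [le_sw eq_sw] := weight_swap uok sI.
have P_swap : P (swap [set i] u).
  rewrite /P swap_ok //; apply/'forall_implyP => j jT; rewrite pref_swap //.
    by rewrite inord_val inE (negbTE (_ : j != i)) ?uw //; apply: contraNneq iT => <-.
  by have := subsetP sTp j jT; rewrite inE => /andP[].
have i0 : ([set i] == set0) = false by apply/negbTE/set0Pn; exists i; rewrite inE.
by move: eq_sw; rewrite i0 eqn_leq le_sw (min_u _ P_swap).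
Qed.

Lemma word_of_prefixes (s : nat -> seq 'I_t) :
    s 0%N = [::] -> ((e <= 1)%N /\ ((e = 1)%N -> s 1%N = [::])) ->
    (forall p, (p < n)%N -> prefix (s p) (s p.+1) && (size (s p.+1) <= (size (s p)).+1)%N) ->
  exists2 w, word_ok w & forall p, (p < n.+1)%N -> pref w p = s p.
Proof.
move=> s0 [e1 s1] sS.
pose w : wordT := [ffun i : 'I_n.+2 =>
  if (0 < i < n.+1)%N then ohead (drop (size (s i.-1)) (s i)) else None].
have wE p : (p < n.+2)%N -> letter w p =
    if (0 < p < n.+1)%N then ohead (drop (size (s p.-1)) (s p)) else None.
  by move=> lt_p; rewrite /letter ffunE inordK.
exists w.
  apply/word_okP; split=> [||p le_pe le_pn]; rewrite wE //; first by rewrite ltnn andbF.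
  case: p le_pe le_pn => [//|[|p]] le_pe le_pn; last lia.
  by rewrite /= s1 ?s0 ?if_same //; lia.
elim=> [|p IHp] lt_p; first by rewrite pref0 ?wE.
rewrite prefS IHp ?wE ?lt_p //=; try lia.
have lt_pn : (p < n)%N by lia.
have /andP[/prefixP[r sr]] := sS p lt_pn.
rewrite sr size_cat drop_size_cat // -addn1 leq_add2l.
by case: r {sr} => [|a [|]].
Qed.

End Words.

(** * Rees products with trees *)

Definition inner d (X : finTBPOrderType d) (u : X) := (\bot < u < \top)%O.

(* X is a Rees product with extrema added: e = 0 for the one of P minus its    *)
(* maximum with T_(t, n), without its minimum, and e = 1 for the one of P      *)
(* minus both extrema (where ranks drop by 1) with T_(t, n - 1).               *)
Record rees_over (t e : nat) dP (P : finTBPOrderType dP) dX (X : finTBPOrderType dX)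
    (pr : X -> P) (wd : X -> seq 'I_t) : Prop := ReesOver {
  rees_pr_inner : forall u, inner u -> inner (pr u);
  rees_wd_size : forall u, inner u -> (size (wd u) + e <= rank (pr u))%N;
  rees_inj : forall u v, inner u -> inner v -> pr u = pr v -> wd u = wd v -> u = v;
  rees_onto : forall p s, inner p -> (size s + e <= rank p)%N ->
    exists u, [/\ inner u, pr u = p & wd u = s];
  rees_leE : forall u v, inner u -> inner v ->
    (u <= v)%O = [&& (pr u <= pr v)%O, prefix (wd u) (wd v)
      & (size (wd v) + rank (pr u) <= rank (pr v) + size (wd u))%N]
}.

Section ReesRank.
Variables (n t e : nat) (dP dX : Order.disp_t).
Variables (P : finTBPOrderType dP) (X : finTBPOrderType dX).
Variables (pr : X -> P) (wd : X -> seq 'I_t).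
Hypotheses (n_gt0 : (0 < n)%N) (e1 : (e <= 1)%N) (rankedP : ranked n P).
Hypothesis reesX : rees_over e pr wd.
Implicit Types (u v : X) (p : P).

Let r u := if u == \bot%O then 0%N else if u == \top%O then n.+1 else rank (pr u).

Lemma inner_rank p : inner p = (0 < rank p < n.+1)%N.
Proof. by rewrite rank_proper. Qed.

Lemma inner_cases u : [\/ u = \bot%O, u = \top%O | inner u].
Proof.
rewrite /inner lt0x ltx1.
by case: eqP => [->|_]; [constructor 1|case: eqP => [->|_]; [constructor 2|constructor 3]].
Qed.

Lemma ranked_bot_lt_top d (Q : finTBPOrderType d) : ranked n Q -> (\bot < \top :> Q)%O.
Proof.
move=> [rkT _]; rewrite lt0x; apply/eqP => bt; have := rank_bot Q.
by rewrite -bt rkT.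
Qed.

Lemma inner_between p q i : (p < q)%O -> (rank p < i < rank q)%N ->
  exists z, [/\ inner z, (p < z < q)%O & rank z = i].
Proof.
move=> lt_pq ri; have [z zP rz] := rankedP.2 p q i lt_pq ri; exists z; split=> //.
have := rank_le (lex1 q); rewrite inner_rank rz rankedP.1; lia.
Qed.

(** With equal components in [P], the rank condition leaves no room for a longer word. *)
Lemma rees_lt u v : inner u -> inner v -> (u < v)%O -> (pr u < pr v)%O.
Proof.
move=> iu iv lt_uv; have := ltW lt_uv; rewrite (rees_leE reesX) // => /and3P[le_p pre sz].
rewrite lt_neqAle le_p andbT; apply: contraTneq lt_uv => eq_p.
rewrite (rees_inj reesX iu iv eq_p) ?ltxx //.
case/prefixP: pre sz => -[|a s] ->; first by rewrite cats0.
by rewrite eq_p size_cat /=; lia.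
Qed.

Lemma rees_top_neq : (\top%O : X) != \bot%O.
Proof.
have [||p [ip _ rp]] := @inner_between \bot%O \top%O 1%N.
- exact: ranked_bot_lt_top.
- by rewrite rankedP.1 rank_bot; lia.
have [|u [/andP[u0 _] _ _]] := rees_onto reesX (p := p) (s := [::]) ip.
  by rewrite rp /=; lia.
by rewrite -lt0x; apply: lt_le_trans u0 _; exact: lex1.
Qed.

(** The tree does not affect the rank, because a word can be shortened when the rank in [P]
    drops. *)
Lemma rees_rankE u : rank u = r u.
Proof.
have rE v : inner v -> r v = rank (pr v).
  by rewrite /inner /r lt0x ltx1 => /andP[/negbTE-> /negbTE->].
have r0 : r \bot%O = 0%N by rewrite /r eqxx.
have rT : r \top%O = n.+1 by rewrite /r eqxx (negbTE rees_top_neq).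
have r_inner v : inner v -> (0 < r v < n.+1)%N.
  by move=> iv; rewrite rE // -inner_rank (rees_pr_inner reesX).
move: u; apply: rank_unique => [u v lt_uv|u].
  have [eu|eu|iu] := inner_cases u; have [ev|ev|iv] := inner_cases v; subst.
  - by rewrite ltxx in lt_uv.
  - by rewrite r0 rT.
  - by rewrite r0; case/andP: (r_inner v iv).
  - by rewrite ltx0 in lt_uv.
  - by rewrite ltxx in lt_uv.
  - by have := lt_le_trans lt_uv (lex1 v); rewrite ltxx.
  - by rewrite ltx0 in lt_uv.
  - by rewrite rT; case/andP: (r_inner u iu).
  by rewrite !rE //; apply/rank_lt/rees_lt.
have [->|->|iu] := inner_cases u; first by rewrite r0.
  move=> _; rewrite rT /=.
  have [||p [ip _ rp]] := @inner_between \bot%O \top%O n.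
  - exact: ranked_bot_lt_top.
  - by rewrite rankedP.1 rank_bot; lia.
  have [|v [iv pv _]] := rees_onto reesX (p := p) (s := [::]) ip.
    by rewrite rp /=; lia.
  by exists v; [case/andP: iv|rewrite rE // pv].
rewrite rE // => r_gt0.
have [r1|r_neq1] := eqVneq (rank (pr u)) 1%N.
  by exists \bot%O; [case/andP: iu|rewrite r0 r1].
have [p lt_pu rp] := rank_pred r_gt0.
have ip : inner p.
  rewrite inner_rank; have := r_inner u iu; rewrite rE //; lia.
(* Cut to the length allowed one rank lower; at most one letter is lost, since [size (wd u) + e] is
   at most the rank of [pr u]. *)
pose s := take ((rank (pr u)).-1 - e) (wd u).
have szu := rees_wd_size reesX iu.
have [|v [iv pv wv]] := rees_onto reesX (p := p) (s := s) ip.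
  by rewrite size_take; case: ifP; lia.
exists v; last by rewrite rE // pv.
rewrite lt_neqAle; apply/andP; split; first by apply: contraTneq lt_pu => <-; rewrite -pv ltxx.
rewrite (rees_leE reesX) // pv wv (ltW lt_pu) /s prefix_take /=.
by rewrite size_take; case: ifP; lia.
Qed.

Lemma rees_rank u : inner u -> rank u = rank (pr u).
Proof. by rewrite rees_rankE /inner /r lt0x ltx1 => /andP[/negbTE-> /negbTE->]. Qed.

Lemma rees_ranked : ranked n X.
Proof.
have rkT : rank (\top%O : X) = n.+1.
  by rewrite rees_rankE /r eqxx (negbTE rees_top_neq).
split=> // u v i lt_uv /andP[lt_ui lt_iv].
have i_bnd : (0 < i < n.+1)%N by have := rank_le (lex1 v); lia.
have [eu|eu|iu] := inner_cases u; last 1 first.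
- have [ev|ev|iv] := inner_cases v.
  + by rewrite ev ltx0 in lt_uv.
  + have [||z [iz /andP[lt_pz _] rz]] := @inner_between (pr u) \top%O i.
    * by have /andP[] := rees_pr_inner reesX iu.
    * by rewrite -rees_rank // rankedP.1 lt_ui; case/andP: i_bnd.
    have [|w [iw pw ww]] := rees_onto reesX (p := z) (s := wd u) iz.
      by have := rees_wd_size reesX iu; rewrite rz -rees_rank //; lia.
    exists w; last by rewrite rees_rank // pw.
    rewrite ev; apply/andP; split; last by case/andP: iw.
    rewrite lt_neqAle; apply/andP; split; first by apply: contraTneq lt_pz => ->; rewrite pw ltxx.
    by rewrite (rees_leE reesX) // pw ww (ltW lt_pz) prefix_refl /= rz -rees_rank //; lia.
  have lt_p := rees_lt iu iv lt_uv.
  have := ltW lt_uv; rewrite (rees_leE reesX) // => /and3P[_ /prefixP[s sE] sz].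
  have [||z [iz /andP[lt_pz lt_zq] rz]] := @inner_between (pr u) (pr v) i => //.
    by rewrite -!rees_rank // lt_ui.
  have szv := rees_wd_size reesX iv; have szu := rees_wd_size reesX iu.
  rewrite -!rees_rank // in szv szu sz.
  (* The least length allowed for the intermediate word: it extends that of [u], and at most
     [rank v - i] letters may still be added on the way to [v]. *)
  pose m := maxn (size (wd u)) (size (wd v) + i - rank v).
  have [|w [iw pw ww]] := rees_onto reesX (p := z) (s := take m (wd v)) iz.
    by rewrite size_take rz; case: ifP; lia.
  have szvu : size (wd v) = (size (wd u) + size s)%N by rewrite sE size_cat.
  have m_le : (m <= size (wd v))%N by rewrite /m geq_max; lia.
  have szw : size (wd w) = m by rewrite ww size_takel.
  exists w; last by rewrite rees_rank // pw.
  apply/andP; split; rewrite lt_neqAle; apply/andP; split.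
  + by apply: contraTneq lt_pz => ->; rewrite pw ltxx.
  + rewrite (rees_leE reesX) // szw pw (ltW lt_pz) rz -rees_rank //=.
    apply/andP; split; last by rewrite /m; lia.
    rewrite ww sE take_cat; case: ltnP => [|_]; last exact: prefix_prefix.
    by rewrite /m; lia.
  + by apply: contraTneq lt_zq => <-; rewrite pw ltxx.
  rewrite (rees_leE reesX) // szw pw (ltW lt_zq) rz -rees_rank //=.
  by rewrite ww prefix_take /= /m; lia.
- have [ev|ev|iv] := inner_cases v.
  + by rewrite ev ltx0 in lt_uv.
  + have [||z [iz _ rz]] := @inner_between \bot%O \top%O i.
    * exact: ranked_bot_lt_top.
    * by rewrite rank_bot rankedP.1.
    have [|w [iw pw ww]] := rees_onto reesX (p := z) (s := [::]) iz.
      by rewrite rz /=; lia.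
    exists w; last by rewrite rees_rank // pw.
    by rewrite eu ev.
  have [||z [iz /andP[_ lt_zq] rz]] := @inner_between \bot%O (pr v) i.
  * by have /andP[] := rees_pr_inner reesX iv.
  * by rewrite rank_bot -rees_rank // lt_iv; case/andP: i_bnd => ->.
  have szv := rees_wd_size reesX iv; rewrite -!rees_rank // in szv.
  pose m := (size (wd v) + i - rank v)%N.
  have m_le : (m <= size (wd v))%N by rewrite /m; lia.
  have [|w [iw pw ww]] := rees_onto reesX (p := z) (s := take m (wd v)) iz.
    by rewrite size_takel // rz /m; lia.
  exists w; last by rewrite rees_rank // pw.
  rewrite eu; apply/andP; split; first by case/andP: iw.
  rewrite lt_neqAle; apply/andP; split; first by apply: contraTneq lt_zq => <-; rewrite pw ltxx.
  rewrite (rees_leE reesX) // pw ww (ltW lt_zq) prefix_take size_takel //= rz -rees_rank //.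
  by rewrite /m; lia.
by have := lt_le_trans lt_uv (lex1 v); rewrite eu ltxx.
Qed.

End ReesRank.

Section ReesChains.
Variables (k : fieldType) (n t e : nat) (dP dX : Order.disp_t).
Variables (P : finTBPOrderType dP) (X : finTBPOrderType dX).
Variables (pr : X -> P) (wd : X -> seq 'I_t).
Hypotheses (n_gt0 : (0 < n)%N) (e1 : (e <= 1)%N) (rankedP : ranked n P).
Hypothesis reesX : rees_over e pr wd.
Local Notation wordT := {ffun 'I_n.+2 -> option 'I_t}.
Implicit Types (u : X) (p z : P) (w : wordT) (c : {set P}) (C D : {set X}).
Implicit Types (T A I : {set 'I_n.+2}) (i l : 'I_n.+2).

Let rankedX : ranked n X := rees_ranked n_gt0 e1 rankedP reesX.

Definition carries w C := [forall u in C, wd u == pref w (rank (pr u))].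

Definition lift_chain c w : {set X} :=
  [set u | [&& inner u, pr u \in c & wd u == pref w (rank (pr u))]].

Definition inner_set d (Y : finTBPOrderType d) (C : {set Y}) := C \subset [set x : Y | inner x].

Lemma carriesP w C : reflect {in C, forall u, wd u = pref w (rank (pr u))} (carries w C).
Proof. by apply: (iffP 'forall_implyP) => h u /h => [/eqP|->]. Qed.

Lemma innerP d (Y : finTBPOrderType d) (C : {set Y}) :
  reflect {in C, forall x : Y, inner x} (inner_set C).
Proof. by apply: (iffP subsetP) => h u /h; rewrite inE. Qed.

Lemma rees_rk u : inner u -> rk n u = rk n (pr u).
Proof. by move=> iu; rewrite /rk (rees_rank n_gt0 e1 rankedP reesX). Qed.

Lemma inner_rk_lt p : inner p -> (rank p < n.+1)%N.
Proof. by rewrite (inner_rank rankedP) => /andP[]. Qed.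

Lemma lift_chain_inner c w : inner_set (lift_chain c w).
Proof. by apply/innerP => u; rewrite inE => /and3P[]. Qed.

Lemma lift_chain_carries c w : carries w (lift_chain c w).
Proof. by apply/carriesP => u; rewrite inE => /and3P[_ _ /eqP]. Qed.

Lemma lift_point w p : word_ok e w -> inner p ->
  exists u, [/\ inner u, pr u = p & wd u = pref w (rank p)].
Proof.
move=> wok ip; apply: (rees_onto reesX ip).
apply: (size_pref (n := n)) => //; move: ip; rewrite (inner_rank rankedP) => /andP[-> /ltnW].
by [].
Qed.

Lemma pr_lift_chain c w : word_ok e w -> inner_set c -> pr @: lift_chain c w = c.
Proof.
move=> wok /innerP ic; apply/setP=> p; apply/imsetP/idP => [[u]|cp].
  by rewrite inE => /and3P[_ + _] ->.
have [u [iu pu wu]] := lift_point wok (ic p cp).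
by exists u; rewrite // inE iu pu cp wu eqxx.
Qed.

Lemma carries_lift_chain w C : inner_set C -> carries w C ->
  C = lift_chain (pr @: C) w.
Proof.
move=> /innerP iC /carriesP wC; apply/setP=> u; rewrite inE.
apply/idP/and3P => [Cu|[iu /imsetP[v Cv puv] /eqP wu]].
  by split; rewrite ?iC ?imset_f ?wC.
by rewrite (rees_inj reesX iu (iC v Cv) puv) // wu wC // puv.
Qed.

Lemma inner_pr_set C : inner_set C -> inner_set (pr @: C).
Proof.
by move=> /innerP iC; apply/innerP=> _ /imsetP[u /iC iu ->]; exact: (rees_pr_inner reesX).
Qed.

Lemma typed_inner d (Y : finTBPOrderType d) T (C : {set Y}) :
  typed_chain \bot%O \top%O T C -> inner_set C.
Proof. by case/and3P. Qed.

(** Along a word both tree conditions follow from the order of the ranks, so a carried chain is an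
    isomorphic copy of its projection. *)
Lemma carries_le w C : inner_set C -> carries w C ->
  {in C &, forall u v, (u <= v)%O = (pr u <= pr v)%O}.
Proof.
move=> /innerP iC /carriesP wC u v Cu Cv.
rewrite (rees_leE reesX) ?iC // !wC //; case: (boolP (_ <= _)%O) => //= le_uv.
by rewrite prefix_pref ?rank_le // size_pref_le // rank_le.
Qed.

Lemma rk_pr_set C : inner_set C -> @rk n _ _ @: (pr @: C) = @rk n _ _ @: C.
Proof.
move=> /innerP iC; rewrite -imset_comp; apply: eq_in_imset => u /iC iu /=.
by rewrite rees_rk.
Qed.

Lemma typed_chain_pr T w C : inner_set C -> carries w C ->
  typed_chain \bot%O \top%O T (pr @: C) = typed_chain \bot%O \top%O T C.
Proof.
move=> iC wC; rewrite /typed_chain rk_pr_set // -/(inner_set _) -/(inner_set C).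
rewrite iC inner_pr_set //; congr (_ && _).
have leC := carries_le iC wC.
apply/chainP/chainP => cC.
  move=> u v Cu Cv; have := cC _ _ (imset_f pr Cu) (imset_f pr Cv).
  by rewrite /Order.comparable !leC.
move=> _ _ /imsetP[u Cu ->] /imsetP[v Cv ->].
by rewrite /Order.comparable -!leC //; exact: cC.
Qed.

Lemma typed_lift_chain T w c : word_ok e w -> inner_set c ->
  typed_chain \bot%O \top%O T (lift_chain c w) = typed_chain \bot%O \top%O T c.
Proof.
move=> wok ic; rewrite -{2}(pr_lift_chain wok ic).
by rewrite (typed_chain_pr _ (lift_chain_inner _ _) (lift_chain_carries _ _)).
Qed.

Lemma typed_extension d (Q : finTBPOrderType d) T (C : {set Q}) : ranked n Q ->
  T \subset proper_ranks n -> typed_chain \bot%O \top%O T C ->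
  exists2 D : {set Q}, typed_chain \bot%O \top%O (proper_ranks n) D & C \subset D.
Proof.
move=> rQ sT /and3P[cC sC _].
have iC : inner_set C by [].
pose b : {set Q} := [set \bot%O; \top%O].
have selT : rank_selected Q (fset_of (proper_ranks n)) = [set: Q].
  apply/setP=> z; rewrite !inE -(rkE rQ) in_fset_of inE (rkE rQ) (rank_proper rQ).
  by rewrite lt0x ltx1; case: eqP => //; case: eqP.
have cbC : chain (b :|: C).
  rewrite -setUA; apply: chainU1 => [|z _]; last exact/le_comparable/le0x.
  apply: chainU1 => // z _; rewrite comparable_sym; exact/le_comparable/lex1.
have [D maxD sD] := chain_extension cbC.
move: maxD; rewrite -selT (max_chains_selected rQ) // => /andP[_ tD].
exists (D :\: b) => //; apply/subsetP=> u Cu; rewrite inE (subsetP sD) ?inE ?Cu ?orbT // andbT.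
by have /innerP/(_ u Cu) := iC; rewrite /inner lt0x ltx1 negb_or.
Qed.

(** A chain with gaps does not determine a path. It is extended to all ranks, a word is read off,
    and the normal form for T keeps the nodes at the ranks of the chain. *)
Lemma exists_carrier T C : T \subset proper_ranks n ->
  typed_chain \bot%O \top%O T C ->
  exists w, [/\ word_ok e w, descents w \subset T & carries w C].
Proof.
move=> sT tC; have [D tD sCD] := typed_extension rankedX sT tC.
have /and3P[cD _ /eqP rD] := tD; have /innerP iD := typed_inner tD.
(* The default is the root of the tree, which is the node at rank 0. *)
pose s (p : nat) := if [pick u in D | rank u == p] is Some u then wd u else [::].
have sE u : u \in D -> s (rank u) = wd u.
  move=> Du; rewrite /s; case: pickP => [v /andP[Dv /eqP ruv]|/(_ u)]; last first.
    by rewrite Du eqxx.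
  congr wd; apply: comparable_rank_eq ruv; exact: (chainP _ cD).
have D_ex (p : nat) : (0 < p < n.+1)%N -> exists2 u, u \in D & rank u = p.
  move=> /andP[p0 pn]; have : inord p \in @rk n _ _ @: D by rewrite rD inE inordK ?p0 ?pn //; lia.
  case/imsetP=> u Du /(congr1 val) /=; rewrite inordK ?(rkE rankedX) => [->|]; last lia.
  by exists u.
have s0 : s 0%N = [::].
  rewrite /s; case: pickP => // u /andP[/iD iu /eqP ru].
  by move: iu; rewrite (inner_rank rankedX) ru.
have s_size (p : nat) : (0 < p < n.+1)%N -> (size (s p) + e <= p)%N.
  move=> /D_ex[u Du <-]; rewrite sE // (rees_rank n_gt0 e1 rankedP reesX) ?iD //.
  exact/(rees_wd_size reesX)/iD.
have [||w wok ws] := @word_of_prefixes t n e s s0.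
- split=> // e_1; have := s_size 1%N n_gt0; rewrite e_1.
  by case: (s 1%N) => //= a r; lia.
- move=> p lt_p; have [u Du ru] : exists2 u, u \in D & rank u = p.+1 by apply: D_ex.
  have [p0|p0] := posnP p.
    by rewrite p0 s0 prefix0s /= (leq_trans _ (s_size 1%N n_gt0)) ?leq_addr.
  have [v Dv rv] : exists2 v, v \in D & rank v = p by apply: D_ex; lia.
  rewrite -ru -rv !sE //.
  have : (v <= u)%O.
    by apply/ltW/comparable_rank_lt; [exact: (chainP _ cD)|rewrite rv ru].
  rewrite (rees_leE reesX) ?iD // => /and3P[_ -> /=].
  rewrite -!(rees_rank n_gt0 e1 rankedP reesX) ?iD // rv ru; lia.
have [w' [w'ok w'T w'w]] := normal_form wok sT.
exists w'; split=> //; apply/carriesP=> u Cu; have Du := subsetP sCD u Cu.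
have iu := iD u Du.
have := w'w (rk n u); rewrite (rkE rankedX) (rees_rank n_gt0 e1 rankedP reesX) // => ->.
  rewrite ws ?inner_rk_lt ?(rees_pr_inner reesX) //.
  by rewrite -(rees_rank n_gt0 e1 rankedP reesX) // sE.
by have /and3P[_ _ /eqP <-] := tC; rewrite imset_f.
Qed.

Lemma carries_pref T C w w' : typed_chain \bot%O \top%O T C ->
  carries w C -> carries w' C -> forall i, i \in T -> pref w i = pref w' i.
Proof.
move=> tC /carriesP wC /carriesP w'C i; have /innerP iC := typed_inner tC.
case/and3P: tC => _ _ /eqP <- /imsetP[u Cu ->].
by rewrite (rkE rankedX) (rees_rank n_gt0 e1 rankedP reesX) ?iC // -wC // w'C.
Qed.

(** The copy of [h] along the path [w]. One chain can occur for several words, so distinct words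
    need not give independent copies. *)
Definition tensor (h : 'rV[k]_#|{set P}|) w : 'rV[k]_#|{set X}| :=
  vec (fun C => if inner_set C && carries w C then entry h (pr @: C) else 0).

Lemma entry_tensor h w C : entry (tensor h w) C =
  if inner_set C && carries w C then entry h (pr @: C) else 0.
Proof. exact: vecE. Qed.

Lemma carriesU1 w u D : carries w (u |: D) = (wd u == pref w (rank (pr u))) && carries w D.
Proof.
apply/carriesP/andP => [wD|[/eqP wu /carriesP wD] v /setU1P[->//|/wD//]].
by split; [apply/eqP/wD/setU11|apply/carriesP => v Dv; apply/wD/setU1r].
Qed.

Lemma inner_setU1 d (Y : finTBPOrderType d) (z : Y) (D : {set Y}) :
  inner_set (z |: D) = inner z && inner_set D.
Proof. by rewrite /inner_set subUset sub1set inE. Qed.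

(** An element of rank [l] that extends a carried chain along [w] is the lift of a unique element of
    [P], so forgetting happens in [P] alone. *)
Lemma forget_tensor h w l : word_ok e w -> l \in proper_ranks n ->
  tensor h w *m forget_mx k X l = tensor (h *m forget_mx k P l) w.
Proof.
move=> wok lpr; apply: entry_inj => D; rewrite entry_forget entry_tensor.
case: ifPn => [/andP[iD wD]|ND]; last first.
  rewrite big1 // => u _; rewrite entry_tensor inner_setU1 carriesU1.
  by rewrite ifN //; apply: contra ND => /andP[/andP[_ ->] /andP[_ ->]].
rewrite entry_forget.
have inner_l z : rk n z = l -> inner z.
  by move=> rz; move: lpr; rewrite inE -rz (rkE rankedP) (inner_rank rankedP).
rewrite (eq_bigr (fun u => if inner u && (wd u == pref w l)
  then entry h (pr u |: pr @: D) else 0)); last first.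
  move=> u /andP[Du /eqP ru]; rewrite entry_tensor inner_setU1 carriesU1 iD wD !andbT.
  have [iu|//] := boolP (inner u).
  by rewrite -(rees_rank n_gt0 e1 rankedP reesX) // -(rkE rankedX) ru imsetU1.
rewrite -big_mkcondr /=.
pose L := [set u | [&& u \notin D, rk n u == l, inner u & wd u == pref w l]].
rewrite (eq_bigl (fun u => u \in L)) => [|u]; last by rewrite inE -!andbA.
rewrite -(big_imset (fun z => entry h (z |: pr @: D))) /=; last first.
  move=> u v; rewrite !inE => /and4P[_ _ iu /eqP wu] /and4P[_ _ iv /eqP wv] puv.
  by apply: (rees_inj reesX) => //; rewrite wu.
apply: eq_bigl => z; apply/imsetP/andP => [[u + ->]|[Dz /eqP rz]].
  rewrite inE => /and4P[Du /eqP ru iu /eqP wu]; rewrite -rees_rk // ru; split=> //.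
  apply: contra Du => /imsetP[v Dv puv].
  have iv := innerP _ iD v Dv.
  rewrite (rees_inj reesX iu iv puv) // wu (carriesP _ _ wD v Dv) -puv.
  by rewrite -ru (rkE rankedX) (rees_rank n_gt0 e1 rankedP reesX).
have [u [iu pu wu]] := lift_point wok (inner_l z rz).
exists u => //; rewrite inE rees_rk // pu rz eqxx iu wu -rz (rkE rankedP) eqxx !andbT.
by apply: contra Dz => Du; rewrite -pu imset_f.
Qed.

(* The signed sums of the swaps of w replace w by a basis adapted to all       *)
(* forgetful maps: forgetting a rank kills them exactly at the descents of w.  *)
Definition sign_tensor (h : 'rV[k]_#|{set P}|) w :=
  \sum_(I : {set 'I_n.+2} | I \subset descents w) (-1) ^+ #|I| *: tensor h (swap I w).

Lemma forget_sign_tensor h w l : word_ok e w -> l \in proper_ranks n ->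
  sign_tensor h w *m forget_mx k X l = sign_tensor (h *m forget_mx k P l) w.
Proof.
move=> wok lpr; rewrite mulmx_suml; apply: eq_bigr => I sI.
by rewrite -scalemxAl forget_tensor ?swap_ok.
Qed.

(** The exchange at [l] changes only the prefix at rank [l], where C has no element. *)
Lemma carries_swap I w l C : word_ok e w -> I \subset descents w -> l \notin I ->
    l \in descents w -> inner_set C -> l \notin @rk n _ _ @: C ->
  carries (swap (l |: I) w) C = carries (swap I w) C.
Proof.
move=> wok sI lI lw /innerP iC lC.
have slI : l |: I \subset descents w by rewrite subUset sub1set lw.
apply: eq_forallb => u; case: (boolP (u \in C)) => //= Cu.
have iu := iC u Cu; have ru := inner_rk_lt (rees_pr_inner reesX iu).
rewrite !(pref_swap wok) // in_setU1 -/(rk n _) -rees_rk //.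
by rewrite (negbTE (_ : rk n u != l)) //; apply: contraNneq lC => <-; rewrite imset_f.
Qed.

(** Once rank [l] is forgotten, the terms of I and of l + I describe the same chains with opposite
    signs. *)
Lemma forget_sign_tensor0 h w l : word_ok e w -> l \in descents w ->
  (forall c, entry h c != 0 -> chain c) ->
  sign_tensor h w *m forget_mx k X l = 0.
Proof.
move=> wok lw hc; rewrite forget_sign_tensor //; last exact: (subsetP (descents_proper wok)).
set h' := h *m _.
have h'l c : entry h' c != 0 -> l \notin @rk n _ _ @: c.
  by case/entry_forget_neq0=> z [cz <- /hc]; exact: (rk_setU1_notin rankedP).
rewrite /sign_tensor (bigID (fun I : {set 'I_n.+2} => l \in I)) /=.
rewrite (reindex_onto (fun I => l |: I) (fun I => I :\ l)) /=; last first.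
  by move=> I /andP[_ lI]; rewrite setD1K.
apply/eqP; rewrite addr_eq0 -sumrN; apply/eqP; apply: eq_big => [I|I].
  rewrite setU11 andbT subUset sub1set lw /=; congr (_ && _).
  by apply/eqP/idP => [<-|/setU1K//]; rewrite setD11.
case/andP=> /andP[slI _] /eqP lI.
have {}lI : l \notin I by rewrite -lI setD11.
have sI : I \subset descents w by apply: subset_trans slI; exact: subsetU1.
rewrite cardsU1 lI exprS mulN1r scaleNr; congr (- (_ *: _)); apply: entry_inj => C.
rewrite !entry_tensor; have [iC|//] := boolP (inner_set C).
have [h'0|/h'l] := eqVneq (entry h' (pr @: C)) 0; first by rewrite h'0 !if_same.
by rewrite rk_pr_set // => lC; rewrite carries_swap.
Qed.

End ReesChains.

Section ReesLifting.
Variables (k : fieldType) (n t e : nat) (dP dX : Order.disp_t).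
Variables (P : finTBPOrderType dP) (X : finTBPOrderType dX).
Variables (pr : X -> P) (wd : X -> seq 'I_t).
Hypotheses (n_gt0 : (0 < n)%N) (e1 : (e <= 1)%N) (rankedP : ranked n P).
Hypothesis reesX : rees_over e pr wd.
Hypothesis liftP : lifting k n (\bot%O : P) \top%O.
Local Notation wordT := {ffun 'I_n.+2 -> option 'I_t}.
Implicit Types (u : X) (p z : P) (w : wordT) (c : {set P}) (C D : {set X}).
Implicit Types (T A I : {set 'I_n.+2}) (i l : 'I_n.+2).
Implicit Types (v : 'rV[k]_#|{set X}|) (h : 'rV[k]_#|{set P}|).

Let rankedX : ranked n X := rees_ranked n_gt0 e1 rankedP reesX.

Definition word_coord v w : 'rV[k]_#|{set P}| :=
  vec (fun c => if inner_set c then entry v (lift_chain pr wd c w) else 0).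

Lemma lift_chainU1 z c w u : word_ok e w -> inner u -> pr u = z -> wd u = pref w (rank z) ->
  lift_chain pr wd (z |: c) w = u |: lift_chain pr wd c w.
Proof.
move=> wok iu pu wu; apply/setP=> x; rewrite !inE.
apply/and3P/orP => [[ix + /eqP wx]|[/eqP->|/and3P[-> -> ->]]].
- case/orP=> [/eqP pz|->]; last by right; rewrite ix wx eqxx.
  by left; apply/eqP; apply: (rees_inj reesX) => //; rewrite ?pu // wx pz wu.
- by rewrite iu pu wu !eqxx.
by rewrite orbT.
Qed.

(** Suppose adding [u] to a chain on the path [w] leaves that path. The new chain is carried by
    another word with descents in T. If [l] is not a descent of [w], then [w] has the least weight
    among the words through the old chain, so the other word is heavier than m, which is excluded.
    Hence the condition on [v] at [l] is one on the coordinate alone. *)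
Lemma word_coord_cycle T A w v m :
    word_ok e w -> descents w \subset T -> T \subset proper_ranks n -> A \subset T ->
    (v <= cycle_mx k \bot%O \top%O T A)%MS ->
    (forall C w', entry v C != 0 -> word_ok e w' -> descents w' \subset T ->
       carries pr wd w' C -> (weight w' <= m)%N) -> weight w = m ->
  (word_coord v w <= cycle_mx k \bot%O \top%O T (A :\: descents w))%MS.
Proof.
move=> wok wT sT sA /cycle_mxP[vT vA] vm wm; apply/cycle_mxP; split=> [c|l].
  rewrite vecE; case: ifP => [ic /vT|]; last by rewrite eqxx.
  by rewrite (typed_lift_chain n_gt0 e1 rankedP reesX).
rewrite inE => /andP[lw Al]; apply: entry_inj => c; rewrite entry0 entry_forget.
have lpr : l \in proper_ranks n by apply: (subsetP sT); apply: (subsetP sA).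
have inner_l z : rk n z = l -> inner z.
  by move=> rz; move: lpr; rewrite inE -rz (rkE rankedP) (inner_rank rankedP).
have [ic|Nc] := boolP (inner_set c); last first.
  rewrite big1 // => z _; rewrite vecE inner_setU1 ifN //.
  by apply: contra Nc => /andP[].
set D := lift_chain pr wd c w.
have iD : inner_set D by exact: lift_chain_inner.
have wD : carries pr wd w D by exact: lift_chain_carries.
have prD : pr @: D = c by exact: (pr_lift_chain (e := e) e1 rankedP reesX).
have := congr1 (fun x => entry x D) (vA l Al); rewrite entry0 entry_forget.
move/(etrans _); apply.
rewrite [RHS](bigID (fun u => inner u && (wd u == pref w l))) /=.
rewrite [X in _ = _ + X]big1 ?addr0 => [|u /andP[/andP[Du /eqP ru] Nu]]; last first.
  apply/eqP; apply: contraNT Nu => vC.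
  have tC := vT _ vC; set C := u |: D in vC tC.
  have iu : inner u by apply: (innerP _ (typed_inner tC)); exact: setU11.
  rewrite iu /=; have [w' [w'ok w'T w'C]] := exists_carrier n_gt0 e1 rankedP reesX sT tC.
  have w'm := vm C w' vC w'ok w'T w'C.
  have tD : typed_chain \bot%O \top%O (T :\ l) D.
    by have [] := typed_chainU1 rankedX Du tC; rewrite ru.
  have w'D : carries pr wd w' D by move: w'C; rewrite carriesU1 => /andP[].
  have wTl : descents w \subset T :\ l by rewrite subsetD1 wT.
  have [_ eqw] := weight_min wok w'ok wTl (carries_pref n_gt0 e1 rankedP reesX tD wD w'D).
  have := carriesP _ _ _ _ w'C u (setU11 _ _).
  rewrite -eqw ?wm // -(rees_rank n_gt0 e1 rankedP reesX) // -(rkE rankedX) ru => ->.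
  exact: eqxx.
pose L := [set u | [&& u \notin D, rk n u == l, inner u & wd u == pref w l]].
rewrite [RHS](eq_bigl (fun u => u \in L)) => [|u]; last by rewrite [u \in L]inE -!andbA.
rewrite (eq_bigl (fun z => z \in pr @: L)) => [|z]; last first.
  apply/andP/imsetP => [[cz /eqP rz]|[u]].
    have [u [iu pu wu]] := lift_point e1 rankedP reesX wok (inner_l z rz).
    exists u => //; rewrite inE (rees_rk n_gt0 e1 rankedP reesX) // pu rz eqxx iu wu.
    rewrite -rz (rkE rankedP) eqxx !andbT.
    by apply: contra cz => Du; rewrite -pu -prD imset_f.
  rewrite inE => /and4P[Du /eqP ru iu /eqP wu ->].
  rewrite -(rees_rk n_gt0 e1 rankedP reesX) // ru; split=> //.
  rewrite -prD; apply: contra Du => /imsetP[x Dx pux].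
  have ix := innerP _ iD x Dx.
  rewrite (rees_inj reesX iu ix pux) // wu (carriesP _ _ _ _ wD x Dx) -pux.
  by rewrite -ru (rkE rankedX) (rees_rank n_gt0 e1 rankedP reesX).
rewrite big_imset /=; last first.
  move=> u x; rewrite !inE => /and4P[_ _ iu /eqP wu] /and4P[_ _ ix /eqP wx] pux.
  by apply: (rees_inj reesX) => //; rewrite wu.
apply: eq_bigr => u; rewrite inE => /and4P[Du /eqP ru iu /eqP wu].
rewrite vecE inner_setU1 ic (rees_pr_inner reesX) //=; congr entry.
apply: (lift_chainU1 _ wok iu erefl).
by rewrite wu -ru (rkE rankedX) (rees_rank n_gt0 e1 rankedP reesX).
Qed.

Lemma sign_tensor_supp T w h C : word_ok e w ->
    (forall c, entry h c != 0 -> typed_chain \bot%O \top%O T c) ->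
    entry (sign_tensor pr wd h w) C != 0 ->
  typed_chain \bot%O \top%O T C /\
  exists2 I : {set 'I_n.+2}, I \subset descents w & carries pr wd (swap I w) C.
Proof.
move=> wok hT; rewrite entry_sum => neq0.
have [I sI tI] : exists2 I : {set 'I_n.+2}, I \subset descents w &
    entry ((-1) ^+ #|I| *: tensor pr wd h (swap I w)) C != 0.
  apply/exists_inP; apply: contraNT neq0 => /exists_inPn IN.
  by rewrite big1 // => I /IN/negPn/eqP.
move: tI; rewrite entryZ entry_tensor; case: ifP => [/andP[iC wC]|]; last first.
  by rewrite mulr0 eqxx.
rewrite mulf_eq0 negb_or => /andP[_ /hT]; rewrite (typed_chain_pr n_gt0 e1 rankedP reesX _ iC wC).
by split=> //; exists I.
Qed.

Lemma rees_lifting : lifting k n (\bot%O : X) \top%O.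
Proof.
move=> T A i sAT iT ri.
have [sT|NsT] := boolP (T \subset proper_ranks n); last first.
  apply/rV_subP => v /cycle_mxP[vT _]; rewrite (_ : v = 0) ?sub0mx //.
  apply: entry_inj => C; rewrite entry0; apply/eqP; apply: contraNT NsT => /vT tC.
  have /and3P[_ _ /eqP <-] := tC; apply/subsetP=> _ /imsetP[u Cu ->].
  have := innerP _ (typed_inner tC) u Cu.
  by rewrite (inner_rank rankedX) inE (rkE rankedX).
have riP : (rk n (\bot%O : P) < i < rk n (\top%O : P))%N.
  by move: ri; rewrite !(rkE rankedX) !(rkE rankedP) !rank_bot rankedX.1 rankedP.1.
have ipr : i \in proper_ranks n by move: riP; rewrite inE !(rkE rankedP) rank_bot rankedP.1.
suff main m v : (v <= cycle_mx k \bot%O \top%O T A)%MS ->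
    (forall C w, entry v C != 0 -> word_ok e w -> descents w \subset T ->
       carries pr wd w C -> (weight w < m)%N) ->
    (v <= cycle_mx k \bot%O \top%O (i |: T) A *m forget_mx k X i)%MS.
  apply/rV_subP => v vc; apply: (main (\max_(w : wordT) weight w).+1 v vc) => C w _ _ _ _.
  by rewrite ltnS (bigop.leq_bigmax w).
(* Lift the components of v along the words of the largest weight m that       *)
(* occurs, and subtract: what remains involves words of smaller weight only.   *)
elim: m v => [|m IHm] v vc vm.
  rewrite (_ : v = 0) ?sub0mx //; apply: entry_inj => C; rewrite entry0.
  apply/eqP/negPn/negP => vC; have /cycle_mxP[vT _] := vc.
  have [w [wok wT wC]] := exists_carrier n_gt0 e1 rankedP reesX sT (vT C vC).
  by have := vm C w vC wok wT wC.
pose W := [pred w : wordT | [&& word_ok e w, descents w \subset T & weight w == m]].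
(* The conditions at the descents of [w] are not asked of [h], since [sign_tensor] supplies them. *)
have lift_w w : exists h : 'rV[k]_#|{set P}|, W w ->
    (h <= cycle_mx k \bot%O \top%O (i |: T) (A :\: descents w))%MS /\
    h *m forget_mx k P i = word_coord v w.
  have [/and3P[wok wT /eqP wm]|NW] := boolP (W w); last by exists 0.
  have hc := @word_coord_cycle T A w v m wok wT sT sAT vc vm wm.
  have := liftP (subset_trans (subsetDl A (descents w)) sAT) iT riP.
  move/(submx_trans hc)/submxP=> [B ->].
  by exists (B *m cycle_mx k \bot%O \top%O (i |: T) (A :\: descents w)); rewrite submxMl mulmxA.
have {lift_w}/fin_all_exists[g gP] := lift_w.
pose F := \sum_(w | W w) sign_tensor pr wd (g w) w.
have gT w : W w -> forall c, entry (g w) c != 0 -> typed_chain \bot%O \top%O (i |: T) c.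
  by case/gP=> /cycle_mxP[].
have Fc : (F <= cycle_mx k \bot%O \top%O (i |: T) A)%MS.
  apply: summx_sub => w Ww; have /and3P[wok wT _] := Ww.
  apply/cycle_mxP; split=> [C|l Al]; first by case/(sign_tensor_supp wok (gT w Ww)).
  have [lw|lw] := boolP (l \in descents w).
    apply: (forget_sign_tensor0 n_gt0 e1 rankedP reesX wok lw) => c /(gT w Ww)/and3P[].
    by [].
  rewrite (forget_sign_tensor n_gt0 e1 rankedP reesX) //; last first.
    by apply: (subsetP sT); apply: (subsetP sAT).
  have [/cycle_mxP[_ kill] _] := gP w Ww.
  rewrite kill; last by rewrite inE lw.
  rewrite /sign_tensor big1 // => I _; apply: entry_inj => C.
  by rewrite entryZ entry_tensor !entry0 if_same mulr0.
have Fi : F *m forget_mx k X i = \sum_(w | W w) sign_tensor pr wd (word_coord v w) w.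
  rewrite mulmx_suml; apply: eq_bigr => w Ww; have /and3P[wok _ _] := Ww.
  by rewrite (forget_sign_tensor n_gt0 e1 rankedP reesX) //; have [_ ->] := gP w Ww.
have Fic : (F *m forget_mx k X i <= cycle_mx k \bot%O \top%O T A)%MS.
  have := cycle_mx_forget k rankedX \bot%O \top%O (setU11 i T) (_ : i \notin A).
  rewrite setU1K // => sub; apply: submx_trans (submxMr _ Fc) (sub _).
  by apply: contra iT; exact: (subsetP sAT).
rewrite -(subrK (F *m forget_mx k X i) v).
apply: addmx_sub; last exact: submxMr.
apply: IHm => [|C w v'C wok wT wC].
  by apply: addmx_sub => //; rewrite eqmx_opp.
have /cycle_mxP[vT _] := vc.
have cT w' : W w' -> forall c, entry (word_coord v w') c != 0 -> typed_chain \bot%O \top%O T c.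
  move=> Ww' c; have /and3P[w'ok _ _] := Ww'.
  rewrite vecE; case: ifP => [ic /vT|]; last by rewrite eqxx.
  by rewrite (typed_lift_chain n_gt0 e1 rankedP reesX).
have tC : typed_chain \bot%O \top%O T C.
  have [vC|/vT//] := eqVneq (entry v C) 0.
  move: v'C; rewrite entryB vC sub0r oppr_eq0 Fi entry_sum => neq0.
  have [w' Ww' tw'] : exists2 w', W w' & entry (sign_tensor pr wd (word_coord v w') w') C != 0.
    apply/exists_inP; apply: contraNT neq0 => /exists_inPn wN.
    by rewrite big1 // => w' /wN/negPn/eqP.
  have /and3P[w'ok _ _] := Ww'.
  by have [] := sign_tensor_supp w'ok (cT w' Ww') tw'.
(* Here weight w <= weight (swap I w') <= weight w' = m, so m <= weight w forces equality
   throughout. *)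
have term0 w' (I : {set 'I_n.+2}) : W w' -> I \subset descents w' ->
    carries pr wd (swap I w') C -> (m <= weight w)%N ->
    [/\ weight w = m, w' = w & I = set0].
  move=> /and3P[w'ok w'T /eqP w'm] sI swC le_mw.
  have := weight_min wok (swap_ok w'ok sI) wT (carries_pref n_gt0 e1 rankedP reesX tC wC swC).
  case=> le1 eq1; have [le2 eq2] := weight_swap w'ok sI.
  have sm : weight (swap I w') = m by apply/eqP; rewrite eqn_leq -{1}w'm le2 (leq_trans le_mw).
  have I0 : I = set0 by apply/eqP; rewrite -eq2 sm w'm.
  have wE : w = swap I w' by apply: eq1; rewrite sm.
  by split=> //; [rewrite wE|rewrite wE I0 (swap0 w'ok)].
rewrite ltnNge; apply/negP => le_mw.
move: v'C; rewrite entryB Fi entry_sum.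
have [wm|w_neq] := eqVneq (weight w) m; last first.
  rewrite big1 => [|w' Ww'].
    rewrite subr0 => vC; have := vm C w vC wok wT wC.
    by rewrite ltnS leq_eqVlt (negbTE w_neq) ltnNge le_mw.
  apply/eqP/negPn/negP; have /and3P[w'ok _ _] := Ww'.
  case/(sign_tensor_supp w'ok (cT w' Ww')) => _ [I sI sC].
  by have [wm _ _] := term0 w' I Ww' sI sC le_mw; rewrite wm eqxx in w_neq.
(* In weight m only the term of [w] with I = set0 is left, and it cancels the entry of [v] at C. *)
have Ww : W w by rewrite /= wok wT wm eqxx.
rewrite (bigD1 w) //= big1 => [|w' /andP[Ww' ww']]; last first.
  apply/eqP/negPn/negP; have /and3P[w'ok _ _] := Ww'.
  case/(sign_tensor_supp w'ok (cT w' Ww')) => _ [I sI sC].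
  by have [_ eqw _] := term0 w' I Ww' sI sC le_mw; rewrite eqw eqxx in ww'.
rewrite addr0 entry_sum (bigD1 set0) ?sub0set //= big1 => [|I /andP[sI I0]]; last first.
  rewrite entryZ entry_tensor; case: ifP => [/andP[_ sC]|]; last by rewrite mulr0.
  by have [_ _ eI] := term0 w I Ww sI sC le_mw; rewrite eI eqxx in I0.
have iC := typed_inner tC.
rewrite addr0 cards0 expr0 scale1r (swap0 wok) entry_tensor iC wC vecE.
rewrite (inner_pr_set reesX iC) -(carries_lift_chain reesX iC wC) subrr eqxx.
by [].
Qed.

End ReesLifting.

Section ReesAlpha.
Variables (k : fieldType) (G : finGroupType) (n t e : nat) (dP dX : Order.disp_t).
Variables (P : finTBPOrderType dP) (X : finTBPOrderType dX).
Variables (toP : poset_action G P) (toX : poset_action G X).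
Variables (pr : X -> P) (wd : X -> seq 'I_t).
Hypotheses (n_gt0 : (0 < n)%N) (e1 : (e <= 1)%N) (rankedP : ranked n P).
Hypothesis reesX : rees_over e pr wd.
Hypotheses (pr_act : forall u g, pr (toX u g) = toP (pr u) g).
Hypotheses (wd_act : forall u g, wd (toX u g) = wd u).
Local Notation wordT := {ffun 'I_n.+2 -> option 'I_t}.
Implicit Types (u : X) (p z : P) (w : wordT) (c : {set P}) (C D : {set X}).
Implicit Types (T A I : {set 'I_n.+2}).

Let rankedX : ranked n X := rees_ranked n_gt0 e1 rankedP reesX.

Lemma carries_act g w C :
  carries pr wd w ((toX^*)%act C g) = carries pr wd w C.
Proof.
apply/carriesP/carriesP => wC u.
  move=> Cu; have := wC (toX u g); rewrite mem_pact => /(_ Cu).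
  by rewrite wd_act pr_act pact_rank.
by case/imsetP=> v Cv ->; rewrite wd_act pr_act pact_rank wC.
Qed.

Definition carried T (ws : seq wordT) C :=
  typed_chain \bot%O \top%O T C && has (fun w => carries pr wd w C) ws.

Lemma carried_act T ws g C : carried T ws ((toX^*)%act C g) = carried T ws C.
Proof.
rewrite /carried pact_typed_chain; congr (_ && _).
by apply: eq_has => w; exact: carries_act.
Qed.

(** Each of the two words has least weight among the words agreeing with it at the ranks in T, so
    they coincide. *)
Lemma carries_unique T w w' C : typed_chain \bot%O \top%O T C ->
    word_ok e w -> word_ok e w' -> descents w \subset T -> descents w' \subset T ->
  carries pr wd w C -> carries pr wd w' C -> w = w'.
Proof.
move=> tC ok ok' wT w'T wC w'C.
have ww' := carries_pref n_gt0 e1 rankedP reesX tC wC w'C.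
have w'w := carries_pref n_gt0 e1 rankedP reesX tC w'C wC.
by have [_ ->] := weight_min ok ok' wT ww'; [|have [] := weight_min ok' ok w'T w'w].
Qed.

(** One word is split off at a time: restriction to the chains it carries has as kernel the span of
    the chains of the other words. Projection identifies the chains of one word with those of
    [P]. *)
Lemma carried_class T ws
    (modP : mxmodule (chain_repr toP k) (supp_mx k (typed_chain \bot%O \top%O T)))
    (modX : mxmodule (chain_repr toX k) (supp_mx k (carried T ws))) :
    T \subset proper_ranks n -> uniq ws ->
    (forall w, w \in ws -> word_ok e w && (descents w \subset T)) ->
  submodule_class modX = submodule_class modP *+ size ws.
Proof.
move=> sT; elim: ws modX => [|w ws IHws] modX.
  move=> _ _; rewrite submodule_class0 //.
  apply/matrixP=> i j; rewrite /supp_mx !mxE /carried /= andbF mul0rn //.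
move=> /= /andP[w_ws uniq_ws] wsP.
have /andP[wok wT] := wsP w (mem_head _ _).
have modX' : mxmodule (chain_repr toX k) (supp_mx k (carried T ws)).
  by apply: supp_mx_module => g C; exact: carried_act.
have modw : mxmodule (chain_repr toX k) (supp_mx k (carried T [:: w])).
  by apply: supp_mx_module => g C; exact: carried_act.
have notboth C : carried T ws C -> ~~ carries pr wd w C.
  case/andP=> tC /hasP[w' ws' w'C]; apply: contra w_ws => wC.
  have /andP[w'ok w'T] : word_ok e w' && (descents w' \subset T).
    by apply: wsP; rewrite inE ws' orbT.
  by rewrite (carries_unique tC wok w'ok wT w'T wC w'C).
rewrite (submodule_class_exact (f := supp_mx k (carried T [:: w])) modX modX' modw).
- rewrite IHws // => [|w' w'ws]; last by apply: wsP; rewrite inE w'ws orbT.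
  rewrite mulrSr; congr (_ + _).
  apply: (push_submodule_class (h := fun C : {set X} => pr @: C)).
  + move=> C D /andP[tC]; rewrite /= orbF => wC /andP[tD]; rewrite /= orbF => wD eCD.
    rewrite (carries_lift_chain reesX (typed_inner tC) wC).
    by rewrite (carries_lift_chain reesX (typed_inner tD) wD) eCD.
  + move=> C /andP[tC]; rewrite /= orbF => wC.
    by rewrite (typed_chain_pr n_gt0 e1 rankedP reesX _ (typed_inner tC) wC).
  + move=> c tc; have ic := typed_inner tc.
    exists (lift_chain pr wd c w); last exact: (pr_lift_chain (e := e) e1 rankedP reesX).
    rewrite /carried (typed_lift_chain n_gt0 e1 rankedP reesX) // tc /= orbF.
    exact: lift_chain_carries.
  move=> C g; rewrite /= /setact -!imset_comp; apply: eq_imset => u /=.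
  exact: pr_act.
- move=> g; apply: perm_supp_mx_comm => C; exact: carried_act.
- apply/eqmxP/rV_eqP => v; rewrite sub_capmx; apply/sub_supp_mxP/andP => [vS|[/sub_supp_mxP vS /sub_kermxP v0] C vC].
    split; first by apply/sub_supp_mxP => C /vS/andP[tC wC]; rewrite /carried tC /= wC orbT.
    apply/sub_kermxP/entry_inj => C; rewrite entry_supp entry0.
    have [->|/vS cC] := eqVneq (entry v C) 0; first by rewrite mulr0.
    by rewrite /carried /= orbF (negbTE (notboth C cC)) andbF mul0r.
  have /andP[tC] := vS C vC; rewrite /carried tC /= => /orP[wC|//].
  have := congr1 (fun x => entry x C) v0.
  by rewrite entry_supp entry0 /carried tC /= wC mul1r => /eqP; rewrite (negbTE vC).
apply/eqmxP/rV_eqP => v; apply/sub_supp_mxP/submxP => [vS|[B ->] C].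
  exists v; rewrite mulmxA; apply: entry_inj => C; rewrite !entry_supp.
  have [->|/vS cC] := eqVneq (entry v C) 0; first by rewrite !mulr0.
  rewrite cC; case/andP: cC => tC; rewrite /= orbF => wC.
  by rewrite /carried tC /= wC !mul1r.
rewrite mulmxA entry_supp mulf_eq0 negb_or => /andP[+ _].
by case: (carried _ _ _); rewrite // eqxx.
Qed.

Lemma rees_alpha T : T \subset proper_ranks n ->
  alpha k toX (fset_of T) =
  alpha k toP (fset_of T) *+ #|[set w : {w : wordT | word_ok e w} | descents (val w) \subset T]|.
Proof.
move=> sT; rewrite -(cycle_class0 k toX rankedX sT) -(cycle_class0 k toP rankedP sT).
set W := [set w | _]; pose ws : seq wordT := map val (enum W).
have modP : mxmodule (chain_repr toP k) (supp_mx k (typed_chain \bot%O \top%O T)).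
  by apply: supp_mx_module => g C; exact: pact_typed_chain.
have modX : mxmodule (chain_repr toX k) (supp_mx k (carried T ws)).
  by apply: supp_mx_module => g C; exact: carried_act.
have cls d (Q : finTBPOrderType d) (to : poset_action G Q) (rQ : ranked n Q)
    (mod : mxmodule (chain_repr to k) (supp_mx k (typed_chain \bot%O \top%O T))) :
    cycle_class k to T set0 = submodule_class mod.
  apply: submodule_class_eqmx; apply/eqmxP/rV_eqP=> u.
  by apply/cycle_mxP/sub_supp_mxP => [[]//|uT]; split=> // l; rewrite inE.
rewrite (cls _ _ _ rankedP modP).
have -> : #|W| = size ws by rewrite size_map cardE.
rewrite -(carried_class modP modX) //; last first.
- by move=> w /mapP[w' + ->]; rewrite mem_enum inE => ->; rewrite (valP w').
- by rewrite map_inj_uniq ?enum_uniq //; exact: val_inj.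
apply: submodule_class_eqmx; apply/eqmxP/rV_eqP=> u.
apply/cycle_mxP/sub_supp_mxP => [[uT _] C uC|uT]; last first.
  by split=> [C /uT/andP[]//|l]; rewrite inE.
have tC := uT C uC; rewrite /carried tC.
have [w [wok wT wC]] := exists_carrier n_gt0 e1 rankedP reesX sT tC.
apply/hasP; exists w => //; apply/mapP; exists (exist _ w wok) => //.
by rewrite mem_enum inE.
Qed.

Lemma rees_beta :
  beta k toX (fset_of (proper_ranks n)) =
  \sum_(S : {set 'I_n.+2} | S \subset proper_ranks n)
    beta k toP (fset_of (proper_ranks n :\: S))
      *+ #|[set w : {w : wordT | word_ok e w} | S \subset descents (val w)]|.
Proof.
rewrite beta_mobius; under [RHS]eq_bigr do rewrite beta_mobius.
rewrite -(mobius_mulrn_card (D := fun w : {w : wordT | word_ok e w} => descents (val w))).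
  by apply: eq_bigr => T sT; rewrite rees_alpha.
by move=> [w wok]; exact: (descents_proper wok).
Qed.

End ReesAlpha.

(** * Counting words with prescribed descents *)

Section CountWords.
Variables (t n e : nat).
Hypotheses (n_gt0 : (0 < n)%N) (e1 : (e <= 1)%N).
Local Notation wordT := {ffun 'I_n.+2 -> option 'I_t}.
Implicit Types (w : wordT) (S : {set 'I_n.+2}) (i j : 'I_n.+2).

Definition sparse S :=
  [forall i in S, forall j in S, j != i.+1 :> nat].

Definition words_descending S :=
  [set w : {w : wordT | word_ok e w} | S \subset descents (val w)].

Lemma sparseP S : reflect {in S &, forall i j, j <> i.+1 :> nat} (sparse S).
Proof.
apply: (iffP 'forall_implyP) => [h i j Si Sj|h i Si].
  by have /'forall_implyP/(_ j Sj)/eqP := h i Si.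
by apply/'forall_implyP => j Sj; apply/eqP/h.
Qed.

Lemma words_descending_eq0 S :
  ~~ (sparse S && [forall i in S, (e < i < n.+1)%N]) -> #|words_descending S| = 0%N.
Proof.
move=> NS; apply/eqP; rewrite cards_eq0; apply: contraNT NS => /set0Pn[[w wok]].
rewrite inE /= => /subsetP sS; have [w0 wn we] := word_okP _ _ wok.
have SP i : i \in S -> [/\ (i < n.+1)%N, letter w i != None & letter w i.+1 = None].
  by move/sS; rewrite inE => /and3P[-> -> /eqP->].
apply/andP; split.
  by apply/sparseP => i j /SP[_ _ wi] /SP[_ + _] ji; rewrite ji wi.
apply/'forall_implyP => i /SP[-> wi _]; rewrite andbT ltnNge; apply/negP => le_ie.
by case/eqP: wi; apply: we => //; exact: (ltn_ord i).
Qed.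

(** Position n + 1 is left out because it is counted in [fixed_set]. *)
Definition succ_set S : {set 'I_n.+2} := [set i : 'I_n.+2 | [exists j in S, (j.+1 == i) && (i < n.+1)%N]].
Definition fixed_set : {set 'I_n.+2} := [set i : 'I_n.+2 | (i <= e)%N || (i == n.+1 :> nat)].

Lemma card_fixed_set : #|fixed_set| = e.+2.
Proof.
have -> : fixed_set = (inord n.+1 : 'I_n.+2) |: [set i : 'I_n.+2 | (i <= e)%N].
  by apply/setP=> i; rewrite !inE orbC -val_eqE /= inordK.
rewrite cardsU1 inE inordK // -ltnNge (leq_ltn_trans e1) //= add1n; congr S.
have <- : #|[set: 'I_e.+1]| = e.+1 by rewrite cardsT card_ord.
have le_en : (e.+1 <= n.+2)%N by lia.
have inj_w : injective (widen_ord le_en) by move=> i j /(congr1 val) /= ij; exact: val_inj.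
rewrite -(card_imset _ inj_w).
apply: eq_card => i; rewrite inE; apply/idP/imsetP => [le_ie|[j _ ->]].
  by exists (Ordinal (le_ie : (i < e.+1)%N)) => //; exact: val_inj.
exact: (ltn_ord j).
Qed.

Lemma card_succ_set S : [forall i in S, (e < i < n.+1)%N] ->
  #|succ_set S| = #|S :\ inord n|.
Proof.
move=> /'forall_implyP SP.
have lt_S i : i \in S :\ inord n -> (i < n)%N.
  rewrite !inE -val_eqE /= inordK // => /andP[neq /SP/andP[_]]; move: neq; rewrite ltnS ltn_neqAle => -> //.
have -> : succ_set S = (fun i : 'I_n.+2 => inord i.+1 : 'I_n.+2) @: (S :\ inord n).
  apply/setP=> i; rewrite inE; apply/exists_inP/imsetP => [[j Sj /andP[/eqP ji lt_i]]|[j Sj ->]].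
    exists j; last by apply: val_inj; rewrite /= ji inordK.
    by rewrite !inE Sj andbT -val_eqE /= inordK //; move: lt_i; rewrite -ji; lia.
  exists j; first by case/setD1P: Sj.
  by have := lt_S j Sj => lt_j; rewrite inordK ?eqxx /=; lia.
rewrite card_in_imset // => i j /lt_S lt_i /lt_S lt_j /(congr1 val) /=.
by rewrite !inordK; [case=> ij; exact: val_inj|lia|lia].
Qed.

(** The letters are independent: t choices at S, a stay right after S and at the e + 2 fixed
    positions, 1 + t choices elsewhere. The exponent has [S :\ inord n] because the stay after n is
    the padding. *)
Lemma card_words_descending S : sparse S -> [forall i in S, (e < i < n.+1)%N] ->
  #|words_descending S| = (t ^ #|S| * (1 + t) ^ (n - e - #|S| - #|S :\ inord n|))%N.
Proof.
move=> spS SP; have /'forall_implyP SPi := SP.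
pose F (i : 'I_n.+2) : pred (option 'I_t) :=
  if i \in S then [pred x | x != None]
  else if i \in succ_set S :|: fixed_set then pred1 None else predT.
have -> : #|words_descending S| = #|family F|.
  rewrite -(card_imset _ val_inj); apply: eq_card => w; apply/imsetP/familyP => [[[w' ok]]|wF].
    rewrite inE /= => /subsetP sS -> i; have [w0 wn we] := word_okP _ _ ok.
    have SD j : j \in S -> [/\ (j < n.+1)%N, letter w' j != None & letter w' j.+1 = None].
      by move/sS; rewrite inE => /and3P[-> -> /eqP->].
    rewrite /F; case: ifP => [/SD[_ + _]|_]; first by rewrite /letter inord_val inE.
    case: ifP => // iF; rewrite inE -[i]inord_val -/(letter w' i).
    move: iF; rewrite !inE => /orP[/exists_inP[j /SD[_ _ wj] /andP[/eqP <- _]]|]; first by rewrite wj.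
    case/orP=> [le_ie|/eqP->]; last by rewrite wn.
    by rewrite we //; exact: (ltn_ord i).
  have wS i : i \in S -> w i != None by move=> Si; have := wF i; rewrite /F Si inE.
  have wN i : i \notin S -> i \in succ_set S :|: fixed_set -> w i = None.
    by move=> Si iN; have := wF i; rewrite /F (negbTE Si) iN inE => /eqP.
  have fixedS i : i \in fixed_set -> i \notin S.
    by rewrite inE => fi; apply/negP => /SPi; case/orP: fi => [|/eqP->]; lia.
  have ok : word_ok e w.
    apply/forallP => i; apply/implyP => fi; rewrite wN ?fixedS // ?inE ?fi ?orbT //.
  exists (exist _ w ok) => //; rewrite inE /=; apply/subsetP=> i Si.
  rewrite inE; have /andP[lt_ei lt_in] := SPi i Si.
  rewrite lt_in /letter inord_val wS //=; apply/eqP/wN.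
    apply/negP => Si1; have /sparseP/(_ i _ Si Si1) := spS; apply.
    by rewrite inordK.
  rewrite !inE inordK //; have [->|neq] := eqVneq i.+1 n.+1; first by rewrite !orbT.
  apply/orP; left; apply/exists_inP; exists i => //; rewrite eqxx /=; lia.
rewrite card_family foldrE big_map big_enum /=.
rewrite (bigID (fun i => i \in S)) /=; congr (_ * _)%N.
  rewrite (eq_bigr (fun=> t)) => [|i Si]; first by rewrite prod_nat_const.
  rewrite /F Si; have := cardC (pred1 (None : option 'I_t)).
  rewrite card1 card_option card_ord add1n => -[]; apply: etrans.
  by apply: eq_card => x; rewrite !inE.
rewrite (bigID (fun i => i \in succ_set S :|: fixed_set)) /= big1 ?mul1n; last first.
  by move=> i /andP[/negbTE Si iN]; rewrite /F Si iN card1.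
rewrite (eq_bigr (fun=> (1 + t)%N)) => [|i /andP[/negbTE Si /negbTE iN]]; last first.
  by rewrite /F Si iN card_option card_ord add1n.
rewrite prod_nat_const; congr (_ ^ _)%N.
transitivity #|~: (S :|: (succ_set S :|: fixed_set))|.
  by apply: eq_card => i; rewrite in_setC [in RHS]in_setU negb_or.
have dj1 : succ_set S :&: fixed_set = set0.
  apply/setP=> i; rewrite !inE; apply/negP => /andP[/exists_inP[j /SPi /andP[lt_ej _] /andP[/eqP ji lt_i]]].
  by case/orP => [|/eqP]; lia.
have dj2 : S :&: (succ_set S :|: fixed_set) = set0.
  apply/setP=> i; rewrite in_setI !inE; apply/negP => /andP[Si].
  have /andP[lt_ei lt_in] := SPi i Si.
  case/orP=> [/exists_inP[j Sj /andP[/eqP ji _]]|/orP[|/eqP]]; [|lia|lia].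
  by have /sparseP/(_ j i Sj Si) := spS; apply.
have := cardsC (S :|: (succ_set S :|: fixed_set)).
rewrite cardsU dj2 cardsU dj1 !cards0 card_fixed_set card_succ_set // card_ord.
by move: #|S :\ inord n| #|S| #|~: _| => a b c; lia.
Qed.

End CountWords.

Lemma in_int_range a b i : (i \in int_range a b) = (a <= i <= b)%N.
Proof. by rewrite !inE mem_iota; lia. Qed.

Section StableSums.
Variable n : nat.
Implicit Types (S : {set 'I_n.+2}) (i j : 'I_n.+2).

Lemma fset_of_Stab S a b :
  (fset_of S \in Stab (int_range a b)) = sparse S && [forall i in S, (a <= i <= b)%N].
Proof.
rewrite !inE fpowersetE andbC; congr (_ && _).
  apply/forallP/sparseP => [h i j Si Sj ji|h [i /= iS]].
    have iS : (i : nat) \in fset_of S by rewrite in_fset_of.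
    by have := h [` iS]%fset; rewrite /= -ji in_fset_of Sj.
  have /imfsetP[i' /= Si' ei] := iS; apply/negP => /imfsetP[j /= Sj ej].
  by apply: (h i' j Si' Sj); rewrite -ej ei.
apply/fsubsetP/'forall_implyP => [h i Si|h i /imfsetP[j /= Sj ->]].
  by rewrite -in_int_range; apply: h; rewrite in_fset_of.
by rewrite in_int_range; exact: h.
Qed.

Lemma fset_of_proper_ranks : fset_of (proper_ranks n) = int_range 1 n.
Proof.
apply/fsetP=> i; rewrite in_int_range; apply/imfsetP/idP => [[j /= + ->]|ri].
  by rewrite inE ltnS.
have lt_i : (i < n.+2)%N by lia.
by exists (Ordinal lt_i); rewrite // inE /= ltnS.
Qed.

Lemma fset_of_proper_ranksD1 : (0 < n)%N ->
  fset_of (proper_ranks n :\ inord n) = int_range 1 (n - 1).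
Proof.
move=> n_gt0; apply/fsetP=> i; rewrite in_int_range; apply/imfsetP/idP => [[j /= + ->]|ri].
  by rewrite !inE -val_eqE /= inordK //; lia.
have lt_i : (i < n.+2)%N by lia.
by exists (Ordinal lt_i); rewrite // !inE -val_eqE /= inordK //; lia.
Qed.

(** The two sums run over the sets S without n and with n. In the second, sparsity excludes n - 1,
    and splitting n off S accounts for the extra factor t and for the complement in [n - 1]. For n
    <= e, that is n = e = 1, rank n cannot be a descent: this is the degenerate case of the second
    formula. *)
Lemma sum_words_descending (t e : nat) (V : zmodType) (f : {fset nat} -> V) :
    (0 < n)%N -> (e <= 1)%N ->
  \sum_(S : {set 'I_n.+2} | S \subset proper_ranks n)
    f (fset_of (proper_ranks n :\: S)) *+ #|words_descending t e S| =
  \sum_(S <- Stab (int_range e.+1 (n - 1)))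
    f (int_range 1 n `\` S)%fset *+ (t ^ #|` S| * (1 + t) ^ (n - e - 2 * #|` S|))%N
  + (if (n <= e)%N then 0 else
     \sum_(S <- Stab (int_range e.+1 (n - 2)))
       f (int_range 1 (n - 1) `\` S)%fset
         *+ (t ^ (#|` S| + 1) * (1 + t) ^ (n - e.+1 - 2 * #|` S|))%N).
Proof.
move=> n_gt0 e1; have Stab_lt a b (S : {fset nat}) (i : nat) :
    (b < n.+2)%N -> S \in Stab (int_range a b) -> i \in S -> (i < n.+2)%N.
  move=> lt_b; rewrite !inE fpowersetE => /andP[/fsubsetP sS _] /sS.
  by rewrite in_int_range => /andP[_ /leq_ltn_trans]; apply.
rewrite !(@sum_fset_of n.+2); last 2 first.
- by move=> S i; apply: Stab_lt; lia.
- by move=> S i; apply: Stab_lt; lia.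
pose nn : 'I_n.+2 := inord n; have nnE : nn = n :> nat by rewrite /nn inordK.
have good S : [forall i in S, (e < i < n.+1)%N] -> S \subset proper_ranks n.
  by move=> /'forall_implyP h; apply/subsetP=> i /h; rewrite inE; lia.
rewrite (bigID (fun S => nn \notin S)) /=; congr (_ + _).
  rewrite big_mkcond [RHS]big_mkcond; apply: eq_bigr => S _.
  rewrite fset_of_Stab; case: (boolP (sparse S && _)) => [/andP[spS /'forall_implyP SP]|NS].
    have SP' : [forall i in S, (e < i < n.+1)%N] by apply/'forall_implyP => i /SP; lia.
    have nS : nn \notin S by apply/negP => /SP; rewrite nnE; lia.
    rewrite good // nS card_words_descending // fset_ofD fset_of_proper_ranks card_fset_of.
    rewrite (_ : S :\ inord n = S); last first.
      by apply/setP=> i; rewrite !inE; case: eqP => // ->; rewrite -/nn (negbTE nS).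
    by congr (_ *+ (_ * _ ^ _)%N); lia.
  case: ifP => // /andP[sS nS]; rewrite words_descending_eq0 ?mulr0n //.
  apply: contra NS => /andP[-> /'forall_implyP SP]; apply/'forall_implyP => i Si.
  have := SP i Si; have : i != nn by apply: contraNneq nS => <-.
  by rewrite -val_eqE /= nnE; lia.
have [le_ne|lt_en] := leqP n e.
  rewrite big1 // => S /andP[sS /negPn nS]; rewrite words_descending_eq0 //.
  apply/negP => /andP[_ /'forall_implyP/(_ nn nS)]; rewrite nnE; lia.
rewrite (reindex_onto (fun S => nn |: S) (fun S => S :\ nn)) /=; last first.
  by move=> S /andP[_ /negPn nS]; rewrite setD1K.
rewrite big_mkcond [RHS]big_mkcond; apply: eq_bigr => S _.
rewrite negbK setU11 andbT fset_of_Stab.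
case: (boolP (sparse S && _)) => [/andP[/sparseP spS /'forall_implyP SP]|NS].
  have nS : nn \notin S by apply/negP => /SP; rewrite nnE; lia.
  have SP' : [forall i in nn |: S, (e < i < n.+1)%N].
    by apply/'forall_implyP => i /setU1P[->|/SP]; rewrite ?nnE; lia.
  have spS' : sparse (nn |: S).
    apply/sparseP => i j /setU1P[->|Si] /setU1P[->|Sj]; rewrite ?nnE.
    - lia.
    - by have := SP j Sj; lia.
    - by have := SP i Si; lia.
    exact: spS.
  rewrite good // setU1K // eqxx /= card_words_descending // setU1K //.
  rewrite cardsU1 nS card_fset_of -setDDl fset_ofD fset_of_proper_ranksD1 //.
  by congr (_ *+ (_ ^ _ * _ ^ _)%N); [rewrite addn1|lia].
case: ifP => // /andP[sS /eqP nSK]; have nS : nn \notin S by rewrite -nSK setD11.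
rewrite words_descending_eq0 ?mulr0n //; apply: contra NS => /andP[/sparseP sp /'forall_implyP SP].
apply/andP; split; first by apply/sparseP => i j Si Sj; apply: sp; rewrite setU1r.
apply/'forall_implyP => i Si; have := SP i (setU1r _ Si).
have := sp i nn (setU1r _ Si) (setU11 _ _); rewrite nnE.
have : i != nn by apply: contraNneq nS => <-.
by rewrite -val_eqE /= nnE; lia.
Qed.

End StableSums.

(** * Homology and the two Rees products *)

Section AdjoinedHomology.
Variables (k : fieldType) (G : finGroupType) (n : nat) (d : Order.disp_t).
Variables (Y : finPOrderType d) (to : poset_action G Y).
Local Notation X := (adjoined Y).
Hypothesis rankedX : ranked n X.
Local Notation R := (proper_ranks n).
Implicit Types (C : {set Y}) (D : {set X}) (l : 'I_n.+2).

Lemma inner_adjoined (u : X) : inner u <-> exists y, In y = u.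
Proof.
by case: u => [|y|]; split=> [|[z]] //; exists y.
Qed.

Lemma In_mono : {mono (@In Y : Y -> X) : x y / (x <= y)%O}.
Proof. by []. Qed.

Lemma card_proper_ranks : #|R| = n.
Proof.
have -> : R = ~: [set ord0; ord_max].
  by apply/setP=> i; rewrite !inE -!val_eqE /=; have := ltn_ord i; lia.
have := cardsC [set ord0; ord_max : 'I_n.+2]; rewrite cards2 card_ord.
by rewrite -val_eqE /= add2n => -[].
Qed.

Lemma typed_adjoined_chain C :
  typed_chain \bot%O \top%O R (@In Y @: C : {set X}) = is_simplex n C.
Proof.
rewrite /typed_chain /is_simplex (embedding_chain In_mono).
case: (boolP (chain C)) => //= cC.
have sC : @In Y @: C \subset [set u : X | inner u].
  by apply/subsetP=> _ /imsetP[y _ ->]; rewrite inE; apply/inner_adjoined; exists y.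
rewrite [@In Y @: C \subset _]sC /=.
have cI : chain (@In Y @: C : {set X}) by rewrite (embedding_chain In_mono).
have sR : (@rk n _ X) @: (@In Y @: C) \subset R.
  apply/subsetP=> _ /imsetP[u /(subsetP sC) + ->].
  by rewrite !inE (rkE rankedX) (inner_rank rankedX).
rewrite eqEcard sR card_proper_ranks (chain_card_rk rankedX cI) /=.
rewrite card_imset; last exact: (embedding_inj In_mono).
apply/idP/eqP => [le_n|-> //]; apply/eqP; rewrite eqn_leq le_n andbT.
have := subset_leq_card sR.
rewrite card_proper_ranks (chain_card_rk rankedX cI) card_imset //.
exact: (embedding_inj In_mono).
Qed.

Lemma no_long_chain C : chain C -> (#|C| <= n)%N.
Proof.
move=> cC; have cI : chain (@In Y @: C : {set X}) by rewrite (embedding_chain In_mono).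
rewrite -(card_imset _ (embedding_inj In_mono)) -(chain_card_rk rankedX cI).
rewrite -[X in (_ <= X)%N]card_proper_ranks; apply/subset_leq_card/subsetP => _ /imsetP[u /imsetP[y _ ->] ->].
by rewrite !inE (rkE rankedX) -(inner_rank rankedX); apply/inner_adjoined; exists y.
Qed.

Lemma top_boundaries0 : boundaries Y k n = 0.
Proof.
rewrite /boundaries (_ : chain_mx Y k n.+1 = 0) ?mul0mx //.
apply/matrixP=> i j; rewrite !mxE (_ : is_simplex n.+1 _ = false) ?mul0rn //.
apply/negbTE/negP => /andP[/no_long_chain le_n /eqP eq_n].
by rewrite eq_n ltnn in le_n.
Qed.

Lemma homology_submodule m : boundaries Y k m = 0 ->
  homology to k m = submodule_class (cycles_module to k m).
Proof.
move=> b0; symmetry; apply: (submodule_class_iso (f := in_factmod (boundaries Y k m) 1%:M)).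
- move=> g; rewrite -in_factmodE -[_ g in RHS]/(factmod_mx (boundaries_module to k m) g).
  by rewrite -in_factmodJ ?inE ?mul1mx.
- apply/eqP/rowV0P => u; rewrite sub_capmx => /andP[_ /sub_kermxP].
  rewrite -in_factmodE => /eqP; rewrite in_factmod_eq0 b0 submx0; exact: eqP.
by rewrite -in_factmodE; exact: genmxE.
Qed.

(** A chain with one rank missing shows which rank was forgotten, so a single term of the boundary
    contributes at D. *)
Lemma signed_forget_top (v : 'rV[k]_#|{set X}|) (l : 'I_n.+2) D :
    typed_supp \bot%O \top%O (fun T => T == R) v ->
    entry (v *m signed_forget k X l) D != 0 ->
  entry (v *m boundary_mx X k) D = entry (v *m signed_forget k X l) D /\ l \in R.
Proof.
move=> vR vl; have [z [_ _ lD /eqP lR _]] := forget_not_in rankedX vR vl.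
split; last by rewrite -lR setU11.
rewrite (boundary_signed rankedX); last exact: (typed_supp_chainly vR).
rewrite entry_sum (bigD1 l) //= big1 ?addr0 // => l' l'l.
apply/eqP/negPn/negP => /(forget_not_in rankedX vR)[z' [_ _ _ /eqP l'R _]].
have : l \in l' |: [set rk n x | x in D] by rewrite l'R -lR setU11.
by rewrite in_setU1 (negbTE lD) orbF eq_sym (negbTE l'l).
Qed.

(** There are no boundaries in the top degree n - 1, which has index n. The terms of the boundary of
    a vector on full chains have disjoint supports, so it is a cycle exactly when every forgetful
    map kills it. *)
Lemma homology_cycle_class :
  homology to k n = cycle_class k (act_adjoined to) R R.
Proof.
rewrite homology_submodule ?top_boundaries0 //.
pose h C : {set X} := @In Y @: C.
have h_inj : injective h by exact: (embedding_set_inj In_mono).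
have bdh := embedding_boundary k In_mono inner_adjoined.
apply: (submodule_class_iso (f := push_mx k h)).
- move=> g; apply: push_mx_comm => C; rewrite /h /= /setact -!imset_comp.
  by apply: eq_imset.
- apply/eqP/rowV0P => u; rewrite sub_capmx => /andP[_ /sub_kermxP].
  exact: (push_embedding_inj In_mono).
apply/eqmxP/rV_eqP => v; apply/cycle_mxP/submxP => [[vT vA]|[w ->]].
  have vR : typed_supp \bot%O \top%O (fun T => T == R) v.
    by move=> D /vT/and3P[cD sD eD]; rewrite /interval_chain cD sD.
  pose v' := vec (fun C => entry v (h C)).
  have v'h : v' *m push_mx k h = v.
    apply: entry_inj => D; have [sD|NsD] := boolP (D \subset [set u : X | inner u]).
      have [C <-] := embedding_preim inner_adjoined sD.
      by rewrite -/(h C) entry_push_inj ?vecE.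
    rewrite entry_push_notin.
      by apply/esym/eqP; apply: contraNT NsD => /vT/typed_inner.
    move=> C; apply: contraNneq NsD => <-; apply/subsetP=> _ /imsetP[y _ ->].
    by rewrite inE; apply/inner_adjoined; exists y.
  have : (v' <= cycles Y k n)%MS.
    rewrite sub_capmx; apply/andP; split.
      by apply/sub_supp_mxP => C; rewrite vecE => /vT; rewrite typed_adjoined_chain.
    apply/sub_kermxP/(push_embedding_inj In_mono); rewrite -/h.
    rewrite -mulmxA bdh mulmxA v'h (boundary_signed rankedX); last exact: (typed_supp_chainly vR).
    rewrite big1 // => l _; apply: entry_inj => D; rewrite entry0; apply/eqP/negPn/negP => vl.
    have [_ lR] := signed_forget_top vR vl.
    have /eqP v0 : v *m signed_forget k X l == 0 by rewrite signed_forget_eq0 vA.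
    by rewrite v0 entry0 eqxx in vl.
  by case/submxP=> w v'w; exists w; rewrite mulmxA -v'w v'h.
rewrite mulmxA; have := submxMl w (cycles Y k n); move: (w *m _) => u.
rewrite sub_capmx => /andP[/sub_supp_mxP uP /sub_kermxP ub].
have uT D : entry (u *m push_mx k h) D != 0 -> typed_chain \bot%O \top%O R D.
  have [sD|NsD] := boolP (D \subset [set x : X | inner x]); last first.
    rewrite entry_push_notin ?eqxx // => C.
    apply: contraNneq NsD => <-; apply/subsetP=> _ /imsetP[y _ ->].
    by rewrite inE; apply/inner_adjoined; exists y.
  have [C <-] := embedding_preim inner_adjoined sD.
  by rewrite -/(h C) entry_push_inj // => /uP; rewrite typed_adjoined_chain.
split=> // l lR; apply/eqP; rewrite -signed_forget_eq0; apply/eqP.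
have vR : typed_supp \bot%O \top%O (fun T => T == R) (u *m push_mx k h).
  by move=> D /uT/and3P[cD sD eD]; rewrite /interval_chain cD sD.
apply: entry_inj => D; rewrite entry0; apply/eqP/negPn/negP => vl.
have [bd _] := signed_forget_top vR vl; move: vl; rewrite -bd.
by rewrite -mulmxA -bdh mulmxA ub mul0mx entry0 eqxx.
Qed.

End AdjoinedHomology.

Section SubposetRanks.
Variables (d : Order.disp_t) (P : finTBPOrderType d).

Lemma is_minE (p : P) : is_min p = (p == \bot%O).
Proof.
apply/forallP/eqP => [h|-> x]; last exact: le0x.
by apply/eqP; rewrite -lex0.
Qed.

Lemma is_maxE (p : P) : is_max p = (p == \top%O).
Proof.
apply/forallP/eqP => [h|-> x]; last exact: lex1.
by apply/eqP; rewrite -le1x.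
Qed.

Lemma rank_remove_max (x : remove_max P) : rank x = rank (val x).
Proof.
move: x; apply: (rank_unique (r := fun x : remove_max P => rank (val x))) => [x y lt_xy|x].
  exact: (rank_lt (lt_xy : val x < val y)%O).
case/rank_pred=> y lt_yx ry.
have yP : ~~ is_max y.
  by rewrite is_maxE -ltx1; apply: lt_le_trans lt_yx (lex1 _).
by exists (exist _ y yP).
Qed.

Lemma rank_remove_both (x : remove_both P) : rank x = (rank (val x)).-1.
Proof.
have r_gt0 (p : P) : ~~ is_min p -> (0 < rank p)%N.
  by rewrite is_minE -lt0x => /rank_lt; apply: leq_ltn_trans.
move: x; apply: (rank_unique (r := fun x : remove_both P => (rank (val x)).-1)) => [x y lt_xy|x r1].
  have := rank_lt (lt_xy : val x < val y)%O; have /andP[/r_gt0 + _] := valP x; lia.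
have [|y lt_yx ry] := @rank_pred _ _ (val x); first lia.
have yP : ~~ is_min y && ~~ is_max y.
  apply/andP; split; last by rewrite is_maxE -ltx1; apply: lt_le_trans lt_yx (lex1 _).
  by rewrite is_minE; apply: contraTneq r1 => y0; rewrite -ry y0 rank_bot.
by exists (exist _ y yP) => //=; rewrite ry.
Qed.

End SubposetRanks.

Lemma rank_tree t n (u : tree t n) : rank u = size u.
Proof.
move: u; apply: (rank_unique (r := fun u : tree t n => size u)) => [u v|u u_gt0].
  rewrite lt_neqAle => /andP[neq /prefixP[s sE]].
  rewrite sE size_cat; case: s sE => [|a s] sE; last by rewrite /= ; lia.
  by case/eqP: neq; apply: val_inj; rewrite /= sE cats0.
have szt : (size (take (size u).-1 u) <= n)%N.
  by rewrite size_takel ?leq_pred //; apply: leq_trans (leq_pred _) (valP u).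
pose v : tree t n := Bseq szt; exists v; last by rewrite /= size_takel ?leq_pred.
rewrite lt_neqAle; apply/andP; split; last exact: prefix_take.
apply/eqP => /(congr1 (fun w : tree t n => size w)) /=.
by rewrite size_takel ?leq_pred //; lia.
Qed.

Section ReesInstances.
Variables (n t : nat) (d : Order.disp_t) (P : finTBPOrderType d).
Hypothesis rankedP : ranked n P.

Definition proj_lower (u : adjoined (remove_min (rees (remove_max P) (tree t n)))) : P :=
  match u with Bot => \bot%O | In y => val (val (val y)).1 | Top => \top%O end.
Definition word_lower (u : adjoined (remove_min (rees (remove_max P) (tree t n)))) : seq 'I_t :=
  match u with In y => (val (val y)).2 : seq 'I_t | _ => [::] end.

Definition proj_proper (u : adjoined (rees (remove_both P) (tree t n.-1))) : P :=
  match u with Bot => \bot%O | In y => val (val y).1 | Top => \top%O end.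
Definition word_proper (u : adjoined (rees (remove_both P) (tree t n.-1))) : seq 'I_t :=
  match u with In y => (val y).2 : seq 'I_t | _ => [::] end.

Lemma inner_neq (p : P) : inner p = (p != \bot%O) && (p != \top%O).
Proof. by rewrite /inner lt0x ltx1. Qed.

(** Over the bottom of [P] the rank condition leaves only the root of the tree, and that pair lies
    below all others. *)
Lemma is_min_rees (u : rees (remove_max P) (tree t n)) :
  is_min u = (val (val u).1 == \bot%O).
Proof.
have bP : ~~ is_max (\bot%O : P).
  by rewrite is_maxE -ltx1; exact: ranked_bot_lt_top rankedP.
apply/forallP/eqP => [min_u|u0 v].
  have oP : (rank ([bseq] : tree t n) <= rank (exist _ \bot%O bP : remove_max P))%N.
    by rewrite rank_tree.
  have := min_u (exist _ (exist _ \bot%O bP : remove_max P, [bseq] : tree t n) oP).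
  rewrite /Order.le /= /rees_le /=; case: (val u) => p q /and3P[le_p _ _].
  by apply/eqP; rewrite -lex0.
rewrite [(_ <= _)%O](_ : _ = rees_le u v) // /rees_le.
move: (valP u) (valP v); case: (val u) (val v) u0 => [p q] [p' q'] /= p0.
have rp : rank p = 0%N by rewrite rank_remove_max (p0 : val p = _) rank_bot.
rewrite rp leqn0 !rank_tree => /nilP q0 le_q'; rewrite q0 addn0 addn0 le_q' andbT.
apply/andP; split; last by rewrite [(_ <= _)%O](_ : _ = prefix q q') // q0 prefix0s.
by rewrite [(_ <= _)%O](_ : _ = (val p <= val p')%O) // (p0 : val p = _) le0x.
Qed.

Lemma rees_over_lower : rees_over 0 proj_lower word_lower.
Proof.
split.
- move=> [|y|] //= _; rewrite inner_neq.
  have := valP y; rewrite is_min_rees => -> /=.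
  by have := valP (val (val y)).1; rewrite is_maxE.
- move=> [|y|] //= _; have := valP (val y).
  by rewrite rank_tree rank_remove_max addn0.
- move=> [|y|] [|z|] //= _ _ ep ew; congr In; do 2!apply: val_inj.
  by rewrite [LHS]surjective_pairing [RHS]surjective_pairing (val_inj ep) (val_inj ew).
- move=> p s; rewrite inner_neq => /andP[p0 p1]; rewrite addn0 => le_s.
  have pP : ~~ is_max p by rewrite is_maxE.
  have szs : (size s <= n)%N.
    apply: leq_trans le_s _; rewrite -ltnS -rankedP.1 rank_lt // ltx1 //.
  have oP : (rank (Bseq szs : tree t n) <= rank (exist _ p pP : remove_max P))%N.
    by rewrite rank_tree rank_remove_max.
  pose u : rees (remove_max P) (tree t n) := exist _ (exist _ p pP : remove_max P, Bseq szs : tree t n) oP.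
  have uP : ~~ is_min u by rewrite is_min_rees.
  by exists (In (exist _ u uP)).
move=> [|y|] [|z|] // _ _; transitivity (rees_le (val y) (val z)) => //.
rewrite /rees_le; cbv beta iota delta [proj_lower word_lower].
case: (val (val y)) (val (val z)) => [p q] [p' q'].
by rewrite !rank_tree !rank_remove_max.
Qed.

Lemma rees_over_proper : (0 < n)%N -> rees_over 1 proj_proper word_proper.
Proof.
move=> n_gt0.
have r_gt0 (p : remove_both P) : (0 < rank (val p))%N.
  have /andP[+ _] := valP p; rewrite is_minE -lt0x => /rank_lt; exact: leq_ltn_trans.
split.
- move=> [|y|] //= _; rewrite inner_neq.
  by have := valP (val y).1; rewrite is_maxE is_minE.
- move=> [|y|] // _; cbv beta iota delta [proj_proper word_proper].
  have := valP y; have := r_gt0 (val y).1.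
  rewrite rank_tree rank_remove_both; case: (val y) => p q.
  by move: (rank (val p)) (size q) => a b; lia.
- move=> [|y|] [|z|] //= _ _ ep ew; congr In; apply: val_inj.
  by rewrite [LHS]surjective_pairing [RHS]surjective_pairing (val_inj ep) (val_inj ew).
- move=> p s; rewrite inner_neq => /andP[p0 p1] le_s.
  have pP : ~~ is_min p && ~~ is_max p by rewrite is_minE is_maxE p0.
  have lt_p : (rank p < n.+1)%N by rewrite -rankedP.1 rank_lt // ltx1.
  have szs : (size s <= n.-1)%N by lia.
  have oP : (rank (Bseq szs : tree t n.-1) <= rank (exist _ p pP : remove_both P))%N.
    by rewrite rank_tree rank_remove_both /=; lia.
  by exists (In (exist _ (exist _ p pP : remove_both P, Bseq szs : tree t n.-1) oP)).
move=> [|y|] [|z|] // _ _; transitivity (rees_le y z) => //.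
rewrite /rees_le; cbv beta iota delta [proj_proper word_proper].
case: (val y) (val z) => [p q] [p' q'].
rewrite !rank_tree !rank_remove_both; congr [&& _, _ & _].
move: (r_gt0 p) (r_gt0 p').
by move: (rank (val p)) (rank (val p')) (size q) (size q') => a b a' b'; lia.
Qed.

End ReesInstances.

Section ReesHomology.
Variables (k : fieldType) (G : finGroupType) (n t e : nat) (dP d : Order.disp_t).
Variables (P : finTBPOrderType dP) (toP : poset_action G P).
Variables (Y : finPOrderType d) (to : poset_action G Y).
Variables (pr : adjoined Y -> P) (wd : adjoined Y -> seq 'I_t).
Hypotheses (n_gt0 : (0 < n)%N) (e1 : (e <= 1)%N) (rankedP : ranked n P).
Hypothesis reesY : rees_over e pr wd.
Hypotheses (pr_act : forall u g, pr (act_adjoined to u g) = toP (pr u) g).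
Hypotheses (wd_act : forall u g, wd (act_adjoined to u g) = wd u).

Lemma beta_properE :
  beta_proper k to = beta k (act_adjoined to) (fset_of (proper_ranks n)).
Proof.
have rankedX := rees_ranked n_gt0 e1 rankedP reesY.
by rewrite /beta_proper rankedX.1 fset_of_proper_ranks.
Qed.

Lemma beta_proper_rees :
  beta_proper k to =
  \sum_(S <- Stab (int_range e.+1 (n - 1)))
    beta k toP (int_range 1 n `\` S)%fset *+ (t ^ #|` S| * (1 + t) ^ (n - e - 2 * #|` S|))%N
  + (if (n <= e)%N then 0 else
     \sum_(S <- Stab (int_range e.+1 (n - 2)))
       beta k toP (int_range 1 (n - 1) `\` S)%fset
         *+ (t ^ (#|` S| + 1) * (1 + t) ^ (n - e.+1 - 2 * #|` S|))%N).
Proof.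
rewrite beta_properE (rees_beta k n_gt0 e1 rankedP reesY pr_act wd_act).
by rewrite -(@sum_words_descending n t e _ _ n_gt0 e1).
Qed.

Lemma homology_rees : lifting k n (\bot%O : P) \top%O ->
  homology to k n = beta_proper k to.
Proof.
move=> liftP; have rankedX := rees_ranked n_gt0 e1 rankedP reesY.
rewrite beta_properE (beta_cycle_class _ rankedX) ?homology_cycle_class //.
exact: (rees_lifting n_gt0 e1 rankedP reesY liftP).
Qed.

End ReesHomology.

Theorem theorem1p1 (k : fieldType) (n : nat) (G : finGroupType)
    (d : Order.disp_t) (P : finTBPOrderType d) (to : poset_action G P)
    (n_gt0 : (0 < n)%N) (P_graded : graded P n.+1)
    (t : nat) (t_gt0 : (0 < t)%N) :
  let act1 := act_remove_min (act_rees (act_remove_max to) (tree t n)) in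
  let act2 := act_rees (act_remove_both to) (tree t n.-1) in
  let betaP (S : {fset nat}) := beta k to S in
  let rhs1 : K0 k G :=
    \sum_(S <- Stab (int_range 1 (n - 1)))
       betaP (int_range 1 n `\` S)%fset
         *+ (t ^ #|` S| * (1 + t) ^ (n - 2 * #|` S|))%N
    + \sum_(S <- Stab (int_range 1 (n - 2)))
       betaP (int_range 1 (n - 1) `\` S)%fset
         *+ (t ^ (#|` S| + 1) * (1 + t) ^ (n - 1 - 2 * #|` S|))%N in
  let rhs2 : K0 k G :=
    (if n == 1%N then 0 else
      \sum_(S <- Stab (int_range 2 (n - 2)))
        betaP (int_range 1 (n - 1) `\` S)%fset
          *+ (t ^ (#|` S| + 1) * (1 + t) ^ (n - 2 - 2 * #|` S|))%N)
    + \sum_(S <- Stab (int_range 2 (n - 1)))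
       betaP (int_range 1 n `\` S)%fset
         *+ (t ^ #|` S| * (1 + t) ^ (n - 1 - 2 * #|` S|))%N in
  [/\ beta_proper k act1 = rhs1,
      beta_proper k act2 = rhs2
    & cohen_macaulay k P ->
      [/\ homology act1 k n = rhs1,
          homology act2 k n = rhs2
        & [/\ nonvirtual (beta_proper k act1),
              nonvirtual (beta_proper k act2),
              (forall S, S \in Stab (int_range 1 (n - 1)) ->
                 nonvirtual (betaP (int_range 1 n `\` S)%fset)) /\
              (forall S, S \in Stab (int_range 1 (n - 2)) ->
                 nonvirtual (betaP (int_range 1 (n - 1) `\` S)%fset))
            & (forall S, S \in Stab (int_range 2 (n - 2)) ->
                 nonvirtual (betaP (int_range 1 (n - 1) `\` S)%fset)) /\
              (forall S, S \in Stab (int_range 2 (n - 1)) ->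
                 nonvirtual (betaP (int_range 1 n `\` S)%fset))]]].
Proof.
move=> act1 act2 betaP rhs1 rhs2.
have rankedP := graded_ranked P_graded.
have rees1 := rees_over_lower t rankedP.
have rees2 := rees_over_proper t rankedP n_gt0.
have pr1 u g : proj_lower (act_adjoined act1 u g) = to (proj_lower u) g.
  by case: u => [|y|] //=; rewrite ?pact_bot ?pact_top.
have wd1 u g : word_lower (act_adjoined act1 u g) = word_lower u by case: u.
have pr2 u g : proj_proper (act_adjoined act2 u g) = to (proj_proper u) g.
  by case: u => [|y|] //=; rewrite ?pact_bot ?pact_top.
have wd2 u g : word_proper (act_adjoined act2 u g) = word_proper u by case: u.
have beta1 : beta_proper k act1 = rhs1.
  rewrite (beta_proper_rees k n_gt0 (leq0n 1) rankedP rees1 pr1 wd1).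
  by rewrite leqNgt n_gt0 /rhs1; under eq_bigr do rewrite subn0.
have beta2 : beta_proper k act2 = rhs2.
  (* In this formula the sum over the sets without n comes second. *)
  rewrite (beta_proper_rees k n_gt0 (leqnn 1) rankedP rees2 pr2 wd2) addrC /rhs2.
  by congr (_ + _); rewrite (_ : (n <= 1)%N = (n == 1%N)) //; lia.
split=> // cmP.
have liftP : lifting k n (\bot%O : P) \top%O.
  exact: (cohen_macaulay_lifting rankedP cmP (ranked_bot_lt_top rankedP)).
(* Under lifting, [beta] at any set S of proper ranks is the class of the module Z(S, S). *)
have nonvirt (S : {fset nat}) : (S `<=` int_range 1 n)%fset -> nonvirtual (betaP S).
  move=> sS; have S_lt i : i \in S -> (i < n.+2)%N.
    by move/(fsubsetP sS); rewrite in_int_range; lia.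
  rewrite /betaP -(fset_ofP S_lt) (beta_cycle_class to rankedP liftP).
    exact: nonvirtual_submodule_class.
  apply/subsetP=> i; rewrite !inE => /(fsubsetP sS); rewrite in_int_range; lia.
have hom1 : homology act1 k n = beta_proper k act1.
  exact: (homology_rees act1 n_gt0 (leq0n 1) rankedP rees1 liftP).
have hom2 : homology act2 k n = beta_proper k act2.
  exact: (homology_rees act2 n_gt0 (leqnn 1) rankedP rees2 liftP).
have sub (a : nat) (S : {fset nat}) : (a <= n)%N -> (int_range 1 a `\` S `<=` int_range 1 n)%fset.
  by move=> le_a; apply/fsubsetP=> i; rewrite in_fsetD !in_int_range => /andP[_]; lia.
split; [by rewrite hom1|by rewrite hom2|split].
- by rewrite -hom1; eexists; eexists.
- by rewrite -hom2; eexists; eexists.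
- by split=> S _; apply/nonvirt/sub; lia.
by split=> S _; apply/nonvirt/sub; lia.
Qed.
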